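(* If $E\subset\mathbb{R}^2$ is a locally $K$-quasiminimizing set, then $E$ is a $BV_l$ extension domain.
   Context: Here $K$ is a constant. For an open set $U\subset\mathbb{R}^2$ and measurable $E$, $\mathrm{Per}(E,U):=\sup\{\int_E \mathrm{div}\,\phi : \phi\in [C^1_c(U)]^2,\ \|\phi\|_\infty\le 1\}$; $E$ is of finite perimeter if $\mathrm{Per}(E,\mathbb{R}^2)<\infty$. $\partial E$ is the topological boundary of $E$ and $B_r(x)$ is the ball of radius $r$ centred at $x$. A set $E$ of finite perimeter is a $K$-quasiminimal set in an open set $\Omega$ if for all open $U\subset\subset\Omega$ (compactly contained) and all Borel sets $F,G\subset\subset U$ one has $\mathrm{Per}(E,U)\le K\,\mathrm{Per}((E\cup F)\setminus G,U)$. A set $E$ of finite perimeter is locally $K$-quasiminimizing if there exists $\delta>0$ such that for any $x\in\partial E$ the set $E$ is $K$-quasiminimal in $B_\delta(x)$; in the case where $E$ is bounded, $\delta$ can be chosen depending on $x$. A set $E$ of finite perimeter is a $BV_l$ extension domain if and only if there are constants $c\ge 1$ and $\delta>0$ such that whenever $u\in BV(E)$ is such that the diameter of the support of $u$ is smaller than $\delta$, there is a function $Tu\in BV(\mathbb{R}^2)$ such that $\|D\,Tu\|(\mathbb{R}^2)\le c\,\|Du\|(E)$ and $Tu=u$ on $E$. Here $BV(E)$ is the space of integrable functions of bounded variation on $E$, and $\|Du\|$ denotes the total variation measure of $u$.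
   Formalization: BV(E) and ‖Du‖(E) are taken on the essential interior of E (largest open set contained in E up to a null set; the interior when E is normalized), since for non-normalized E, e.g. a disc minus tiny circles shrinking to a point, the claim fails. *)

(* Defs.v *)
From HB Require Import structures.
From mathcomp Require Import all_boot all_order all_algebra.
From mathcomp Require Import all_classical all_reals all_analysis.
From mathcomp Require Import ring lra.
Set Implicit Arguments.
Unset Strict Implicit.
Unset Printing Implicit Defensive.
Import Order.TTheory GRing.Theory Num.Theory.
Import numFieldNormedType.Exports.
Local Open Scope classical_set_scope.
Local Open Scope ring_scope.

Notation plane R := (R * R)%type.

(* The completion of the product measure: its measurable sets are the Lebesgue
   measurable subsets of the plane, and not only the Borel sets. *)
Definition lebesgue2 {R : realType} :=
  @completed_measure_extension _ _ _ (@lebesgue_measure R \x @lebesgue_measure R)%E.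
HB.instance Definition _ (R : realType) := Measure.on (@lebesgue2 R).

Definition lebesgue_measurable {R : realType} (E : set (plane R)) : Prop :=
  measurable (E : set (caratheodory_type
                         ((@lebesgue_measure R \x @lebesgue_measure R)%E^*)%mu)).

Definition borel {R : realType} : set (set (plane R)) := <<s open >>.

(* The norm that the library puts on R * R is the sup norm. *)
Definition enorm {R : realType} (x : plane R) : R :=
  Num.sqrt (x.1 ^+ 2 + x.2 ^+ 2).

Definition eball {R : realType} (x : plane R) (r : R) : set (plane R) :=
  [set y | enorm (y - x) < r].

Definition boundary {R : realType} (E : set (plane R)) : set (plane R) :=
  closure E `\` E^°.

Definition compactly_contained {R : realType} (A U : set (plane R)) : Prop :=
  compact (closure A) /\ closure A `<=` U.

Definition C1 {R : realType} (phi : plane R -> plane R) : Prop :=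
  (forall x, differentiable phi x) /\ forall v, continuous ('D_v phi).

Definition divergence {R : realType} (phi : plane R -> plane R) (x : plane R) : R :=
  'D_(1, 0) (fun y => (phi y).1) x + 'D_(0, 1) (fun y => (phi y).2) x.

(* The fields of [C^1_c(U)]^2, extended by zero, of sup norm at most 1. *)
Definition test_field {R : realType} (U : set (plane R)) :
    set (plane R -> plane R) :=
  [set phi | [/\ C1 phi, compactly_contained [set x | phi x != 0] U &
                 forall x, enorm (phi x) <= 1]].

Definition perimeter {R : realType} (E U : set (plane R)) : \bar R :=
  ereal_sup [set (\int[lebesgue2]_(x in E) (divergence phi x)%:E)%E |
             phi in test_field U].

Definition finite_perimeter {R : realType} (E : set (plane R)) : Prop :=
  lebesgue_measurable E /\ (perimeter E setT < +oo)%E.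

Definition quasiminimal {R : realType} (K : R) (E Omega : set (plane R)) : Prop :=
  finite_perimeter E /\
  forall U F G : set (plane R),
    open U -> compactly_contained U Omega ->
    borel F -> compactly_contained F U ->
    borel G -> compactly_contained G U ->
    (perimeter E U <= K%:E * perimeter ((E `|` F) `\` G) U)%E.

Definition locally_quasiminimizing {R : realType} (K : R) (E : set (plane R)) :
    Prop :=
  finite_perimeter E /\
  ((exists2 delta : R, 0 < delta &
      forall x, boundary E x -> quasiminimal K E (eball x delta)) \/
   (bounded_set E /\
    forall x, boundary E x ->
      exists2 delta : R, 0 < delta & quasiminimal K E (eball x delta))).

Definition variation {R : realType} (u : plane R -> R) (U : set (plane R)) : \bar R :=
  ereal_sup [set (\int[lebesgue2]_(x in U) (u x * divergence phi x)%:E)%E |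
             phi in test_field U].

(* The largest open set contained in E up to a null set. *)
Definition ess_interior {R : realType} (E : set (plane R)) : set (plane R) :=
  [set x | exists2 r : R, 0 < r & lebesgue2 (eball x r `\` E) = 0%E].

Lemma eball_sub_ball {R : realType} (x : plane R) (r : R) :
  0 < r -> eball x r `<=` ball x r.
Proof.
move=> r0 y; rewrite /eball/= /enorm => h.
have aux (a b : R) : Num.sqrt (a ^+ 2 + b ^+ 2) < r -> `|a| < r /\ `|b| < r.
  move=> hab; split; apply: le_lt_trans hab; rewrite -sqrtr_sqr ler_wsqrtr//.
    by rewrite lerDl sqr_ge0.
  by rewrite lerDr sqr_ge0.
by have [h1 h2] := aux _ _ h; split; rewrite /ball/= distrC.
Qed.

Lemma lebesgue2_eball_gt0 {R : realType} (x : plane R) (r : R) :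
  0 < r -> (0 < lebesgue2 (eball x r))%E.
Proof.
move=> r0; pose s := r / 2.
have s0 : 0 < s by rewrite divr_gt0.
pose B := `]x.1 - s, x.1 + s[%classic `*` `]x.2 - s, x.2 + s[%classic : set (plane R).
have BE : B `<=` eball x r.
  move=> [a b] [/=]; rewrite !in_itv/= => /andP[a1 a2] /andP[b1 b2].
  rewrite /eball/= /enorm/=.
  have sq (c d : R) : d - s < c -> c < d + s -> (c - d) ^+ 2 < s ^+ 2.
    by move=> c1 c2; nra.
  rewrite -(gtr0_norm r0) -sqrtr_sqr ltr_sqrt ?exprn_gt0//.
  have := sq _ _ a1 a2; have := sq _ _ b1 b2; rewrite /s; nra.
have mB : measurable (B : set (measurableTypeR R * measurableTypeR R)).
  by apply: measurableX; exact: measurable_itv.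
apply: (@lt_le_trans _ _ (lebesgue2 B)); last exact: le_outer_measure.
rewrite /lebesgue2 /completed_measure_extension measurable_mu_extE//=.
rewrite /B product_measure1E//=; [|exact: measurable_itv..].
rewrite !lebesgue_measure_itv/= !lte_fin.
rewrite !ifT; [|lra..].
by rewrite -!EFinB -EFinM lte_fin mulr_gt0//; lra.
Qed.

Lemma ess_interiorT {R : realType} : ess_interior [set: plane R] = setT.
Proof.
by apply/seteqP; split=> // x _; exists 1 => //; rewrite setDT measure0.
Qed.

Lemma ess_interiorE {R : realType} (E : set (plane R)) :
  (forall x r, boundary E x -> 0 < r -> lebesgue2 (eball x r `\` E) <> 0%E) ->
  ess_interior E = E^°.
Proof.
move=> hE; apply/seteqP; split=> x.
  move=> [r r0 hr]; have [//|nEx] := pselect (E^° x).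
  have [cEx|] := pselect (closure E x); first by case: (hE x r).
  rewrite -[~ closure E x]/((~` closure E) x) -interiorC.
  move=> /nbhs_ballP[e /= e0 eE].
  have m0 : 0 < Num.min e r by rewrite lt_min e0.
  have := lebesgue2_eball_gt0 x m0; rewrite -hr ltNge => /negP; case.
  apply: le_outer_measure => y; rewrite /eball/= lt_min => /andP[ye yr].
  by split=> //; apply: eE; exact: eball_sub_ball.
move=> /nbhs_ballP[e /= e0 eE]; exists e => //.
rewrite (_ : _ `\` _ = set0) ?measure0//.
by apply/seteqP; split=> // y [/(eball_sub_ball e0)/eE].
Qed.

(* Since E is only determined up to null sets, BV(E) and ||Du||(E) are those of
   the open set ess_interior E. It is the interior of E if |B_r(x) \ E| > 0 for
   all boundary points x of E and all r > 0, which the usual normalization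
   of E by a null set ensures. For a set that is not normalized the interior
   would not do: a locally quasiminimizing set could lose the extension property
   by the removal of a null set, such as a dense countable set or a suitable
   sequence of circles shrinking to a point. *)
Definition BV {R : realType} (E : set (plane R)) : set (plane R -> R) :=
  [set u : plane R -> R | lebesgue2.-integrable E (EFin \o u) /\
           (variation u (ess_interior E) < +oo)%E].

Definition ediam {R : realType} (A : set (plane R)) : \bar R :=
  ereal_sup [set (enorm (x - y))%:E | x in A & y in A].

Definition support_in {R : realType} (E : set (plane R)) (u : plane R -> R) :
    set (plane R) :=
  closure [set x | E x /\ u x != 0].

Definition BVl_extension_domain {R : realType} (E : set (plane R)) : Prop :=
  finite_perimeter E /\
  exists c delta : R, [/\ 1 <= c, 0 < delta &
    forall u : plane R -> R,
      BV E u -> (ediam (support_in E u) < delta%:E)%E ->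
      exists Tu : plane R -> R,
        [/\ BV setT Tu,
            (variation Tu setT <= c%:E * variation u (ess_interior E))%E &
            {ae lebesgue2, forall x, E x -> Tu x = u x}]].

(* Main.v *)
(** Up to a null set, E is the open set Om of its essential interior points. The
    coarea inequality turns quasiminimality into a Caccioppoli inequality, and De
    Giorgi iteration then gives lower density bounds for E and its complement at
    small scales.

    Let F be a subset of Om of small diameter and perimeter p in Om. The C^1
    function v that interpolates the density ratios |F n Q| / |E n Q| on a grid of
    mesh h tends to the indicator of F on E, and the integral of |grad v| over E is
    at most C / h times the measure of the points x of F with x + w in E \ F, for
    some |w| <= C h. If the segment from x to x + w stays in Om, p controls this
    measure, by C p h. Otherwise the complement of E has positive density near x,
    and one counts triples of points of the three phases F, E \ F and the
    complement of E. On a square lattice on whose lines each phase begins or ends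
    at most once there is at most one such corner; comparing the scales h and n h
    shows that the measure of the triples is o(h). Hence the integral of |grad v|
    over E is at most C p in the limit, and quasiminimality of E, applied to the
    superlevel sets of v, bounds the perimeter of F in the whole plane by C p.

    The coarea inequality carries this over from sets to functions, whose extension
    by zero is the required one. *)
Require Import Defs.
From HB Require Import structures.
From mathcomp Require Import all_boot all_order all_algebra.
From mathcomp Require Import all_classical all_reals all_analysis measurable_realfun.
From mathcomp Require Import ring lra zify.
Set Implicit Arguments.
Unset Strict Implicit.
Unset Printing Implicit Defensive.
Import Order.TTheory GRing.Theory Num.Theory.
Import numFieldNormedType.Exports.
Local Open Scope classical_set_scope.
Local Open Scope ring_scope.

(** * Measure and translations *)

(** No structure theory of sets of finite perimeter is used. A perimeter bound is a bound [varle] on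
    integrals against test fields, and it acts through translations: [A] and its translate by [y]
    differ by at most [2 |y|] times the perimeter. Tonelli in the translation then replaces
    isoperimetric inequalities. The obstacle is a set F that reaches the boundary of Om: its
    perimeter in Om ignores that contact, so a translation estimate with constant p holds only along
    segments in Om. For the other pairs one needs that points where three phases meet are negligible
    for length. The lattice count is an elementary form of this: the translation quotients of each
    phase are bounded and monotone along dyadic scales, hence nearly equal at h and n h, which
    leaves little room for lines with two changes and for corners. Quasiminimality enters only
    through [varle_gt1]: with a cutoff it is the Caccioppoli inequality; with the density ratios it
    bounds the perimeter of E where 3 v > 1, a set containing the support of the step function of v
    that multiplies an arbitrary field. *)

Notation mplane R := (measurableTypeR R * measurableTypeR R)%type.

(** The measure on the Borel sigma-algebra of the product. The analysis is done here; the completed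
    measure [lebesgue2] of the statement is reached at the end, up to null sets. *)
Definition mu {R : realType} : set (mplane R) -> \bar R :=
  (@lebesgue_measure R \x @lebesgue_measure R)%E.
HB.instance Definition _ (R : realType) := Measure.on (@mu R).
Definition bset {R : realType} (A : set (plane R)) : Prop :=
  measurable (A : set (mplane R)).

Definition bfun {R : realType} (f : plane R -> R) : Prop :=
  measurable_fun setT (f : mplane R -> R).

Section measure_plane.
Context {R : realType}.
Implicit Types (x y : plane R) (A : set (plane R)).

Lemma bsetI A B : bset A -> bset B -> bset (A `&` B).
Proof. exact: measurableI. Qed.

Lemma bsetU A B : bset A -> bset B -> bset (A `|` B).
Proof. exact: measurableU. Qed.

Lemma bsetD A B : bset A -> bset B -> bset (A `\` B).
Proof. exact: measurableD. Qed.

Lemma bsetC A : bset A -> bset (~` A).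
Proof. exact: measurableC. Qed.

Lemma ex_natSinv_lt (e : R) : 0 < e -> exists n : nat, n.+1%:R^-1 < e.
Proof.
by move=> e0; have [n /= ne] := filter_ex (near_infty_natSinv_lt (PosNum e0)); exists n.
Qed.

Lemma plane_ballE x (r : R) : ball x r = ball x.1 r `*` ball x.2 r.
Proof. by apply/seteqP; split=> [[a b]|[a b]]. Qed.

Lemma bset_ball x r : bset (ball x r).
Proof.
by rewrite plane_ballE !ball_itv; apply: measurableX; exact: measurable_itv.
Qed.

Definition rball (q : rat * rat * nat) : set (plane R) :=
  ball (ratr q.1.1 : R, ratr q.1.2 : R) q.2.+1%:R^-1.

(** A rational centre within [k < r / 2] of [x] gives a ball around [x] inside the given one. [Q] is
    abstract because it serves twice: for balls inside an open set, and for balls that lie in a set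
    up to a null set. *)
Lemma ex_rball (Q : set (plane R) -> Prop) x (r : R) :
  (forall B B', B `<=` B' -> Q B' -> Q B) -> 0 < r -> Q (ball x r) ->
  exists2 q, Q (rball q) & rball q x.
Proof.
move=> QS e0 Qx.
have [n n2] : exists n : nat, (n.+1%:R^-1 : R) < r / 2.
  by apply: ex_natSinv_lt; lra.
have n0 : 0 < (n.+1%:R^-1 : R) by rewrite invr_gt0.
have [k kE] : exists k : R, n.+1%:R^-1 = k by eexists.
rewrite kE in n0 n2; have lt_nat (t : R) : t - k < t by lra.
have [a] := rat_in_itvoo (lt_nat x.1); have [b] := rat_in_itvoo (lt_nat x.2).
rewrite !in_itv/= => /andP[b1 b2] /andP[a1 a2].
exists (a, b, n); rewrite /rball /= kE; last first.
  by split => /=; rewrite /ball/= ltr_norml; apply/andP; split; lra.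
apply: QS Qx => -[z1 z2] [/=]; rewrite /ball/= !ltr_norml => /andP[za1 za2] /andP[zb1 zb2].
by split; rewrite /ball /= ltr_norml; apply/andP; split; lra.
Qed.

Lemma bset_open (U : set (plane R)) : open U -> bset U.
Proof.
move=> oU; have -> : U = \bigcup_(q in [set q | rball q `<=` U]) rball q.
  apply/seteqP; split=> [x Ux|x [q qU]]; last exact: qU.
  have /nbhs_ballP[e /= e0 xeU] := open_nbhs_nbhs (conj oU Ux).
  have [B B' BB' B'U|q qU qx] := @ex_rball (fun B => B `<=` U) x e _ e0 xeU.
    exact: subset_trans B'U.
  by exists q.
rewrite bigcup_mkcond; apply: (@countable_bigcupT_measurable _ (mplane R)) => // q.
by case: ifPn => _; [exact: bset_ball|exact: measurable0].
Qed.

Lemma lebesgue_measure_shift (B : set R) (b : R) :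
  measurable (B : set (measurableTypeR R)) ->
  lebesgue_measure [set t | B (t + b)] = lebesgue_measure B.
Proof.
move=> mB.
have ms : measurable_fun setT ((fun t => t + b) : measurableTypeR R -> measurableTypeR R).
  exact: measurable_funD.
pose s : {mfun measurableTypeR R >-> measurableTypeR R} :=
  HB.pack ((fun t => t + b) : measurableTypeR R -> measurableTypeR R)
          (isMeasurableFun.Build _ _ _ _ _ ms).
apply/esym; rewrite (@lebesgue_measure_unique _ (pushforward lebesgue_measure s))//.
move=> _ [[c d] _ <-]; rewrite /pushforward.
rewrite [X in _ = lebesgue_measure X](_ : _ = `]c - b, d - b]%classic); last first.
  by apply/seteqP; split=> t; rewrite /= !in_itv/= ltrBlDr lerBrDr.
by rewrite !lebesgue_measure_itv/= !lte_fin ltrD2r -!EFinB opprB addrA subrK.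
Qed.

Lemma mu_ball x (r : R) : 0 <= r -> mu (ball x r) = ((2 * r) ^+ 2)%:E.
Proof.
move=> r0; rewrite plane_ballE /mu product_measure1E//.
- transitivity ((r *+ 2)%:E * (r *+ 2)%:E)%E.
    by congr (_ * _)%E; exact: lebesgue_measure_ball.
  by rewrite [2 * r]mulr_natl expr2 EFinM.
- have -> : ball x.1 r = `]x.1 - r, x.1 + r[%classic by rewrite ball_itv.
  exact: measurable_itv.
- have -> : ball x.2 r = `]x.2 - r, x.2 + r[%classic by rewrite ball_itv.
  exact: measurable_itv.
Qed.

Lemma sigma_finite_mu : sigma_finite setT (@mu R).
Proof.
exists (fun n => ball (0 : plane R) n%:R) => [|n]; last first.
  by split; [exact: bset_ball|rewrite mu_ball// ltry].
apply/seteqP; split => // x _; exists (Num.truncn `|x|).+1 => //.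
by rewrite -ball_normE /= sub0r normrN truncnS_gt.
Qed.

End measure_plane.

HB.instance Definition _ (R : realType) :=
  @Measure_isSigmaFinite.Build _ _ _ (@mu R) sigma_finite_mu.

Section measure_plane.
Context {R : realType}.
Implicit Types (x y : plane R) (A : set (plane R)).

Lemma measurable_shift y :
  measurable_fun setT ((fun x => x + y) : mplane R -> mplane R).
Proof.
apply: (@measurable_fun_pair _ _ _ (mplane R) (measurableTypeR R)
  (measurableTypeR R) (fun x => x.1 + y.1) (fun x => x.2 + y.2)).
  exact: (@measurable_funD _ (mplane R) R setT fst (cst y.1)).
exact: (@measurable_funD _ (mplane R) R setT snd (cst y.2)).
Qed.

Lemma bset_shift A y : bset A -> bset [set x | A (x + y)].
Proof. by move=> mA; rewrite /bset -[X in measurable X]setTI; exact: measurable_shift. Qed.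

Lemma mu_shift A y : bset A -> mu [set x | A (x + y)] = mu A.
Proof.
move=> mA.
pose s : {mfun mplane R >-> mplane R} :=
  HB.pack ((fun x => x + y) : mplane R -> mplane R)
          (isMeasurableFun.Build _ _ _ _ _ (measurable_shift y)).
apply/esym; apply: (@product_measure_unique _ _ _ _ _ _ _ (pushforward mu s)) => //.
move=> B C mB mC; rewrite /pushforward.
transitivity (mu ([set t | B (t + y.1)] `*` [set t | C (t + y.2)])) => //.
rewrite /mu product_measure1E//=; first by rewrite !lebesgue_measure_shift.
- by rewrite -[X in measurable X]setTI; apply: (@measurable_funD _ (measurableTypeR R) R).
- by rewrite -[X in measurable X]setTI; apply: (@measurable_funD _ (measurableTypeR R) R).
Qed.

Lemma ge0_integral_shift (f : plane R -> \bar R) y :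
  measurable_fun setT (f : mplane R -> \bar R) -> (forall x, 0 <= f x)%E ->
  (\int[mu]_x f (x + y)%R = \int[mu]_x f x)%E.
Proof.
move=> mf f0.
pose s : {mfun mplane R >-> mplane R} :=
  HB.pack ((fun x => x + y) : mplane R -> mplane R)
          (isMeasurableFun.Build _ _ _ _ _ (measurable_shift y)).
transitivity (\int[pushforward mu s]_x f x)%E.
  by rewrite (ge0_integral_pushforward (measurable_shift y) mu measurableT mf).
by apply: eq_measure_integral => A mA _; exact: mu_shift.
Qed.

Lemma bfunS f y : bfun f -> bfun (fun x => f (x + y)).
Proof. by move=> mf; exact: (measurableT_comp mf (measurable_shift y)). Qed.

Lemma bfun_indic A : bset A -> bfun (\1_A).
Proof. exact: measurable_indic. Qed.

Lemma bset_preimage f (B : set R) : bfun f -> measurable B -> bset (f @^-1` B).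
Proof. by move=> mf mB; rewrite /bset -[X in measurable X]setTI; exact: mf. Qed.

Lemma ball_addr x (r : R) w : ball x r (w + x) = ball 0 r w.
Proof. by rewrite -!ball_normE /ball_ /= opprD addrCA subrr addr0 sub0r. Qed.

(* Averaging in the translation: Tonelli for the pairs (x, x + w). *)
Lemma tonelli_ball (X Y : set (plane R)) (r : R) (M : \bar R) :
  bset X -> bset Y -> 0 <= r -> (0 <= M)%E ->
  (forall w, ball (0%R : plane R) r w -> mu (X `&` [set x | Y (x + w)%R]) <= M)%E ->
  (\int[mu]_(x in X) mu (Y `&` ball x r) <= M * ((2 * r) ^+ 2)%:E)%E.
Proof.
move=> mX mY r0 M0 XYM.
pose Z : set (plane R * plane R) :=
  [set p | [/\ X p.1, ball 0 r p.2 & Y (p.1 + p.2)%R]].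
have mZ : measurable (Z : set (mplane R * mplane R)).
  have -> : Z = ((fst @^-1` X) `&` (snd @^-1` (ball 0 r))) `&`
      ((fun p => p.1 + p.2) @^-1` Y).
    by apply/seteqP; split=> [p [? ? ?]|p [[]]].
  apply: measurableI; first apply: measurableI.
  - by rewrite -[X in measurable X]setTI; exact: (@measurable_fst _ _ (mplane R) (mplane R)).
  - rewrite -[X in measurable X]setTI.
    by apply: (@measurable_snd _ _ (mplane R) (mplane R)) => //; exact: bset_ball.
  - have ma : measurable_fun setT ((fun p => p.1 + p.2) : mplane R * mplane R -> mplane R).
      apply: (@measurable_fun_pair _ _ _ (mplane R * mplane R)%type (measurableTypeR R)
        (measurableTypeR R) (fun p => p.1.1 + p.2.1) (fun p => p.1.2 + p.2.2)).
        apply: (@measurable_funD _ (mplane R * mplane R)%type R setT (fst \o fst) (fst \o snd)).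
          by apply: measurableT_comp; exact: measurable_fst.
        by apply: measurableT_comp; [exact: measurable_fst|exact: measurable_snd].
      apply: (@measurable_funD _ (mplane R * mplane R)%type R setT (snd \o fst) (snd \o snd)).
        by apply: measurableT_comp; [exact: measurable_snd|exact: measurable_fst].
      by apply: measurableT_comp; exact: measurable_snd.
    by rewrite -[X in measurable X]setTI; exact: ma.
have FG : (\int[mu]_x (mu \o xsection Z) x = \int[mu]_y (mu \o ysection Z) y)%E.
  transitivity (\int[mu]_x fubini_F mu (EFin \o \1_Z) x)%E.
    apply: eq_integral => x _.
    exact: (esym (congr1 (fun f => f x) (@indic_fubini_tonelli_FE _ _ (mplane R) (mplane R) R mu Z mZ))).
  transitivity (\int[mu]_y fubini_G mu (EFin \o \1_Z) y)%E.
    exact: (@indic_fubini_tonelli _ _ (mplane R) (mplane R) R mu mu Z mZ).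
  apply: eq_integral => x _.
  exact: (congr1 (fun f => f x) (@indic_fubini_tonelli_GE _ _ (mplane R) (mplane R) R mu Z mZ)).
rewrite integral_mkcond.
have -> : (\int[mu]_x ((fun x => mu (Y `&` ball x r)) \_ X) x =
    \int[mu]_x (mu \o xsection Z) x)%E.
  apply: eq_integral => x _; rewrite patchE /=.
  case: ifPn => [/set_mem Xx|/negP nXx]; last first.
    transitivity (mu (set0 : set (mplane R))); first by rewrite measure0.
    congr (mu _); apply/seteqP; split=> [w []|w /set_mem[/= Xx _ _]].
    by case: nXx; exact/mem_set.
  have <- := @mu_shift (Y `&` ball x r) x; last first.
    exact: bsetI mY (bset_ball x r).
  congr (mu _); apply/seteqP; split=> w.
    move=> [Yw bw]; apply/mem_set; split; [exact: Xx|by rewrite -(ball_addr x)|].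
    by move: Yw; rewrite addrC.
  move=> /set_mem[_ bw Yw]; split; [|by rewrite ball_addr].
  by move: Yw; rewrite addrC.
rewrite FG.
have mb : bset (ball (0 : plane R) r) by exact: bset_ball.
apply: (@le_trans _ _ (\int[mu]_w (M * (\1_(ball (0%R : plane R) r) w)%:E)))%E.
  apply: ge0_le_integral.
  - exact: measurableT.
  - by move=> w _; exact: measure_ge0.
  - exact: (@measurable_fun_ysection _ _ (mplane R) (mplane R) R mu Z mZ).
  - apply: emeasurable_funM; first exact: measurable_cst.
    by apply/measurable_EFinP; exact: bfun_indic.
  move=> w _ /=; rewrite indicE.
  have [bw|nbw] := pselect (ball 0 r w).
    rewrite (mem_set bw) mule1.
    suff -> : mu (ysection Z w) = mu (X `&` [set x | Y (x + w)]) by exact: XYM.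
    congr (mu _).
    apply/seteqP; split=> [x /set_mem[Xx _ Yx]|x [Xx Yx]].
      by split; [exact: Xx|exact: Yx].
    by apply/mem_set; split; [exact: Xx|exact: bw|exact: Yx].
  rewrite (memNset nbw) mule0.
  suff -> : mu (ysection Z w) = mu (set0 : set (mplane R)) by rewrite measure0.
  congr (mu _).
  by apply/seteqP; split=> [x /set_mem[_ /nbw]|x []].
have m1 : measurable_fun setT
    ((fun w => (\1_(ball (0 : plane R) r) w)%:E) : mplane R -> \bar R).
  by apply/measurable_EFinP; exact: bfun_indic.
have p1 w : setT w -> (0 <= (\1_(ball (0%R : plane R) r) w)%:E :> \bar R)%E.
  by move=> _; rewrite lee_fin.
rewrite (ge0_integralZl _ measurableT m1 p1 M0).
rewrite le_eqVlt; apply/orP; left; apply/eqP; congr (M * _)%E.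
by rewrite (integral_indic _ measurableT mb) setIT; exact: mu_ball.
Qed.

End measure_plane.

(** * Functions of class C^1 *)

Section c1.
Context {R : realType}.
Implicit Types (f g : plane R -> R) (phi : plane R -> plane R) (x v : plane R).

Definition c1 f : Prop :=
  (forall x, differentiable f x) /\ forall v, continuous ('D_v f).

Lemma c1_continuous f : c1 f -> continuous f.
Proof. by move=> [df _] x; exact: differentiable_continuous. Qed.

Lemma c1_cst (a : R) : c1 (cst a).
Proof.
split=> [x|v]; first exact: differentiable_cst.
have -> : 'D_v (cst a : plane R -> R) = cst 0.
  by apply/funext => x; exact: derive_cst.
by move=> x; exact: cvg_cst.
Qed.

Let fst_linear : linear (fst : plane R -> R).
Proof. by []. Qed.

Let snd_linear : linear (snd : plane R -> R).
Proof. by []. Qed.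

Let fstL : {linear plane R -> R} :=
  HB.pack (fst : plane R -> R) (GRing.isLinear.Build _ _ _ _ _ fst_linear).
Let sndL : {linear plane R -> R} :=
  HB.pack (snd : plane R -> R) (GRing.isLinear.Build _ _ _ _ _ snd_linear).

Lemma continuous_fst : continuous (fst : plane R -> R).
Proof. by move=> x; exact: cvg_fst. Qed.

Lemma continuous_snd : continuous (snd : plane R -> R).
Proof. by move=> x; exact: cvg_snd. Qed.

Let diff_fst x : differentiable (fst : plane R -> R) x.
Proof. exact: (@linear_differentiable _ _ _ fstL x continuous_fst). Qed.

Let diff_snd x : differentiable (snd : plane R -> R) x.
Proof. exact: (@linear_differentiable _ _ _ sndL x continuous_snd). Qed.

Lemma derive_fst v x : 'D_v (fst : plane R -> R) x = v.1.
Proof.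
by rewrite deriveE//; have -> := @diff_lin _ _ _ fstL x continuous_fst.
Qed.

Lemma derive_snd v x : 'D_v (snd : plane R -> R) x = v.2.
Proof.
by rewrite deriveE//; have -> := @diff_lin _ _ _ sndL x continuous_snd.
Qed.

Lemma c1_fst : c1 fst.
Proof.
split=> // v; rewrite (_ : 'D_v _ = cst v.1); first by move=> x; exact: cvg_cst.
by apply/funext => x; rewrite derive_fst.
Qed.

Lemma c1_snd : c1 snd.
Proof.
split=> // v; rewrite (_ : 'D_v _ = cst v.2); first by move=> x; exact: cvg_cst.
by apply/funext => x; rewrite derive_snd.
Qed.

Lemma c1_derivable f x v : c1 f -> derivable f x v.
Proof. by move=> [df _]; exact: diff_derivable. Qed.

Lemma c1D f g : c1 f -> c1 g -> c1 (f \+ g).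
Proof.
move=> cf cg; split=> [x|v]; first exact: (differentiableD (cf.1 x) (cg.1 x)).
rewrite (_ : 'D_v _ = 'D_v f \+ 'D_v g); last first.
  by apply/funext => x; apply: deriveD; exact: c1_derivable.
by move=> x; apply: cvgD; [exact: cf.2|exact: cg.2].
Qed.

Lemma c1N f : c1 f -> c1 (\- f).
Proof.
move=> cf; split=> [x|v]; first exact: (differentiableN (cf.1 x)).
rewrite (_ : 'D_v _ = \- 'D_v f); last first.
  by apply/funext => x; apply: deriveN; exact: c1_derivable.
by move=> x; apply: cvgN; exact: cf.2.
Qed.

Lemma c1B f g : c1 f -> c1 g -> c1 (f \- g).
Proof. by move=> cf cg; exact: (c1D cf (c1N cg)). Qed.

Lemma c1_deriveM f g v x : c1 f -> c1 g ->
  'D_v (f \* g) x = f x * 'D_v g x + g x * 'D_v f x.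
Proof. by move=> cf cg; apply: deriveM; exact: c1_derivable. Qed.

Lemma c1M f g : c1 f -> c1 g -> c1 (f \* g).
Proof.
move=> cf cg; split=> [x|v]; first exact: (differentiableM (cf.1 x) (cg.1 x)).
rewrite (_ : 'D_v _ = (f \* 'D_v g) \+ (g \* 'D_v f)); last first.
  by apply/funext => x; exact: c1_deriveM.
by move=> x; apply: cvgD; apply: cvgM;
  [exact: c1_continuous|exact: cg.2|exact: c1_continuous|exact: cf.2].
Qed.

Lemma c1_sum (I : Type) (s : seq I) (F : I -> plane R -> R) :
  (forall i, c1 (F i)) -> c1 (fun x => \sum_(i <- s) F i x).
Proof.
move=> cF; elim: s => [|i s ih].
  rewrite (_ : (fun _ => _) = cst 0); first exact: c1_cst.
  by apply/funext => x; rewrite big_nil.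
rewrite (_ : (fun _ => _) = F i \+ (fun x => \sum_(j <- s) F j x)); first exact: c1D.
by apply/funext => x; rewrite big_cons.
Qed.

Lemma c1_comp (h h' : R -> R) f : (forall t : R, is_derive t 1 h (h' t)) ->
  continuous h' -> c1 f -> c1 (h \o f).
Proof.
move=> dh ch cf.
have dfh t : differentiable h t by apply/derivable1_diffP; exact: ex_derive.
have E v : 'D_v (h \o f) = (h' \o f) \* 'D_v f.
  apply/funext => x /=; rewrite deriveE; last exact: (differentiable_comp (cf.1 x)).
  rewrite diff_comp//=; last exact: cf.1.
  rewrite [in RHS]deriveE; last exact: cf.1.
  by rewrite diff1E// derive1E derive_val /= mulrC.
split=> [x|v]; first exact: (differentiable_comp (cf.1 x)).
rewrite E => x; apply: cvgM; last exact: cf.2.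
by apply: continuous_comp; [exact: c1_continuous|exact: ch].
Qed.

Lemma c1_derive_lin f v x : c1 f ->
  'D_v f x = v.1 * 'D_(1, 0) f x + v.2 * 'D_(0, 1) f x.
Proof.
move=> cf; rewrite !deriveE; [|exact: cf.1..].
rewrite -[_ * _]/(v.1 *: _) -[v.2 * _]/(v.2 *: _) -!linearZ -linearD.
congr ('d f x _); apply: injective_projections;
  by rewrite /= /GRing.scale/= ?mulr0 ?mulr1 ?addr0 ?add0r.
Qed.

Lemma C1P phi : C1 phi <-> c1 (fst \o phi) /\ c1 (snd \o phi).
Proof.
split=> [[dp cp]|[[d1 k1] [d2 k2]]].
  have E1 v : 'D_v (fst \o phi) = fst \o 'D_v phi.
    apply/funext => x /=; rewrite deriveE; last exact: differentiable_comp.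
    rewrite diff_comp//=; have -> := @diff_lin _ _ _ fstL (phi x) continuous_fst.
    by rewrite deriveE.
  have E2 v : 'D_v (snd \o phi) = snd \o 'D_v phi.
    apply/funext => x /=; rewrite deriveE; last exact: differentiable_comp.
    rewrite diff_comp//=; have -> := @diff_lin _ _ _ sndL (phi x) continuous_snd.
    by rewrite deriveE.
  split; split=> [x|v]; try exact: differentiable_comp.
    by rewrite E1 => x; apply: continuous_comp; [exact: cp|exact: continuous_fst].
  by rewrite E2 => x; apply: continuous_comp; [exact: cp|exact: continuous_snd].
have phiE : phi = fun x => ((fst \o phi) x, (snd \o phi) x).
  by apply/funext => x; rewrite /=; case: (phi x).
have E v : 'D_v phi = fun x => ('D_v (fst \o phi) x, 'D_v (snd \o phi) x).
  apply/funext => x; rewrite [in LHS]phiE deriveE; last exact: differentiable_pair.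
  by rewrite diff_pair// !deriveE.
split=> [x|v]; first by rewrite phiE; exact: differentiable_pair.
by rewrite E => x; exact: (cvg_pair (k1 v x) (k2 v x)).
Qed.

End c1.

(** * Quadratic splines *)

Section spline.
Context {R : realType}.
Implicit Types (t s : R).

(** The expansions at [t] and at [s], each evaluated at the other point, add up to
    [(t - s) (H' t - H' s)], so [H'] is Lipschitz. For a piecewise quadratic function this avoids a
    separate treatment of the knots. *)
Lemma quad_derive (H H' : R -> R) (C : R) :
  (forall t h, `|H (t + h) - H t - h * H' t| <= C * h ^+ 2) ->
  (forall t, is_derive t 1 H (H' t)) /\ continuous H'.
Proof.
move=> Hq.
have C0 : 0 <= C by have := Hq 0 1; rewrite expr1n mulr1; apply: le_trans.
split=> t.
  have cv : (fun h => h^-1 *: ((H \o shift t) (h *: (1 : R)) - H t)) @ 0^' --> H' t.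
    apply/cvgrPdist_le => e e0; near=> h.
    have h0 : h != 0 by near: h; exact: nbhs_dnbhs_neq.
    have hC : `|h| <= e / (C + 1).
      near: h; apply: dnbhs0_le; rewrite divr_gt0//; lra.
    rewrite /= /GRing.scale /= mulr1 [h + t]addrC.
    have -> : H' t - h^-1 * (H (t + h) - H t) = - h^-1 * (H (t + h) - H t - h * H' t).
      by field.
    rewrite normrM normrN normfV; have hp : 0 < `|h| by rewrite normr_gt0.
    rewrite -ler_pdivlMl ?invr_gt0// invrK; apply: le_trans (Hq t h) _.
    rewrite -real_normK ?num_real// expr2 mulrA mulrC ler_wpM2l//.
    have : `|h| * (C + 1) <= e by rewrite -ler_pdivlMr//; lra.
    by apply: le_trans; rewrite mulrC ler_wpM2l//; lra.
  by split; [exact: (cvgP _ cv)|exact: (cvg_lim _ cv)].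
have lip s : `|H' t - H' s| <= 2 * C * `|t - s|.
  have [->|ts] := eqVneq t s; first by rewrite !subrr normr0 mulr0.
  have q1 := Hq s (t - s); have q2 := Hq t (s - t).
  rewrite !subrKC in q1 q2.
  have ts0 : 0 < `|t - s| by rewrite normr_gt0 subr_eq0.
  rewrite -(ler_pM2l ts0) -normrM.
  have -> : (t - s) * (H' t - H' s) =
    (H t - H s - (t - s) * H' s) + (H s - H t - (s - t) * H' t) by ring.
  rewrite (le_trans (ler_normD _ _))//.
  have -> : `|t - s| * (2 * C * `|t - s|) = C * (t - s) ^+ 2 + C * (s - t) ^+ 2.
    rewrite -(opprB t s) sqrrN -[(t - s) ^+ 2]real_normK ?num_real//; ring.
  exact: lerD.
apply/cvgrPdist_le => e e0; near=> s.
apply: le_trans (lip s) _.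
have sd : `|t - s| <= e / (2 * C + 1).
  near: s; apply: cvgr_dist_le; first exact: cvg_id.
  by rewrite divr_gt0//; lra.
have : `|t - s| * (2 * C + 1) <= e by rewrite -ler_pdivlMr//; lra.
by apply: le_trans; rewrite mulrC ler_wpM2l//; lra.
Unshelve. all: by end_near. Qed.

Let p t : R := Num.max t 0 ^+ 2.
Let p' t : R := 2 * Num.max t 0.

Let p_quad t h : `|p (t + h) - p t - h * p' t| <= h ^+ 2.
Proof.
rewrite /p /p'; case: (leP (t + h) 0) => ?; case: (leP t 0) => ?;
  rewrite ler_norml; apply/andP; split; nra.
Qed.

(* A C^{1,1} step from 0 to 1 on [0, 1], given by quadratic splines. *)
Definition step t : R := 2 * (p t - 2 * p (t - 2^-1) + p (t - 1)).
Definition step' t : R := 2 * (p' t - 2 * p' (t - 2^-1) + p' (t - 1)).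

Lemma step_quad t h : `|step (t + h) - step t - h * step' t| <= 8 * h ^+ 2.
Proof.
have h1 := p_quad t h; have h2 := p_quad (t - 2^-1) h; have h3 := p_quad (t - 1) h.
rewrite /step /step'; rewrite (addrAC t) in h2; rewrite (addrAC t) in h3.
move: (p (t + h)) (p t) (p' t) (p (t + h - 2^-1)) (p (t - 2^-1)) (p' (t - 2^-1))
  (p (t + h - 1)) (p (t - 1)) (p' (t - 1)) h1 h2 h3 => a1 a2 a3 b1 b2 b3 d1 d2 d3.
rewrite !ler_norml => /andP[? ?] /andP[? ?] /andP[? ?]; apply/andP; split; lra.
Qed.

Lemma step_le0 t : t <= 0 -> step t = 0.
Proof.
move=> t0; rewrite /step /p !max_r//; [|lra..].
by rewrite expr0n /= mulr0 subrr addr0 mulr0.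
Qed.

Lemma step_half1 t : 0 <= t <= 2^-1 -> step t = 2 * t ^+ 2.
Proof.
move=> /andP[t0 t1]; rewrite /step /p (max_l t0) !max_r//; [|lra..].
by rewrite expr0n /= mulr0 subr0 addr0.
Qed.

Lemma step_half2 t : 2^-1 <= t <= 1 -> step t = 1 - 2 * (1 - t) ^+ 2.
Proof.
move=> /andP[t0 t1]; rewrite /step /p.
have -> : Num.max t 0 = t by rewrite max_l//; lra.
have -> : Num.max (t - 2^-1) 0 = t - 2^-1 by rewrite max_l//; lra.
have -> : Num.max (t - 1) 0 = 0 by rewrite max_r//; lra.
by field.
Qed.

Lemma step_ge1 t : 1 <= t -> step t = 1.
Proof.
move=> t1; rewrite /step /p !max_l; [|lra..].
by field.
Qed.

Lemma step_nd s t : s <= t -> 0 <= step t - step s <= 2 * (t - s).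
Proof.
move=> st; case: (leP t 0) => t0.
  by rewrite !step_le0//; lra.
case: (leP s 0) => s0.
  rewrite (step_le0 s0); case: (leP t 2^-1) => t1.
    by rewrite step_half1 ?(ltW t0)//; apply/andP; split; nra.
  case: (leP t 1) => t2.
    by rewrite step_half2 ?(ltW t1)//; apply/andP; split; nra.
  by rewrite step_ge1 ?(ltW t2)//; lra.
case: (leP t 2^-1) => t1.
  rewrite !step_half1; [|lra..]. by apply/andP; split; nra.
case: (leP s 2^-1) => s1.
  rewrite (step_half1 (t := s)); last lra.
  case: (leP t 1) => t2.
    rewrite step_half2; last lra. by apply/andP; split; nra.
  by rewrite step_ge1 ?(ltW t2)//; apply/andP; split; nra.
case: (leP t 1) => t2.
  by rewrite !step_half2; [apply/andP; split; nra|lra..].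
rewrite (step_ge1 (ltW t2)); case: (leP s 1) => s2.
  by rewrite step_half2; [apply/andP; split; nra|lra].
by rewrite step_ge1 ?(ltW s2)//; lra.
Qed.

Lemma step_ge0 t : 0 <= step t.
Proof.
case: (leP t 0) => t0; first by rewrite step_le0.
by have := step_nd (ltW t0); rewrite (step_le0 (lexx 0)) subr0 => /andP[].
Qed.

Lemma step_le1 t : step t <= 1.
Proof.
case: (leP 1 t) => t1; first by rewrite step_ge1.
by have := step_nd (ltW t1); rewrite (step_ge1 (lexx 1)) subr_ge0 => /andP[].
Qed.

Lemma step_lip s t : `|step t - step s| <= 2 * `|t - s|.
Proof.
wlog st : s t / s <= t.
  move=> hw; case: (leP s t) => st; first exact: hw.
  by rewrite distrC (distrC t); apply: hw; exact: ltW.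
have /andP[h1 h2] := step_nd st.
by rewrite !ger0_norm// subr_ge0.
Qed.

Lemma step'_bound t : `|step' t| <= 2.
Proof.
rewrite /step' /p'; case: (leP t 0) => ?; case: (leP (t - 2^-1) 0) => ?;
 case: (leP (t - 1) 0) => ?; rewrite ler_norml; apply/andP; split; lra.
Qed.

Lemma step'_out t : t <= 0 \/ 1 <= t -> step' t = 0.
Proof.
move=> [t0|t1]; rewrite /step' /p'.
  by rewrite !max_r; [lra|lra..].
by rewrite !max_l; [lra|lra..].
Qed.

Lemma is_derive_step t : is_derive t 1 step (step' t).
Proof. by have [+ _] := quad_derive step_quad; apply. Qed.

Lemma continuous_step' : continuous step'.
Proof. by have [_] := quad_derive step_quad. Qed.

Lemma c1_step (f : plane R -> R) : c1 f -> c1 (step \o f).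
Proof. exact: (c1_comp is_derive_step continuous_step'). Qed.

Lemma derive_step (f : plane R -> R) v x : c1 f ->
  'D_v (step \o f) x = step' (f x) * 'D_v f x.
Proof.
move=> cf; have cs := c1_step cf.
rewrite deriveE; last exact: cs.1.
have ds : differentiable step (f x).
  by apply/derivable1_diffP; have := is_derive_step (f x) => ds; exact: ex_derive.
rewrite diff_comp//=; last exact: cf.1.
rewrite [in RHS]deriveE; last exact: cf.1.
have ids := is_derive_step (f x).
by rewrite diff1E// derive1E derive_val /= mulrC.
Qed.

(** A bump on [-1, 1] written as a difference of steps: the sum of its integer translates
    telescopes, which makes them a partition of unity. *)
Definition hat t : R := step (t + 1) - step t.

Lemma hat_ge0 t : 0 <= hat t.
Proof. by have /andP[] := @step_nd t (t + 1) ltac:(by rewrite lerDl). Qed.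

Lemma hat_le1 t : hat t <= 1.
Proof. by rewrite /hat; have := step_le1 (t + 1); have := step_ge0 t; lra. Qed.

Lemma hat_out t : 1 <= `|t| -> hat t = 0.
Proof.
rewrite ler_normr /hat => /orP[t1|t1].
  by rewrite !step_ge1 ?subrr//; lra.
by rewrite !step_le0 ?subrr//; lra.
Qed.

Lemma hat_lip s t : `|hat t - hat s| <= 4 * `|t - s|.
Proof.
have h1 := step_lip (s + 1) (t + 1); have h2 := step_lip s t.
rewrite /hat; have -> : step (t + 1) - step t - (step (s + 1) - step s) =
  (step (t + 1) - step (s + 1)) - (step t - step s) by ring.
rewrite (le_trans (ler_normB _ _))//.
have e : (t + 1 - (s + 1)) = t - s by ring.
rewrite e in h1; lra.
Qed.

Lemma sum_hat (N : nat) t : `|t| <= N%:R ->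
  \sum_(i < (2 * N).+1) hat (t - (i%:R - N%:R)) = 1.
Proof.
rewrite ler_norml => /andP[t1 t2].
pose f (i : nat) := step (t + N%:R + 1 - i%:R).
transitivity (\sum_(0 <= i < (2 * N).+1) (f i - f i.+1)).
  rewrite big_mkord; apply: eq_bigr => i _; rewrite /hat /f.
  by congr (step _ - step _); rewrite -?natr1; ring.
under eq_bigr do rewrite -opprB.
rewrite sumrN telescope_sumr// opprB.
rewrite /f step_ge1 ?step_le0 ?subr0//.
  by rewrite -natr1 natrM; lra.
lra.
Qed.

(** The counted indices are among the 2m consecutive integers [f + 1], ..., [f + 2m], where [f] is
    the floor of [t + N - m]; summing over the offset [k] instead of [i] bounds the count. *)
Lemma count_near (n m N : nat) t :
  \sum_(i < n) ((`|t - (i%:R - N%:R)| < m%:R)%R : nat)%:R <= (2 * m)%:R :> R.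
Proof.
pose f : int := Num.floor (t + N%:R - m%:R).
apply: (@le_trans _ _ (\sum_(i < n) \sum_(k < 2 * m)
    ((Posz i == f + Posz k + 1)%R : nat)%:R)).
  apply: ler_sum => i _.
  case: (boolP (`|t - (i%:R - N%:R)| < m%:R)) => [|_]; last first.
    by apply: sumr_ge0 => k _.
  rewrite ltr_norml => /andP[h1 h2].
  have fl : (f < Posz i)%R.
    by rewrite -(@ltr_int R) (le_lt_trans (floor_le_tmp _))//= ; lra.
  have fu : (Posz i < f + Posz (2 * m) + 1)%R.
    rewrite -(@ltr_int R) rmorphD rmorphD/=.
    have := floorD1_gt (t + N%:R - m%:R); rewrite -/f rmorphD/= -!pmulrn natrM /=; lra.
  have [k kE] : exists k : nat, Posz k = Posz i - f - 1.
    exists (absz (Posz i - f - 1)%R); rewrite gez0_abs; lia.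
  have km : (k < 2 * m)%N by rewrite -ltz_nat; lia.
  rewrite (bigD1 (Ordinal km))//= (_ : Posz i == _) ?ler_wpDr ?sumr_ge0//.
  by apply/eqP; lia.
rewrite exchange_big/=.
apply: (@le_trans _ _ (\sum_(k < 2 * m) 1)); last by rewrite sumr_const card_ord.
apply: ler_sum => k _.
have [/existsP[i0 /eqP i0E]|/existsPn none] :=
    boolP [exists i : 'I_n, Posz i == (f + Posz k + 1)%R].
  rewrite (bigD1 i0)//= i0E eqxx big1 ?addr0// => i ii0.
  case: eqP => // e; case/negP: ii0; apply/eqP/val_inj => /=; apply/eqP.
  by rewrite -eqz_nat e i0E.
by rewrite big1// => i _; rewrite (negbTE (none i)).
Qed.

End spline.

(** * Interpolation on a square grid *)

Section grid.
Context {R : realType}.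
Implicit Types (x y v : plane R) (f : plane R -> R) (N : nat) (h : R).

Lemma plane_ballP x y (r : R) :
  ball x r y <-> `|y.1 - x.1| < r /\ `|y.2 - x.2| < r.
Proof.
rewrite plane_ballE; split=> -[]; rewrite /ball/= => h1 h2; split => //;
  by rewrite distrC.
Qed.

Lemma plane_normE x : `|x| = Num.max `|x.1| `|x.2|.
Proof. by []. Qed.

Lemma norm_fst x : `|x.1| <= `|x|.
Proof. by rewrite plane_normE le_max lexx. Qed.

Lemma norm_snd x : `|x.2| <= `|x|.
Proof. by rewrite plane_normE le_max lexx orbT. Qed.

(** Indices are shifted by [N], so that [2 N + 1] natural numbers per axis cover the square |x| <= N
    h, on which the hats sum to 1. *)
Definition node N h (i j : nat) : plane R := ((i%:R - N%:R) * h, (j%:R - N%:R) * h).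

Definition hat2 N h (i j : nat) x : R :=
  hat (x.1 / h - (i%:R - N%:R)) * hat (x.2 / h - (j%:R - N%:R)).

Definition grid N h (c : nat -> nat -> R) x : R :=
  \sum_(i < (2 * N).+1) \sum_(j < (2 * N).+1) c i j * hat2 N h i j x.

Lemma c1_hat (f : plane R -> R) : c1 f -> c1 (hat \o f).
Proof.
move=> cf; apply: (@c1B _ (step \o (f \+ cst 1)) (step \o f)).
  by apply: c1_step; exact: (c1D cf (c1_cst 1)).
exact: c1_step.
Qed.

Lemma c1_hat2 N h i j : c1 (hat2 N h i j).
Proof.
have caff (p : plane R -> R) (a b : R) : c1 p -> c1 (fun x => p x / a - b).
  by move=> cp; exact: (c1B (c1M cp (c1_cst a^-1)) (c1_cst b)).
apply: (c1M (f := fun x => hat (x.1 / h - _)) (g := fun x => hat (x.2 / h - _))).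
  by apply: (@c1_hat (fun x => x.1 / h - (i%:R - N%:R))); exact: caff c1_fst.
by apply: (@c1_hat (fun x => x.2 / h - (j%:R - N%:R))); exact: caff c1_snd.
Qed.

Lemma c1_grid N h c : c1 (grid N h c).
Proof.
apply: c1_sum => i; apply: c1_sum => j.
exact: (c1M (c1_cst (c i j)) (c1_hat2 N h i j)).
Qed.

Lemma hat2_ge0 N h i j x : 0 <= hat2 N h i j x.
Proof. by apply: mulr_ge0; exact: hat_ge0. Qed.

Lemma hat2_out N h i j x : 0 < h -> ~ ball (node N h i j) h x -> hat2 N h i j x = 0.
Proof.
move=> h0 nb; rewrite /hat2.
have scal (a b : R) : h <= `|a - b * h| -> hat (a / h - b) = 0.
  move=> ab; apply: hat_out; have -> : a / h - b = (a - b * h) / h.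
    by rewrite mulrBl mulfK// gt_eqF.
  by rewrite normrM normfV (gtr0_norm h0) ler_pdivlMr// mul1r.
have [h1|h1] := ltP `|x.1 - (node N h i j).1| h; last by rewrite scal ?mul0r.
have [h2|h2] := ltP `|x.2 - (node N h i j).2| h; last by rewrite [X in _ * X]scal ?mulr0.
by case: nb; exact/plane_ballP.
Qed.

Lemma sum_hat2 N h x : 0 < h -> `|x| <= N%:R * h ->
  \sum_(i < (2 * N).+1) \sum_(j < (2 * N).+1) hat2 N h i j x = 1.
Proof.
move=> h0 xN.
have le_div (t : R) : `|t| <= N%:R * h -> `|t / h| <= N%:R.
  by move=> tN; rewrite normrM normfV (gtr0_norm h0) ler_pdivrMr.
rewrite -(@sum_hat _ N (x.1 / h)); last by rewrite le_div// (le_trans (norm_fst x)).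
apply: eq_bigr => i _; rewrite -mulr_sumr sum_hat ?mulr1//.
by rewrite le_div// (le_trans (norm_snd x)).
Qed.

Lemma hat2_lip N h i j x y : 0 < h ->
  `|hat2 N h i j x - hat2 N h i j y| <= 8 / h * `|x - y|.
Proof.
move=> h0; rewrite /hat2.
have lip (a b d : R) : `|hat (a / h - d) - hat (b / h - d)| <= 4 / h * `|a - b|.
  rewrite (le_trans (hat_lip _ _))//.
  have -> : a / h - d - (b / h - d) = (a - b) / h by rewrite mulrBl; ring.
  by rewrite normrM normfV (gtr0_norm h0) mulrA mulrAC.
have l1 := lip x.1 y.1 (i%:R - N%:R); have l2 := lip x.2 y.2 (j%:R - N%:R).
have n1 := norm_fst (x - y); have n2 := norm_snd (x - y).
have p4 : 0 <= 4 / h by rewrite divr_ge0// ltW.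
have {}l1 := le_trans l1 (ler_wpM2l p4 n1).
have {}l2 := le_trans l2 (ler_wpM2l p4 n2).
move: l1 l2; set a := hat _; set b := hat _; set a' := hat _; set b' := hat _.
have [a0 a1] : 0 <= a /\ a <= 1 by split; [exact: hat_ge0|exact: hat_le1].
have [b0 b1] : 0 <= b' /\ b' <= 1 by split; [exact: hat_ge0|exact: hat_le1].
move=> l1 l2.
have -> : a * a' - b * b' = a * (a' - b') + b' * (a - b) by ring.
rewrite (le_trans (ler_normD _ _))// !normrM (ger0_norm a0) (ger0_norm b0).
have -> : 8 / h * `|x - y| = 4 / h * `|x - y| + 4 / h * `|x - y| by ring.
by apply: lerD; [rewrite (le_trans _ l2)// ler_piMl|rewrite (le_trans _ l1)// ler_piMl].
Qed.

Lemma grid_ge0 N h c x : (forall i j, 0 <= c i j) -> 0 <= grid N h c x.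
Proof.
by move=> c0; apply: sumr_ge0 => i _; apply: sumr_ge0 => j _; rewrite mulr_ge0// hat2_ge0.
Qed.

(** Outside the square of the grid the hats need not sum to 1, but they are among the nonnegative
    hats of a larger grid, which do. *)
Lemma sum_hat2_le1 N h x : 0 < h ->
  \sum_(i < (2 * N).+1) \sum_(j < (2 * N).+1) hat2 N h i j x <= 1.
Proof.
move=> h0; have le1 (t : R) : \sum_(i < (2 * N).+1) hat (t - (i%:R - N%:R)) <= 1.
  have [tN|Nt] := leP `|t| N%:R; first by rewrite sum_hat.
  have [M MN tM] : exists2 M : nat, (N <= M)%N & `|t| <= M%:R.
    exists (maxn N (Num.truncn `|t|).+1); first exact: leq_maxl.
    by rewrite (le_trans (ltW (truncnS_gt _)))// ler_nat leq_maxr.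
  rewrite -[X in _ <= X](sum_hat tM).
  pose F (k : nat) := hat (t - (k%:R - M%:R)).
  rewrite [leRHS](_ : _ = \sum_(0 <= k < (2 * M).+1) F k); last by rewrite big_mkord.
  rewrite [leLHS](_ : _ = \sum_(M - N <= k < (M - N) + (2 * N).+1) F k); last first.
    rewrite -{1}[(M - N)%N]add0n big_addn addKn big_mkord; apply: eq_bigr => i _.
    by rewrite /F natrD natrB//; congr hat; ring.
  rewrite (@big_cat_nat _ _ _ (M - N) 0 (2 * M).+1)//=; last by lia.
  rewrite (@big_cat_nat _ _ _ (M - N + (2 * N).+1) (M - N) (2 * M).+1)//=; last first.
  - lia.
  - lia.
  rewrite addrCA lerDl addr_ge0// sumr_ge0// => i _; exact: hat_ge0.
rewrite /hat2; under eq_bigr do rewrite -mulr_sumr.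
rewrite (le_trans _ (le1 (x.1 / h)))//; apply: ler_sum => i _.
by rewrite ler_piMr// hat_ge0.
Qed.

Lemma grid_le1 N h c x : 0 < h -> (forall i j, c i j <= 1) -> grid N h c x <= 1.
Proof.
move=> h0 c1'; apply: le_trans (sum_hat2_le1 N x h0).
apply: ler_sum => i _; apply: ler_sum => j _.
by rewrite ler_piMl// hat2_ge0.
Qed.

Lemma derive_bound f v x (L : R) : c1 f ->
  (exists2 e : R, 0 < e & forall k, 0 < k < e -> `|f (x + k *: v) - f x| <= L * k) ->
  `|'D_v f x| <= L.
Proof.
move=> cf [e e0 fL].
have df : (fun k => k^-1 *: (f (k *: v + x) - f x)) @ 0^'+ --> 'D_v f x.
  by have dd := @c1_derivable _ f x v cf; exact: (cvg_dnbhs_at_right dd).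
apply: (cvgr_to_le (cvg_norm df)); near=> k.
have k0 : 0 < k by near: k; exact: nbhs_right_gt.
have ke : k < e by near: k; exact: nbhs_right_lt.
rewrite normrZ normfV (gtr0_norm k0) mulrC ler_pdivrMr// addrC.
by rewrite [_ + x]addrC [- _ + _]addrC fL// k0.
Unshelve. all: by end_near. Qed.

(** Since the hats sum to 1 near [x], subtracting the constant [c0] from all coefficients leaves the
    derivative unchanged; [c0] may thus be adapted to [x]. The radius is 2h rather than h to cover
    the displaced point [x + k v] as well. *)
Lemma grid_derive N h c c0 v x : 0 < h -> `|x| < N%:R * h ->
  `|'D_v (grid N h c) x| <= 8 / h * `|v| *
    \sum_(i < (2 * N).+1) \sum_(j < (2 * N).+1)
      \1_(ball (node N h i j) (2 * h)) x * `|c i j - c0|.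
Proof.
move=> h0 xN; apply: derive_bound; first exact: c1_grid.
pose e := Num.min h (N%:R * h - `|x|) / (`|v| + 1).
have v1 : 0 < `|v| + 1 by rewrite ltr_wpDl.
have m0 : 0 < Num.min h (N%:R * h - `|x|) by rewrite lt_min h0 subr_gt0.
exists e => [|k /andP[k0 ke]]; first exact: divr_gt0.
have kv : `|k *: v| < Num.min h (N%:R * h - `|x|).
  rewrite normrZ (gtr0_norm k0); move: ke; rewrite ltr_pdivlMr//.
  by apply: le_lt_trans; apply: ler_wpM2l; [exact: ltW|rewrite lerDl].
move: kv; rewrite lt_min => /andP[kvh kvN].
have xkN : `|x + k *: v| <= N%:R * h by rewrite (le_trans (ler_normD _ _))// ltW// addrC -ltrBrDr.
have e0 y : `|y| <= N%:R * h -> grid N h c y =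
    c0 + \sum_(i < (2 * N).+1) \sum_(j < (2 * N).+1) (c i j - c0) * hat2 N h i j y.
  move=> yN; rewrite -[X in _ = X + _](mulr1 c0) -[X in _ = c0 * X + _](sum_hat2 h0 yN) mulr_sumr -big_split/=.
  apply: eq_bigr => i _; rewrite mulr_sumr -big_split/=; apply: eq_bigr => j _; ring.
rewrite (e0 _ xkN) (e0 _ (ltW xN)) [X in `|X|](_ : _ =
    \sum_(i < (2 * N).+1) \sum_(j < (2 * N).+1)
     (c i j - c0) * (hat2 N h i j (x + k *: v) - hat2 N h i j x)); last first.
  rewrite opprD addrACA subrr add0r -sumrB; apply: eq_bigr => i _.
  by rewrite -sumrB; apply: eq_bigr => j _; ring.
rewrite (le_trans (ler_norm_sum _ _ _))// [leRHS]mulrAC mulr_sumr.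
apply: ler_sum => i _; rewrite (le_trans (ler_norm_sum _ _ _))// mulr_sumr.
apply: ler_sum => j _; rewrite normrM.
have [xb|xb] := pselect (ball (node N h i j) (2 * h) x).
  rewrite indicE mem_set// mul1r mulrC ler_wpM2r//.
  by rewrite (le_trans (hat2_lip _ _ _ _ _ h0))// addrAC subrr add0r normrZ (gtr0_norm k0) -!mulrA (mulrC k).
rewrite indicE memNset// mul0r mulr0.
have ball1 y : `|y - x| < h -> ~ ball (node N h i j) h y.
  move=> yx yb; apply: xb; have -> : 2 * h = h + h by ring.
  by apply: ball_triangle yb _; rewrite -ball_normE.
rewrite !hat2_out ?subrr ?normr0 ?mulr0//.
  by apply: ball1; rewrite subrr normr0.
by apply: ball1; rewrite addrAC subrr add0r.
Qed.

Lemma count_nodes N h x (m : nat) : 0 < h ->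
  \sum_(i < (2 * N).+1) \sum_(j < (2 * N).+1)
    \1_(ball (node N h i j) (m%:R * h)) x <= ((2 * m) ^ 2)%:R :> R.
Proof.
move=> h0.
pose a (t : R) (i : nat) : R := ((`|t / h - (i%:R - N%:R)| < m%:R)%R : nat)%:R.
have sc (t b : R) : (`|t - b * h| < m%:R * h) = (`|t / h - b| < m%:R).
  have -> : t / h - b = (t - b * h) / h by rewrite mulrBl mulfK// gt_eqF.
  by rewrite normrM normfV (gtr0_norm h0) ltr_pdivrMr.
apply: (@le_trans _ _ (\sum_(i < (2 * N).+1) \sum_(j < (2 * N).+1) a x.1 i * a x.2 j)).
  apply: ler_sum => i _; apply: ler_sum => j _.
  have [/plane_ballP[/=]|xb] := pselect (ball (node N h i j) (m%:R * h) x).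
    by rewrite /a !sc => -> ->; rewrite mulr1 indicE; case: (_ \in _).
  by rewrite indicE memNset// mulr_ge0.
under eq_bigr do rewrite -mulr_sumr.
rewrite -mulr_suml natrX expr2; apply: ler_pM.
- by apply: sumr_ge0.
- by apply: sumr_ge0.
- exact: count_near.
- exact: count_near.
Qed.

Lemma plane_compact (A : set (plane R)) (r : R) :
  closed A -> A `<=` ball 0 r -> compact A.
Proof.
move=> cA Ar; apply: (@subclosed_compact _ _ (`[- r, r] `*` `[- r, r])) => //.
  by apply: compact_setX; exact: segment_compact.
move=> x /Ar /plane_ballP[/=]; rewrite !subr0 !ltr_norml => /andP[? ?] /andP[? ?].
by split; rewrite /= in_itv/=; apply/andP; split; exact: ltW.
Qed.

Lemma compact_ball (A : set (plane R)) : compact A -> exists n : nat, A `<=` ball 0 n%:R.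
Proof.
move=> /compact_bounded[M [_ AM]]; exists (Num.truncn (`|M| + 1)).+1 => x Ax.
rewrite -ball_normE /= sub0r normrN; apply: le_lt_trans (truncnS_gt _).
by apply: AM => //; rewrite (le_lt_trans (ler_norm _))// ltrDl.
Qed.

(** Only nodes whose 2h-ball lies in [V] count, while a hat reaches no further than h: the support
    keeps distance h from the complement of [V], and is bounded because the grid is finite. *)
Definition cutoff N h (V : set (plane R)) : plane R -> R :=
  grid N h (fun i j => `[< ball (node N h i j) (2 * h) `<=` V >]%:R).

End grid.

(** * Cutoff functions and uniform differentiability *)

Section cutoff.
Context {R : realType}.
Implicit Types (x y v : plane R) (U V : set (plane R)) (N : nat) (h : R).

Lemma c1_cutoff N h V : c1 (cutoff N h V).
Proof. exact: c1_grid. Qed.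

Lemma cutoff_ge0 N h V x : 0 <= cutoff N h V x.
Proof. by apply: grid_ge0 => i j; rewrite ler0n. Qed.

Lemma cutoff_le1 N h V x : 0 < h -> cutoff N h V x <= 1.
Proof. by move=> h0; apply: grid_le1 => // i j; case: asbool. Qed.

Lemma cutoff_supp N h V x : 0 < h -> cutoff N h V x != 0 ->
  ball x h `<=` V /\ `|x| < (N.+1)%:R * h.
Proof.
move=> h0; apply: contra_neqP => nV.
rewrite /cutoff /grid big1// => i _; rewrite big1// => j _.
have [xb|xb] := pselect (ball (node N h i j) h x); last by rewrite hat2_out// mulr0.
have [bV|] := asboolP (ball (node N h i j) (2 * h) `<=` V); last by rewrite mul0r.
case: nV; split.
  move=> z xz; apply: bV; have -> : 2 * h = h + h by ring.
  exact: ball_triangle xb xz.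
move/plane_ballP : xb => /= [x1 x2].
have le_node (k : nat) : (k < (2 * N).+1)%N -> `|(k%:R - N%:R) * h| <= N%:R * h.
  move=> kN; rewrite normrM (gtr0_norm h0); apply: ler_wpM2r; first exact: ltW.
  rewrite ler_norml.
  have : k%:R <= (2 * N)%:R :> R by rewrite ler_nat.
  have : 0 <= k%:R :> R by [].
  rewrite natrM => ? ?; apply/andP; split; lra.
have n1 := le_node i (ltn_ord i); have n2 := le_node j (ltn_ord j).
have e : (N.+1)%:R * h = N%:R * h + h by rewrite -natr1; ring.
rewrite plane_normE gt_max e; apply/andP; split.
  rewrite -[x.1](subrK ((i%:R - N%:R) * h)) addrC (le_lt_trans (ler_normD _ _))//.
  exact: ler_ltD.
rewrite -[x.2](subrK ((j%:R - N%:R) * h)) addrC (le_lt_trans (ler_normD _ _))//.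
exact: ler_ltD.
Qed.

Lemma cutoff1 N h V x : 0 < h -> `|x| <= N%:R * h -> ball x (3 * h) `<=` V ->
  cutoff N h V x = 1.
Proof.
move=> h0 xN xV; rewrite -(sum_hat2 h0 xN) /cutoff /grid.
apply: eq_bigr => i _; apply: eq_bigr => j _.
have [xb|xb] := pselect (ball (node N h i j) h x); last by rewrite hat2_out// mulr0.
rewrite asboolT ?mul1r// => z nz; apply: xV.
have -> : 3 * h = h + 2 * h by ring.
by apply: ball_triangle nz; exact: ball_sym.
Qed.

Lemma compactly_contained_closed (A C U : set (plane R)) (r : R) :
  A `<=` C -> closed C -> C `<=` U -> C `<=` ball 0 r -> compactly_contained A U.
Proof.
move=> AC cC CU Cr.
have cAC : closure A `<=` C.
  by move=> x /(closure_subset AC); rewrite -(proj1 (closure_id C) cC).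
split; last exact: subset_trans CU.
by apply: (@plane_compact _ _ r); [exact: closed_closure|exact: subset_trans Cr].
Qed.

Lemma compactly_contained_sub (A B U V : set (plane R)) :
  A `<=` B -> U `<=` V -> compactly_contained B U -> compactly_contained A V.
Proof.
move=> AB UV [cB BU]; have cAB := closure_subset AB; split; last first.
  exact: subset_trans (subset_trans cAB BU) UV.
by apply: subclosed_compact cB cAB; exact: closed_closure.
Qed.

Lemma compactly_contained_ball (A U : set (plane R)) : compactly_contained A U ->
  exists n : nat, A `<=` ball 0 n%:R.
Proof.
move=> [/compact_ball[n An] _]; exists n; apply: subset_trans An.
exact: subset_closure.
Qed.

(** A point of [ball x h] outside [V] stays in the ball when [x] moves a little, so the complement
    is open. *)
Lemma closed_erosion V h : closed [set x | ball x h `<=` V].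
Proof.
rewrite -[X in closed X]setCK; apply: open_closedC; rewrite openE => x /= nV.
have [z xz nz] : exists2 z, ball x h z & ~ V z.
  by apply: contra_notP nV => nz z xz; apply: contrapT => nVz; apply: nz; exists z.
have d0 : 0 < h - `|x - z| by rewrite subr_gt0; move: xz; rewrite -ball_normE.
apply/nbhs_ballP; exists (h - `|x - z|) => //= y xy yV; apply: nz; apply: yV.
move: xy; rewrite -!ball_normE /= => xy.
have -> : y - z = (x - z) - (x - y) by rewrite opprB [RHS]addrC addrA subrK.
rewrite (le_lt_trans (ler_normB _ _))//; lra.
Qed.

Lemma cutoff_cc N h V : 0 < h -> compactly_contained [set x | cutoff N h V x != 0] V.
Proof.
move=> h0.
pose C := [set x | ball x h `<=` V] `&` [set x | `|x| <= (N.+1)%:R * h].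
apply: (@compactly_contained_closed _ C _ ((N.+1)%:R * h + 1)).
- by move=> x /= /(cutoff_supp h0)[xV xN]; split => //=; exact: ltW.
- apply: closedI; first exact: closed_erosion.
  apply: (@closed_comp _ _ (fun x : plane R => `|x|) [set t | t <= (N.+1)%:R * h]).
    by move=> x _; exact: norm_continuous.
  exact: closed_le.
- by move=> x [xV _]; apply: xV; exact: ballxx.
- by move=> x [_ /= xN]; rewrite -ball_normE /= sub0r normrN; lra.
Qed.

(** With mesh [1 / (n + 1)] and [(n + 1) ^ 2] nodes on each half axis, the grid covers the square of
    half-side [n + 1] while the mesh tends to 0. *)
Lemma cutoff_exhaust V x : open V -> V x ->
  \forall n \near \oo, cutoff (n.+1 * n.+1) (n.+1%:R^-1) V x = 1.
Proof.
move=> oV Vx; have /nbhs_ballP[e /= e0 xeV] := open_nbhs_nbhs (conj oV Vx).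
have e3 : 0 < e / 3 by rewrite divr_gt0.
near=> n; have n0 : 0 < (n.+1%:R^-1 : R) by rewrite invr_gt0.
apply: cutoff1 => //.
  rewrite natrM mulfK ?pnatr_eq0//.
  have : `|x| <= n%:R by near: n; exact: nbhs_infty_ger.
  by move=> /le_trans; apply; rewrite ler_nat.
have ne : n.+1%:R^-1 < e / 3.
  by near: n; exact: (near_infty_natSinv_lt (PosNum e3)).
apply: subset_trans xeV; apply: le_ball.
have -> : e = 3 * (e / 3) by field.
by rewrite ler_wpM2l// ltW.
Unshelve. all: by end_near. Qed.

Lemma compact_support_unif (g : plane R -> R) (r : R) : continuous g ->
  (forall x, ~ ball 0 r x -> g x = 0) ->
  forall e, 0 < e -> exists2 d : R, 0 < d &
    forall x y, `|x - y| < d -> `|g x - g y| <= e.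
Proof.
move=> cg g0 e e0.
(* The box exceeds the support by 1 and [d] will be at most 1: if [x] lies outside the box, then [x]
   and [y] are both outside the support. *)
pose K : set (plane R) := `[- (r + 1), r + 1] `*` `[- (r + 1), r + 1].
have cK : compact K by apply: compact_setX; exact: segment_compact.
have /compact_near_coveringP/(_ _ (0^'+ : set_system R)
    (fun d x => forall y, `|x - y| < d -> `|g x - g y| <= e)) := cK.
have FF : Filter (0^'+ : set_system R) by exact: _.
case/(_ FF _) => [x Kx|].
  have e2 : 0 < e / 2 by rewrite divr_gt0.
  have /cvgrPdist_lt/(_ _ e2) := cg x.
  move=> /nbhs_ballP[q /= q0 qx].
  exists (ball x (q / 2), [set d : R | d < q / 2]) => /=.
    split; first by apply: nbhsx_ballx; rewrite divr_gt0.
    by apply: nbhs_right_lt; rewrite divr_gt0.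
  move=> [x' d] [/= xx' dq] y x'y.
  have xy : ball x q y.
    have -> : q = q / 2 + q / 2 by field.
    apply: ball_triangle xx' _; rewrite -ball_normE /=; exact: lt_trans dq.
  have xx'q : ball x q x' by apply: le_ball xx'; lra.
  have h1 := qx _ xx'q; have h2 := qx _ xy.
  have -> : g x' - g y = (g x - g y) - (g x - g x') by ring.
  rewrite (le_trans (ler_normB _ _))//; lra.
move=> d0 /= d0p H; pose d := Num.min (d0 / 2) 1.
have d1 : d <= 1 by rewrite /d ge_min lexx orbT.
have d0' : 0 < d by rewrite lt_min ltr01 divr_gt0.
have dd0 : d < d0 by rewrite /d gt_min; apply/orP; left; lra.
have dK := H d _ d0'; rewrite /= sub0r normrN (gtr0_norm d0') in dK.
have {}dK := dK dd0.
exists d => // x y xy.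
have inK z : `|z| <= r + 1 -> K z.
  move=> zr; have := le_trans (norm_fst z) zr; have := le_trans (norm_snd z) zr.
  by rewrite !ler_norml; split; rewrite /= in_itv.
have [xr|xr] := leP `|x| (r + 1); first by apply: dK => //; exact: inK.
have xb : ~ ball 0 r x.
  by rewrite -ball_normE /= sub0r normrN => ?; move: xr; lra.
have yb : ~ ball 0 r y.
  rewrite -ball_normE /= sub0r normrN => yr.
  have : `|x| <= `|x - y| + `|y| by rewrite -[in leLHS](subrK y x) ler_normD.
  by move: xr; lra.
by rewrite !g0// subrr normr0 ltW.
Unshelve. all: by end_near. Qed.

(** Mean value theorem on the segment from [x] to [x + k v], and uniform continuity of ['D_v f].
    Uniformity in [x] is what allows the difference quotients to be integrated. *)
Lemma c1_compact_unif (f : plane R -> R) (r : R) v : c1 f ->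
  (forall x, ~ ball 0 r x -> f x = 0) ->
  forall e, 0 < e -> exists2 d : R, 0 < d &
    forall x k, 0 < k < d -> `|f (x + k *: v) - f x - k * 'D_v f x| <= e * k.
Proof.
move=> cf f0 e e0.
have D0 x : ~ ball 0 (r + 1) x -> 'D_v f x = 0.
  move=> nb; apply: (@cvg_lim _ _ _ _ _ _ _ _) => //.
  have xr : r + 1 <= `|x|.
    by rewrite leNgt; apply/negP => xr; apply: nb; rewrite -ball_normE /= sub0r normrN.
  apply: cvg_near_cst; near=> k; rewrite /=.
  rewrite !f0 ?subr0 ?scaler0//.
    by rewrite -ball_normE /= sub0r normrN => ?; move: xr; lra.
  rewrite -ball_normE /= sub0r normrN => kx.
  have kv : `|k *: v| <= 1.
    rewrite normrZ; have : `|k| <= (`|v| + 1)^-1.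
      by near: k; apply: dnbhs0_le; rewrite invr_gt0 ltr_wpDl.
    move=> k1; apply: (@le_trans _ _ (`|k| * (`|v| + 1))).
      by rewrite ler_wpM2l// lerDl.
    by rewrite -ler_pdivlMr ?div1r// ltr_wpDl.
  have : `|x| <= `|k *: v + x| + `|k *: v|.
    by rewrite -[x in leLHS](addKr (k *: v)) addrC (le_trans (ler_normB _ _)).
  by move: xr; lra.
have [d d0 dD] := compact_support_unif (cf.2 v) D0 e0.
have v1 : 0 < `|v| + 1 by rewrite ltr_wpDl.
exists (d / (`|v| + 1)) => [|x k /andP[k0 kd]]; first exact: divr_gt0.
pose F (t : R) := f (x + t *: v).
have dF (t : R) : is_derive t (1 : R) F ('D_v f (x + t *: v)).
  have dv := @c1_derivable _ f (x + t *: v) v cf.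
  have E : (fun h : R => h^-1 *: ((F \o shift t) (h *: (1 : R)) - F t)) =
      (fun h : R => h^-1 *: ((f \o shift (x + t *: v)) (h *: v) - f (x + t *: v))).
    apply/funext => h; rewrite /F /=; congr (_ *: (f _ - _)).
    by rewrite /GRing.scale/= mulr1 -/(GRing.scale _ _) scalerDl addrCA.
  split; first by rewrite /derivable E.
  by rewrite /derive E.
have [t] := @MVT_segment R F (fun t => 'D_v f (x + t *: v)) 0 k (ltW k0)
  (fun t _ => dF t) (continuous_subspaceT (fun t => differentiable_continuous (proj1 (derivable1_diffP F t) (@ex_derive _ _ _ _ _ _ _ (dF t))))).
rewrite in_itv/= => /andP[t0 tk].
rewrite /F scale0r addr0 subr0 => ->.
have -> (a b : R) : a * k - k * b = (a - b) * k by ring.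
rewrite normrM (gtr0_norm k0).
apply: ler_wpM2r; first exact: ltW.
apply: dD; rewrite addrAC subrr add0r normrZ (ger0_norm t0).
apply: le_lt_trans (_ : k * (`|v| + 1) < d); last by rewrite -ltr_pdivlMr.
by apply: ler_pM => //; rewrite lerDl.
Unshelve. all: by end_near. Qed.

End cutoff.

(** * Pairing of locally integrable weights with bounded functions *)

Section integration.
Context {R : realType}.
Implicit Types (x y v : plane R) (A O U : set (plane R)) (f g w : plane R -> R).

Lemma bfun_continuous f : continuous f -> bfun f.
Proof.
move=> cf; rewrite /bfun; apply: (measurability _ (RGenOInfty.measurableE R)) => //.
move=> _ [_ [a ->] <-]; rewrite setTI; apply: bset_open.
by apply: open_comp => //; exact: interval_open.
Qed.

Lemma bfunD f g : bfun f -> bfun g -> bfun (f \+ g).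
Proof. exact: measurable_funD. Qed.

Lemma bfunB f g : bfun f -> bfun g -> bfun (f \- g).
Proof. exact: measurable_funB. Qed.

Lemma bfunM f g : bfun f -> bfun g -> bfun (f \* g).
Proof. exact: measurable_funM. Qed.

Lemma bfun_cst (a : R) : bfun (cst a).
Proof. exact: measurable_cst. Qed.

Lemma bfun_norm f : bfun f -> bfun (fun x => `|f x|).
Proof. by move=> mf; apply: measurableT_comp mf. Qed.

(** [bsupp] and [lint] are the two classes paired by [Iw]: divergences of test fields belong to the
    first, indicators of Borel sets, possibly of infinite measure, to the second. *)
Definition bsupp f : Prop :=
  bfun f /\ exists M r : R, [/\ 0 <= M, forall x, `|f x| <= M &
                                forall x, ~ ball 0 r x -> f x = 0].

Definition lint w : Prop :=
  bfun w /\ forall r : R, (\int[mu]_(x in ball (0%R : plane R) r) `|w x|%:E < +oo)%E.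

(** Real valued, so that linear arithmetic applies; for [lint] and [bsupp] arguments the extended
    integral is finite and nothing is lost ([Iw_lint]). *)
Definition Iw w f : R := \int[mu]_x (w x * f x).

Definition L1 w (r : R) : R := fine (\int[mu]_(x in ball (0%R : plane R) r) `|w x|%:E)%E.

Lemma lint_norm_int w r : lint w ->
  (\int[mu]_(x in ball (0%R : plane R) r) `|w x|%:E)%E = (L1 w r)%:E.
Proof.
move=> [mw iw]; rewrite /L1 fineK// ge0_fin_numE; first exact: iw.
by apply: integral_ge0 => x _; rewrite lee_fin.
Qed.

Lemma L1_ge0 w r : 0 <= L1 w r.
Proof.
apply: fine_ge0; apply: integral_ge0 => x _; rewrite lee_fin; exact: normr_ge0.
Qed.

Lemma mEFin f : bfun f -> measurable_fun setT ((EFin \o f) : mplane R -> \bar R).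
Proof. by move=> mf; apply/measurable_EFinP. Qed.

Lemma Iw_abs_bound w f (M r : R) : lint w -> bfun f -> 0 <= M -> (forall x, `|f x| <= M) ->
  (forall x, ~ ball 0 r x -> f x = 0) ->
  (\int[mu]_x `|w x * f x|%:E <= (M * L1 w r)%:E)%E.
Proof.
move=> lw mf M0 fM f0; have mw := lw.1.
have mb : bset (ball (0 : plane R) r) by exact: bset_ball.
apply: (@le_trans _ _ (\int[mu]_(x in ball (0%R : plane R) r) (M%:E * `|w x|%:E))%E).
  rewrite [leRHS]integral_mkcond; apply: ge0_le_integral.
  - exact: measurableT.
  - by move=> x _; rewrite lee_fin.
  - by apply: mEFin; apply: bfun_norm; exact: bfunM.
  - apply/(measurable_restrictT _ mb); apply: measurable_funTS.
    apply: (@mEFin (fun x => M * `|w x|)); apply: (@bfunM (cst M)); first exact: bfun_cst.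
    exact: bfun_norm.
  - move=> x _; rewrite patchE; have [xb|xb] := pselect (ball 0 r x).
      by rewrite (mem_set xb) -EFinM lee_fin normrM mulrC ler_wpM2r.
    by rewrite (memNset xb) (f0 _ xb) mulr0 normr0.
rewrite ge0_integralZl//.
- by rewrite lint_norm_int.
- by apply: measurable_funTS; apply: mEFin; exact: bfun_norm.
Qed.

Lemma lint_integrable w f : lint w -> bsupp f ->
  mu.-integrable setT (fun x => (w x * f x)%:E).
Proof.
move=> lw [mf [M [r [M0 fM f0]]]]; apply/integrableP; split.
  by apply: (@mEFin (fun x => w x * f x)); exact: (bfunM lw.1 mf).
apply: le_lt_trans (ltry (M * L1 w r)).
exact: (Iw_abs_bound lw mf M0 fM f0).
Qed.

Lemma Iw_bound w f (M r : R) : lint w -> bfun f -> 0 <= M -> (forall x, `|f x| <= M) ->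
  (forall x, ~ ball 0 r x -> f x = 0) -> `|Iw w f| <= M * L1 w r.
Proof.
move=> lw mf M0 fM f0.
have iwf : mu.-integrable setT (fun x => (w x * f x)%:E).
  by apply: lint_integrable => //; split => //; exists M, r.
rewrite -lee_fin; apply: le_trans (Iw_abs_bound lw mf M0 fM f0).
rewrite /Iw EFin_normr_Rintegral//.
exact: (le_abse_integral mu measurableT (measurable_int _ iwf)).
Qed.

Lemma IwD w f g : lint w -> bsupp f -> bsupp g -> Iw w (f \+ g) = Iw w f + Iw w g.
Proof.
move=> lw sf sg; rewrite /Iw -RintegralD//; first by apply: eq_Rintegral => x _; rewrite mulrDr.
- exact: lint_integrable.
- exact: lint_integrable.
Qed.

Lemma IwB w f g : lint w -> bsupp f -> bsupp g -> Iw w (f \- g) = Iw w f - Iw w g.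
Proof.
move=> lw sf sg; rewrite /Iw -RintegralB//; first by apply: eq_Rintegral => x _; rewrite mulrBr.
- exact: lint_integrable.
- exact: lint_integrable.
Qed.

Lemma IwZ w f (a : R) : lint w -> bsupp f -> Iw w (fun x => a * f x) = a * Iw w f.
Proof.
move=> lw sf; rewrite /Iw -RintegralZl//; first by apply: eq_Rintegral => x _; rewrite mulrCA.
exact: lint_integrable.
Qed.

Lemma eq_Iw w f g : f =1 g -> Iw w f = Iw w g.
Proof. by move=> fg; congr (Iw w _); exact/funext. Qed.

Lemma bsuppD f g : bsupp f -> bsupp g -> bsupp (f \+ g).
Proof.
move=> [mf [M [r [M0 fM f0]]]] [mg [M' [r' [M0' gM g0]]]]; split; first exact: bfunD.
exists (M + M'), (Num.max r r'); split; first exact: addr_ge0.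
  by move=> x; rewrite (le_trans (ler_normD _ _))// lerD.
move=> x xb; rewrite /= f0 ?g0 ?addr0//; move=> xr; apply: xb;
  by apply: le_ball xr; rewrite le_max lexx ?orbT.
Qed.

Lemma bsuppM f g : bfun g -> (exists M : R, forall x, `|g x| <= M) -> bsupp f -> bsupp (f \* g).
Proof.
move=> mg [M' gM] [mf [M [r [M0 fM f0]]]]; split; first exact: bfunM.
exists (M * `|M'|), r; split; first by rewrite mulr_ge0.
  by move=> x; rewrite normrM ler_pM// (le_trans (gM x))// ler_norm.
by move=> x xb; rewrite /= f0// mul0r.
Qed.

Lemma bsuppZ f (a : R) : bsupp f -> bsupp (fun x => a * f x).
Proof.
move=> sf; have -> : (fun x => a * f x) = f \* cst a by apply/funext => x /=; rewrite mulrC.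
by apply: bsuppM => //; [exact: bfun_cst|exists `|a|].
Qed.

Lemma bsuppN f : bsupp f -> bsupp (\- f).
Proof.
move=> /(bsuppZ (-1)); congr bsupp; by apply/funext => x; rewrite mulN1r.
Qed.

Lemma bsuppB f g : bsupp f -> bsupp g -> bsupp (f \- g).
Proof. by move=> sf sg; exact: (bsuppD sf (bsuppN sg)). Qed.

Lemma bsuppS f y : bsupp f -> bsupp (fun x => f (x + y)).
Proof.
move=> [mf [M [r [M0 fM f0]]]]; split; first exact: bfunS.
exists M, (r + `|y|); split => // x xb; apply: f0 => xyb; apply: xb.
move: xyb; rewrite -!ball_normE /= !sub0r !normrN => xy.
have -> : x = (x + y) - y by rewrite addrK.
by rewrite (le_lt_trans (ler_normB _ _))// ltrD2r.
Qed.

Lemma lintS w y : lint w -> lint (fun x => w (x + y)).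
Proof.
move=> [mw iw]; split=> [|r]; first exact: bfunS.
have mb s : bset (ball (0 : plane R) s) by exact: bset_ball.
apply: le_lt_trans (iw (r + `|y|)).
pose F (x : plane R) : \bar R := (`|w x| * \1_(ball (0 : plane R) (r + `|y|)) x)%:E.
have mF : measurable_fun setT (F : mplane R -> \bar R).
  apply: (@mEFin (fun x => `|w x| * \1_(ball (0 : plane R) (r + `|y|)) x)).
  by apply: bfunM; [exact: bfun_norm|exact: bfun_indic].
have F0 x : (0 <= F x)%E by rewrite lee_fin mulr_ge0.
rewrite [leRHS](_ : _ = \int[mu]_x F x)%E; last first.
  rewrite integral_mkcond; apply: eq_integral => x _; rewrite /F patchE indicE.
  by case: (x \in _); rewrite ?mulr1 ?mulr0.
rewrite -(ge0_integral_shift y mF F0) [leLHS]integral_mkcond; apply: ge0_le_integral.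
- exact: measurableT.
- by move=> x _; rewrite patchE; case: ifP => // _; rewrite lee_fin.
- apply/(measurable_restrictT _ (mb r)); apply: measurable_funTS.
  by apply: mEFin; apply: bfun_norm; exact: bfunS.
- exact: (measurableT_comp mF (measurable_shift y)).
- move=> x _; rewrite patchE; have [xb|xb] := pselect (ball 0 r x); last first.
    by rewrite (memNset xb) F0.
  rewrite (mem_set xb) /F indicE mem_set ?mulr1//.
  move: xb; rewrite -!ball_normE /= !sub0r !normrN => xr.
  by rewrite (le_lt_trans (ler_normD _ _))// ltrD2r.
Qed.

Lemma Iw_shift w f y : lint w -> bsupp f ->
  Iw (fun x => w (x + y)) (fun x => f (x + y)) = Iw w f.
Proof.
move=> lw sf; rewrite /Iw /Rintegral; congr fine.
pose F : plane R -> \bar R := fun x => (w x * f x)%:E.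
have mF : measurable_fun setT (F : mplane R -> \bar R).
  by apply: (@mEFin (fun x => w x * f x)); exact: (bfunM lw.1 sf.1).
rewrite [LHS]integralE [RHS]integralE; congr (_ - _)%E.
  rewrite -[RHS](ge0_integral_shift y (measurable_funepos mF) (fun x => funepos_ge0 _ x)).
  by apply: eq_integral => x _; rewrite !funeposE.
rewrite -[RHS](ge0_integral_shift y (measurable_funeneg mF) (fun x => funeneg_ge0 _ x)).
by apply: eq_integral => x _; rewrite !funenegE.
Qed.

Lemma lint_bounded w (M : R) : bfun w -> (forall x, `|w x| <= M) -> lint w.
Proof.
move=> mw wM; split=> // r; have [r0|r0] := ltP r 0.
  suff -> : ball (0 : plane R) r = set0 by rewrite integral_set0.
  by apply/seteqP; split=> // x; rewrite -ball_normE /= => /(le_lt_trans (normr_ge0 _)) /lt_trans/(_ r0); rewrite ltxx.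
apply: (@le_lt_trans _ _ (\int[mu]_(x in ball (0%R : plane R) r) (cst M%:E x))%E).
  apply: ge0_le_integral.
  - exact: bset_ball.
  - by move=> x _; rewrite lee_fin.
  - by apply: measurable_funTS; apply: mEFin; exact: bfun_norm.
  - exact: measurable_cst.
  - by move=> x _; rewrite lee_fin.
rewrite integral_cst//; last exact: bset_ball.
suff : (M%:E * mu (ball (0%R : plane R) r) < +oo)%E by [].
by rewrite mu_ball// -EFinM ltry.
Qed.

Lemma lint_indic A : bset A -> lint \1_A.
Proof.
move=> mA; apply: (@lint_bounded _ 1); first exact: bfun_indic.
by move=> x; rewrite indicE; case: (_ \in _); rewrite ?normr0 ?normr1.
Qed.

Lemma c1_bsupp f (r : R) : c1 f -> (forall x, ~ ball 0 r x -> f x = 0) -> bsupp f.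
Proof.
move=> cf f0; have cc := c1_continuous cf; split; first exact: bfun_continuous.
have [d d0 df] := compact_support_unif cc f0 ltr01.
have cK : compact (`[- `|r|, `|r|] `*` `[- `|r|, `|r|] : set (plane R)).
  by apply: compact_setX; exact: segment_compact.
have [||c _ cM] := @compact_EVT_max _ R (fun x => `|f x|) _ _ cK.
- exists 0; split => /=; rewrite in_itv/= oppr_le0 normr_ge0//.
- apply: continuous_subspaceT => x; apply: continuous_comp; first exact: cc.
  exact: norm_continuous.
exists `|f c|, r; split => // x.
have [xb|xb] := pselect (ball 0 r x); last by rewrite f0// normr0.
apply: cM; rewrite inE; move: xb => /plane_ballP[/=]; rewrite !subr0 => h1 h2.
by split; rewrite /= in_itv/= -ler_norml (le_trans (ltW _) (ler_norm r)).
Qed.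

Lemma derive_supp f (r : R) v : c1 f -> (forall x, ~ ball 0 r x -> f x = 0) ->
  forall x, ~ ball 0 (r + 1) x -> 'D_v f x = 0.
Proof.
move=> cf f0 x nb; apply/eqP; rewrite -normr_le0.
have xr : r + 1 <= `|x|.
  by rewrite leNgt; apply/negP => xr; apply: nb; rewrite -ball_normE /= sub0r normrN.
apply: derive_bound => //; exists (`|v| + 1)^-1; first by rewrite invr_gt0 ltr_wpDl.
move=> k /andP[k0 k1]; rewrite mul0r !f0 ?subrr ?normr0//.
  by rewrite -ball_normE /= sub0r normrN => ?; move: xr; lra.
rewrite -ball_normE /= sub0r normrN => kx.
have kv : `|k *: v| <= 1.
  rewrite normrZ (gtr0_norm k0); apply: (@le_trans _ _ (k * (`|v| + 1))).
    by apply: ler_wpM2l; [exact: ltW|rewrite lerDl].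
  by rewrite -ler_pdivlMr ?div1r ?ltr_wpDl// ltW.
have : `|x| <= `|x + k *: v| + `|k *: v|.
  by rewrite -[x in leLHS](addrK (k *: v)) ler_normB.
by move: xr; lra.
Qed.

Lemma c1_bsupp_derive f (r : R) v : c1 f -> (forall x, ~ ball 0 r x -> f x = 0) ->
  bsupp ('D_v f).
Proof.
move=> cf f0; have D0 := @derive_supp f r v cf f0.
split; first by apply: bfun_continuous; exact: cf.2.
have [d d0 df] := compact_support_unif (cf.2 v) D0 ltr01.
have cK : compact (`[- `|r + 1|, `|r + 1|] `*` `[- `|r + 1|, `|r + 1|] : set (plane R)).
  by apply: compact_setX; exact: segment_compact.
have [||c _ cM] := @compact_EVT_max _ R (fun x => `|'D_v f x|) _ _ cK.
- exists 0; split => /=; rewrite in_itv/= oppr_le0 normr_ge0//.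
- apply: continuous_subspaceT => x.
  apply: (@continuous_comp _ _ _ ('D_v f) (fun t : R => `|t|)); first exact: cf.2.
  exact: norm_continuous.
exists `|'D_v f c|, (r + 1); split => // x.
have [xb|xb] := pselect (ball 0 (r + 1) x); last by rewrite D0// normr0.
apply: cM; rewrite inE; move: xb => /plane_ballP[/=]; rewrite !subr0 => h1 h2.
by split; rewrite /= in_itv/= -ler_norml (le_trans (ltW _) (ler_norm (r + 1))).
Qed.

Lemma derive_shift_plane f v x y : 'D_v (fun z => f (z + y)) x = 'D_v f (x + y).
Proof.
rewrite /derive.
have -> : (fun h : R => h^-1 *: (((fun z => f (z + y)) \o shift x) (h *: v) - f (x + y)))
  = (fun h : R => h^-1 *: ((f \o shift (x + y)) (h *: v) - f (x + y))).
  by apply/funext => h /=; rewrite addrA.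
by [].
Qed.

Lemma c1_shift f y : c1 f -> c1 (fun z => f (z + y)).
Proof.
move=> cf; split=> [x|v].
  apply: (@differentiable_comp _ _ _ _ (fun z => z + y) f); last exact: cf.1.
  by apply: differentiableD => //; exact: differentiable_cst.
have -> : 'D_v (fun z => f (z + y)) = 'D_v f \o (fun z => z + y).
  by apply/funext => x; rewrite derive_shift_plane.
move=> x; apply: continuous_comp; last exact: cf.2.
by apply: cvgD; [exact: cvg_id|exact: cvg_cst].
Qed.

End integration.

(** * Smooth approximation of indicators *)

Section approx.
Context {R : realType}.
Implicit Types (x y v : plane R) (A O U : set (plane R)) (f g w : plane R -> R).

Lemma compactly_containedU A B U : compactly_contained A U ->
  compactly_contained B U -> compactly_contained (A `|` B) U.
Proof.
move=> [cA AU] [cB BU]; rewrite /compactly_contained closureU; split.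
  exact: compactU.
by move=> x [/AU|/BU].
Qed.

(** Such a class contains the preimages of Borel sets of the line under the two coordinates, and
    these generate the product sigma-algebra. *)
Lemma plane_borel_ind (G : set (set (plane R))) :
  (forall U, open U -> G U) -> (forall A, G A -> G (~` A)) ->
  (forall F : nat -> set (plane R), (forall n, G (F n)) -> G (\bigcup_n F n)) ->
  forall A, bset A -> G A.
Proof.
move=> Go Gc Gu.
have G0 : G set0 by apply: Go; exact: open0.
have G1 (p : plane R -> R) : continuous p ->
    forall B : set R, measurable (B : set (measurableTypeR R)) -> G (p @^-1` B).
  move=> cp B mB.
  have : (@RGenOpens.G R).-sigma.-measurable B by rewrite -RGenOpens.measurableE.
  apply: (@smallest_sub _ (sigma_algebra setT) _ [set B | G (p @^-1` B)]).
    split => //=.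
    - by move=> D GD; rewrite setTD preimage_setC; exact: Gc.
    - by move=> F GF; rewrite preimage_bigcup; exact: Gu.
  move=> _ [x [y ->]] /=; apply: Go; apply: open_comp => //; exact: interval_open.
move=> A; apply: (@smallest_sub _ (sigma_algebra setT) _ G).
  split => //=.
  by move=> D GD; rewrite setTD; exact: Gc.
move=> D [[B mB <-]|[B mB <-]]; rewrite setTI; apply: G1 => //.
  exact: continuous_fst.
exact: continuous_snd.
Qed.

Lemma union_dist (s t : bool) (a b : R) : 0 <= a <= 1 -> 0 <= b <= 1 ->
  `|(s || t)%:R - (a + b - a * b)| <= `|s%:R - a| + `|t%:R - b|.
Proof.
move=> /andP[a0 a1] /andP[b0 b1].
have h1 : 0 <= a * b by exact: mulr_ge0.
have h2 : a * b <= a by rewrite ler_piMr.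
have h3 : a * b <= b by rewrite ler_piMl.
have h4 : 0 <= (1 - a) * (1 - b) by rewrite mulr_ge0// subr_ge0.
have {}h4 : 0 <= 1 - a - b + a * b by move: h4; congr (_ <= _); ring.
move: (a * b) h1 h2 h3 h4 => c h1 h2 h3 h4.
by case: s; case: t => /=; rewrite ?sub0r ?normrN !ger0_norm; lra.
Qed.

Lemma complement_dist (s : bool) (a b : R) : 0 <= a <= 1 -> 0 <= b <= 1 ->
  `|(~~ s)%:R - b * (1 - a)| <= `|1 - b| + `|s%:R - a|.
Proof.
move=> /andP[a0 a1] /andP[b0 b1]; rewrite mulrBr mulr1.
have h2 : b * a <= b by rewrite ler_piMr.
have h1 : 0 <= b * a by exact: mulr_ge0.
have h3 : b * a <= a by rewrite ler_piMl.
have h4 : 0 <= (1 - b) * (1 - a) by rewrite mulr_ge0// subr_ge0.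
have {}h4 : 0 <= 1 - b - a + b * a by move: h4; congr (_ <= _); ring.
move: (b * a) h1 h2 h3 h4 => c h1 h2 h3 h4.
by case: s => /=; rewrite ?sub0r ?normrN !ger0_norm; lra.
Qed.

(** Borel induction on [A] for the finite measure |f| dx on [O]. Open sets are exhausted by cutoffs,
    unions correspond to [p + q - p q], and countable unions follow from finite ones by dominated
    convergence. *)
Lemma smooth_approx O f A : open O -> bfun f ->
  (\int[mu]_(x in O) `|f x|%:E < +oo)%E -> bset A ->
  forall e : R, 0 < e -> exists psi : plane R -> R,
    [/\ c1 psi, forall x, 0 <= psi x <= 1, compactly_contained [set x | psi x != 0] O &
      (\int[mu]_(x in O) (`|f x| * `|\1_A x - psi x|)%:E <= e%:E)%E].
Proof.
move=> oO mf intf.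
have mO : bset O by exact: bset_open.
pose D A psi := (\int[mu]_(x in O) (`|f x| * `|\1_A x - psi x|)%:E)%E.
have mD B (psi : plane R -> R) : bset B -> bfun psi ->
    measurable_fun (O : set (mplane R)) ((EFin \o (fun x => `|f x| * `|\1_B x - psi x|)) : mplane R -> \bar R).
  move=> mB mpsi; apply: measurable_funTS.
  apply: mEFin.
  by apply: bfunM; apply: bfun_norm => //; exact: (bfunB (bfun_indic mB)).
have dct (psi_ : nat -> plane R -> R) B : bset B -> (forall n, bfun (psi_ n)) ->
    (forall n x, 0 <= psi_ n x <= 1) ->
    (forall x, O x -> \forall n \near \oo, psi_ n x = \1_B x) ->
    D B (psi_ n) @[n --> \oo] --> 0%E.
  move=> mB mpsi psi01 psiB.
  have h1 : {ae mu, forall x, O x ->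
      (`|f x| * `|\1_B x - psi_ n x|)%:E @[n --> \oo] --> cst 0%E x}.
    apply: aeW => x Ox; apply: cvg_near_cst.
    by move: (psiB x Ox); apply: filterS => n ->; rewrite subrr normr0 mulr0.
  have h2 : mu.-integrable O (fun x => `|f x|%:E).
    apply/integrableP; split.
      by apply: measurable_funTS; apply: mEFin; exact: bfun_norm.
    by under eq_integral do rewrite abse_EFin normr_id.
  have h3 : {ae mu, forall x n, O x ->
      (`|(`|f x| * `|\1_B x - psi_ n x|)%:E| <= `|f x|%:E)%E}.
    apply: aeW => x n Ox; rewrite abse_EFin lee_fin normrM !normr_id ler_piMr//.
    have /andP[p0 p1] := psi01 n x; rewrite indicE.
    by case: (x \in B) => /=; rewrite ler_norml; apply/andP; split; lra.
  have [_ _] := dominated_convergence mO (fun n => mD B _ mB (mpsi n)) (measurable_cst _) h1 h2 h3.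
  by rewrite integral0.
pose G : set (set (plane R)) := [set A | bset A /\ forall e : R, 0 < e -> exists psi : plane R -> R,
    [/\ c1 psi, forall x, 0 <= psi x <= 1, compactly_contained [set x | psi x != 0] O &
      (D A psi <= e%:E)%E]].
have lim0 (u : nat -> \bar R) (e : R) : 0 < e -> u n @[n --> \oo] --> 0%E ->
    exists n, (u n <= e%:E)%E.
  move=> e0 u0.
  move: u0 => /fine_cvgP[fu /cvgrPdist_lt/(_ _ e0) ue].
  have [n [fn /= un]] := filter_ex (filterI fu ue).
  exists n; rewrite -(fineK fn) lee_fin ltW//.
  by move: un; rewrite sub0r normrN; apply: le_lt_trans; exact: ler_norm.
have Gopen V : open V -> G V.
  move=> oV; have mV : bset V by exact: bset_open.
  split=> // e e0; pose psi_ n := cutoff (n.+1 * n.+1) (n.+1%:R^-1) (V `&` O).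
  have h0 n : 0 < (n.+1%:R^-1 : R) by rewrite invr_gt0.
  have [|n Dn] := lim0 (fun n => D V (psi_ n)) e e0.
    apply: dct => //.
    - by move=> n; apply: bfun_continuous; apply: c1_continuous; exact: c1_cutoff.
    - by move=> n x; rewrite cutoff_ge0 cutoff_le1.
    - move=> x Ox; have [Vx|nVx] := pselect (V x).
        rewrite indicE mem_set//; apply: cutoff_exhaust; last by split.
        exact: openI.
      rewrite indicE memNset//; apply: nearW => n; apply/eqP; apply/negPn/negP.
      move=> /(cutoff_supp (h0 n))[sub _]; apply: nVx.
      by have [] := sub x (ballxx x (h0 n)).
  exists (psi_ n); split => //; first exact: c1_cutoff.
    by move=> x; rewrite cutoff_ge0 cutoff_le1.
  exact: (compactly_contained_sub (@subset_refl _ _) (@subIsetr _ V O) (cutoff_cc _ _ (h0 n))).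
have cb (p : plane R -> R) : c1 p -> bfun p by move=> cp; apply: bfun_continuous; exact: c1_continuous.
have Dle A1 A2 A3 p1 p2 p3 : bset A1 -> bset A2 -> bset A3 -> bfun p1 -> bfun p2 -> bfun p3 ->
    (forall x, O x -> `|\1_A1 x - p1 x| <= `|\1_A2 x - p2 x| + `|\1_A3 x - p3 x|) ->
    (D A1 p1 <= D A2 p2 + D A3 p3)%E.
  move=> m1 m2 m3 q1 q2 q3 le.
  rewrite /D -ge0_integralD; [|exact: mO| | | |]; last 4 first.
  - by move=> x _; rewrite lee_fin mulr_ge0.
  - exact: mD.
  - by move=> x _; rewrite lee_fin mulr_ge0.
  - exact: mD.
  apply: ge0_le_integral.
  - exact: mO.
  - by move=> x _; rewrite lee_fin mulr_ge0.
  - exact: mD.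
  - by apply: emeasurable_funD; exact: mD.
  - by move=> x Ox; rewrite -EFinD lee_fin -mulrDr ler_wpM2l// le.
(* [1 - p] is not compactly supported in [O]; it is multiplied by an approximation [q] of the
   constant 1 that is. *)
have GC A1 : G A1 -> G (~` A1).
  move=> [mA1 GA1]; split=> [|e e0]; first exact: bsetC.
  have e2 : 0 < e / 2 by rewrite divr_gt0.
  have [p [cp p01 sp Dp]] := GA1 _ e2.
  have [_ /(_ _ e2)[q [cq q01 sq Dq]]] := Gopen setT openT.
  exists (fun x => q x * (1 - p x)); split.
  - exact: (c1M cq (c1B (c1_cst 1) cp)).
  - move=> x; have /andP[? ?] := p01 x; have /andP[? ?] := q01 x; apply/andP; split; nra.
  - apply: (compactly_contained_sub _ (@subset_refl _ O) sq) => x /=; apply: contra_neq => ->; exact: mul0r.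
  - rewrite [e](_ : _ = e / 2 + e / 2); last by field.
    rewrite EFinD; apply: le_trans (leeD Dq Dp); apply: Dle => //.
    + exact: bsetC.
    + exact: (bset_open openT).
    + by apply: cb; exact: (c1M cq (c1B (c1_cst 1) cp)).
    + exact: cb.
    + exact: cb.
    move=> x Ox; rewrite !indicE in_setC in_setT /=.
    exact: complement_dist (p01 x) (q01 x).
have GU A1 A2 : G A1 -> G A2 -> G (A1 `|` A2).
  move=> [mA1 GA1] [mA2 GA2]; split=> [|e e0]; first exact: bsetU.
  have e2 : 0 < e / 2 by rewrite divr_gt0.
  have [p [cp p01 sp Dp]] := GA1 _ e2; have [q [cq q01 sq Dq]] := GA2 _ e2.
  exists (fun x => p x + q x - p x * q x); split.
  - exact: (c1B (c1D cp cq) (c1M cp cq)).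
  - move=> x; have /andP[? ?] := p01 x; have /andP[? ?] := q01 x; apply/andP; split; nra.
  - apply: (compactly_contained_sub _ (@subset_refl _ O) (compactly_containedU sp sq)) => x /= pq.
    have [p0|] := eqVneq (p x) 0; last by left.
    by right; move: pq; rewrite p0 add0r mul0r subr0.
  - rewrite [e](_ : _ = e / 2 + e / 2); last by field.
    rewrite EFinD; apply: le_trans (leeD Dp Dq); apply: Dle => //.
    + exact: bsetU.
    + by apply: cb; exact: (c1B (c1D cp cq) (c1M cp cq)).
    + exact: cb.
    + exact: cb.
    move=> x Ox; rewrite !indicE in_setU.
    exact: union_dist (p01 x) (q01 x).
move=> mA; suff [] : G A by [].
apply: plane_borel_ind mA => // F GF.
have mF n : bset (F n) by case: (GF n).
have mU : bset (\bigcup_n F n) by exact: (@bigcupT_measurable _ (mplane R)).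
split=> // e e0; pose B n := \big[setU/set0]_(i < n) F i.
have GB n : G (B n).
  rewrite /B; elim: n => [|n ih]; first by rewrite big_ord0; exact: (Gopen _ open0).
  by rewrite big_ord_recr /=; exact: GU.
have e2 : 0 < e / 2 by rewrite divr_gt0.
have [|n Dn] := lim0 (fun n => D (\bigcup_n F n) (\1_(B n))) _ e2.
  apply: dct => //.
  - by move=> n; apply: bfun_indic; case: (GB n).
  - by move=> n x; rewrite indicE; case: (x \in B n); rewrite /= ?lexx ?ler01.
  - move=> x Ox; have [[k _ Fkx]|nFx] := pselect ((\bigcup_n F n) x).
      have xU : (\bigcup_n F n) x by exists k.
      exists k.+1 => // n /= kn.
      have xB : B n x by rewrite /B -bigcup_mkord; exists k.
      by rewrite !indicE (mem_set xU) (mem_set xB).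
    have nxB n : ~ B n x.
      by rewrite /B -bigcup_mkord => -[k _ Fkx]; apply: nFx; exists k.
    by apply: nearW => n; rewrite !indicE (memNset nFx) (memNset (@nxB n)).
have [_ /(_ _ e2)[p [cp p01 sp Dp]]] := GB n.
exists p; split => //.
have mB k : bset (B k) by case: (GB k).
rewrite [e](_ : _ = e / 2 + e / 2); last by field.
rewrite EFinD; apply: le_trans (leeD Dn Dp); apply: Dle => //.
- exact: cb.
- exact: bfun_indic.
- exact: cb.
by move=> x _; rewrite [X in `|X|](_ : _ = (\1_(\bigcup_n F n) x - \1_(B n) x) + (\1_(B n) x - p x)) ?ler_normD//; ring.
Qed.

End approx.

(** * Total variation *)

Section variation.
Context {R : realType}.
Implicit Types (x y v z : plane R) (A O U : set (plane R)) (f g u w : plane R -> R).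

(* The total variation of w in U is at most M; for w = \1_A, Per(A, U) <= M. *)
Definition varle w U (M : R) : Prop :=
  forall phi, test_field U phi -> Iw w (divergence phi) <= M.

Lemma plane_norm_lt x (r : R) : ball 0 r x = (`|x| < r) :> Prop.
Proof. by rewrite -ball_normE /= sub0r normrN. Qed.

(** One [d] serves all base points [z] with |z| <= rho, so that many short translations can be
    chained along a segment. All supports lie in the ball of radius [r + 1 + rho], because [k |v|]
    is at most 1. *)
Lemma Iw_diff_quot w f (r rho : R) v : lint w -> c1 f -> (forall x, ~ ball 0 r x -> f x = 0) ->
  forall e, 0 < e -> exists2 d : R, 0 < d & forall k z, 0 < k < d -> `|z| <= rho ->
    `|Iw w (fun x => f (x + (z + k *: v)) - f (x + z)) - k * Iw w (fun x => 'D_v f (x + z))|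
      <= e * k * L1 w (r + 1 + rho).
Proof.
move=> lw cf f0 e e0.
have [d d0 dP] := c1_compact_unif v cf f0 e0.
have v1 : 0 < `|v| + 1 by rewrite ltr_wpDl.
exists (Num.min d (`|v| + 1)^-1); first by rewrite lt_min d0 invr_gt0.
move=> k z /andP[k0]; rewrite lt_min => /andP[kd kv] zr.
have D0 := @derive_supp _ f r v cf f0.
have bf := c1_bsupp cf f0.
have bD := c1_bsupp_derive v cf f0.
rewrite -(IwZ k lw (bsuppS z bD)).
have b1 : bsupp (fun x => f (x + (z + k *: v)) - f (x + z)).
  by apply: bsuppB; exact: bsuppS.
rewrite -(IwB lw b1 (bsuppZ k (bsuppS z bD))).
apply: Iw_bound => //.
- by apply: bfunB; [exact: b1.1|apply: (bsuppZ _ (bsuppS _ bD)).1].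
- by rewrite mulr_ge0// ltW.
- by move=> x /=; rewrite addrA; apply: dP; rewrite k0.
move=> x /=; rewrite plane_norm_lt => xr.
have kv1 : `|k *: v| <= 1.
  rewrite normrZ (gtr0_norm k0) (@le_trans _ _ (k * (`|v| + 1)))//.
    by apply: ler_wpM2l; [exact: ltW|rewrite lerDl].
  by rewrite -ler_pdivlMr ?div1r// ltW.
have tr s y : `|y| <= s -> ~ ball 0 (r + 1 + rho - s) (x + y).
  rewrite plane_norm_lt => ys xys; apply: xr.
  have := ler_normB (x + y) y; rewrite addrK; move: xys ys; lra.
rewrite !f0 ?D0 ?mulr0 ?subr0//.
- by move: (tr _ _ zr); rewrite addrK.
- move=> h; apply: (tr _ _ zr); rewrite addrK; apply: le_ball h; lra.
- have zk : `|z + k *: v| <= rho + 1 by rewrite (le_trans (ler_normD _ _))// lerD.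
  by move=> h; apply: (tr _ _ zk); apply: le_ball h; lra.
Qed.

Lemma compactly_contained_shift A O U z : compactly_contained A O ->
  (forall x, O (x + z) -> U x) -> compactly_contained [set x | A (x + z)] U.
Proof.
move=> cA OU; have [n An] := compactly_contained_ball cA; case: cA => cA AO.
have [m Am] := compact_ball cA.
apply: (@compactly_contained_closed _ _ [set x | closure A (x + z)] _ (m%:R + `|z|)).
- by move=> x /= Ax; apply: subset_closure.
- apply: (@closed_comp _ _ (fun x : plane R => x + z) (closure A)).
    by move=> x _; apply: cvgD; [exact: cvg_id|exact: cvg_cst].
  exact: closed_closure.
- by move=> x /AO/OU.
- move=> x /Am; rewrite !plane_norm_lt => xz.
  by have := ler_normB (x + z) z; rewrite addrK; move: xz; lra.
Qed.

(** The factor 2, in place of the square root of 2, is the source of the 2 in the translation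
    estimates below. *)
Lemma enorm_le x : enorm x <= 2 * `|x|.
Proof.
rewrite /enorm -[leRHS]ger0_norm ?mulr_ge0// -sqrtr_sqr ler_wsqrtr//.
have h1 := norm_fst x; have h2 := norm_snd x.
have : `|x.1| ^+ 2 <= `|x| ^+ 2 by rewrite ler_sqr ?nnegrE.
have : `|x.2| ^+ 2 <= `|x| ^+ 2 by rewrite ler_sqr ?nnegrE.
rewrite !real_normK ?num_real//; nra.
Qed.

Lemma enorm_ge0 x : 0 <= enorm x. Proof. exact: sqrtr_ge0. Qed.

Lemma enormZ (a : R) x : enorm (a *: x) = `|a| * enorm x.
Proof.
rewrite /enorm /= !exprMn -mulrDr sqrtrM ?sqr_ge0//; congr (_ * _).
exact: sqrtr_sqr.
Qed.

Lemma test_field_c1 U phi : test_field U phi ->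
  [/\ c1 (fun x => (phi x).1), c1 (fun x => (phi x).2) &
    exists r : R, forall x, ~ ball 0 r x -> phi x = 0].
Proof.
move=> [/C1P[c1f c2f] cc _]; split => //.
have [n sn] := compactly_contained_ball cc; exists n%:R => x nx.
by apply/eqP; apply/negPn/negP => px; apply: nx; exact: sn.
Qed.

Lemma bsupp_divergence U phi : test_field U phi -> bsupp (divergence phi).
Proof.
move=> /test_field_c1[c1f c2f [r s]].
apply: (@bsuppD _ ('D_(1, 0) (fun x => (phi x).1)) ('D_(0, 1) (fun x => (phi x).2))).
  by apply: (@c1_bsupp_derive _ _ r) => // x /s ->.
by apply: (@c1_bsupp_derive _ _ r) => // x /s ->.
Qed.

Lemma test_field0 U : test_field U (cst 0).
Proof.
split.
- by apply/C1P; split; exact: c1_cst.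
- have -> : [set x | (cst 0 : plane R -> plane R) x != 0] = set0.
    by apply/seteqP; split=> // x /=; rewrite eqxx.
  by rewrite /compactly_contained closure0; split=> //; exact: compact0.
- by move=> x; rewrite /enorm /= expr0n addr0 sqrtr0.
Qed.

Lemma divergence0 : divergence (cst 0 : plane R -> plane R) = cst 0.
Proof. by apply/funext => x; rewrite /divergence /= !derive_cst addr0. Qed.

Lemma Iw0 w : Iw w (cst 0) = 0.
Proof.
rewrite /Iw /Rintegral; under eq_integral do rewrite mulr0.
by rewrite integral0.
Qed.

Lemma varle_ge0 w U (M : R) : varle w U M -> 0 <= M.
Proof. by move=> /(_ _ (test_field0 U)); rewrite divergence0 Iw0. Qed.

(* The norm of the plane is the sup norm: [v / (2 |v|)] has Euclidean norm at most 1. *)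
Lemma varle_direction w U (M : R) f v : varle w U M -> lint w -> c1 f -> (forall x, `|f x| <= 1) ->
  compactly_contained [set x | f x != 0] U ->
  Iw w ('D_v f) <= 2 * `|v| * M.
Proof.
move=> vw lw cf f1 cc.
have [v0|v0] := eqVneq v 0.
  rewrite v0 normr0 mulr0 mul0r (_ : 'D_0 f = cst 0) ?Iw0//.
  by apply/funext => x; rewrite c1_derive_lin// !mul0r addr0.
have nv : 0 < `|v| by rewrite normr_gt0.
have [n fn] := compactly_contained_ball cc.
have f0 x : ~ ball 0 n%:R x -> f x = 0.
  by move=> nx; apply/eqP; apply/negPn/negP => px; apply: nx; exact: fn.
pose c := (2 * `|v|)^-1; have c0 : 0 < c by rewrite invr_gt0 mulr_gt0.
pose phi x := (c * f x) *: v.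
have cphi (a : R) : c1 (fun x => c * f x * a).
  by apply: (@c1M _ (fun x => c * f x) (cst a)); [apply: (@c1M _ (cst c)) => //|]; exact: c1_cst.
have tphi : test_field U phi.
  split.
  - by apply/C1P; split; exact: cphi.
  - apply: (compactly_contained_sub _ (@subset_refl _ U) cc) => x /=.
    by apply: contra_neq => fx; rewrite /phi fx mulr0 scale0r.
  - move=> x; rewrite /phi enormZ normrM (gtr0_norm c0).
    rewrite -mulrA mulrCA; apply: mulr_ile1 => //.
      by rewrite mulr_ge0 ?enorm_ge0// ltW.
    by rewrite /c mulrC ler_pdivrMr ?mulr_gt0// mul1r enorm_le.
have := vw _ tphi.
have -> : divergence phi = (fun x => c * 'D_v f x).
  apply/funext => x; rewrite /divergence /phi /=.
  have D a (p : plane R) : 'D_p (fun y => c * f y * a) x = c * a * 'D_p f x.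
    have -> : (fun y => c * f y * a) = (f \* cst (c * a)) by apply/funext => y /=; ring.
    rewrite c1_deriveM//; last exact: c1_cst.
    by rewrite derive_cst mulr0 add0r /GRing.scale/= mulrC.
  by rewrite (D v.1) (D v.2) (c1_derive_lin v x cf) mulrDr !mulrA.
rewrite IwZ//; last exact: (c1_bsupp_derive v cf f0).
by rewrite /c ler_pdivrMl ?mulr_gt0// mulrC.
Qed.

(** With [v = - y], the translation is cut into [m + 1] steps of length [k], where [(m + 1) k = 1].
    Each step is, up to [e k], [k] times a directional derivative of a translate of [f]; the
    hypothesis on segments keeps the support of that translate in [U]. *)
Lemma varle_translate u O U (M : R) y f : lint u -> varle u U M ->
  (forall x s, O x -> 0 <= s <= 1 -> U (x + s *: y)) ->
  c1 f -> (forall x, `|f x| <= 1) -> compactly_contained [set x | f x != 0] O ->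
  Iw u (fun x => f (x - y) - f x) <= 2 * `|y| * M.
Proof.
move=> lu vu OU cf f1 cc.
have [n0 fn] := compactly_contained_ball cc.
have f0 x : ~ ball 0 n0%:R x -> f x = 0.
  by move=> nx; apply/eqP; apply/negPn/negP => px; apply: nx; exact: fn.
set v := - y; have -> : `|y| = `|v| by rewrite /v normrN.
have bf := c1_bsupp cf f0.
have bD := c1_bsupp_derive v cf f0.
apply/ler_addgt0Pr => e e0.
pose C := L1 u (n0%:R + 1 + `|v|); have C0 : 0 <= C by exact: L1_ge0.
have e1 : 0 < e / (C + 1) by rewrite divr_gt0// ltr_wpDl.
have [d d0 dP] := Iw_diff_quot `|v| v lu cf f0 e1.
have [m md] := ex_natSinv_lt d0.
pose k : R := m.+1%:R^-1; have k0 : 0 < k by rewrite invr_gt0.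
have mk : m.+1%:R * k = 1 by rewrite mulfV// pnatr_eq0.
have stp (i : nat) : (i <= m.+1)%N ->
    Iw u (fun x => f (x + (i%:R * k) *: v) - f x) <= i%:R * k * (2 * `|v| * M + e).
  elim: i => [|i ih] im.
    rewrite !mul0r (@eq_Iw _ _ _ (cst 0)) ?Iw0// => x.
    by rewrite scale0r addr0 subrr.
  pose z := (i%:R * k) *: v.
  have ik : 0 <= i%:R * k <= 1.
    apply/andP; split; first by rewrite mulr_ge0// ltW.
    by rewrite -[leRHS]mk ler_pM2r// ler_nat ltnW.
  have zv : `|z| <= `|v|.
    by case/andP: ik => ik0 ik1; rewrite /z normrZ (ger0_norm ik0) ler_piMl.
  have b1 (p : plane R) : bsupp (fun x => f (x + p)) by exact: bsuppS.
  rewrite (@eq_Iw _ _ _ ((fun x => f (x + (z + k *: v)) - f (x + z)) \+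
      (fun x => f (x + z) - f x))); last first.
    move=> x /=; rewrite addrA subrK; congr (f (x + _) - f x).
    by rewrite /z -scalerDl -natr1; congr (_ *: _); ring.
  rewrite IwD//; last 2 first.
  - by apply: bsuppB; exact: b1.
  - by apply: bsuppB => //; exact: b1.
  have := ih (ltnW im).
  have kd : 0 < k < d by rewrite k0.
  have := dP k z kd zv; rewrite -/C ler_norml => /andP[_ h1].
  have h2 : Iw u (fun x => 'D_v f (x + z)) <= 2 * `|v| * M.
    rewrite (@eq_Iw _ _ _ ('D_v (fun x => f (x + z)))); last first.
      by move=> x; rewrite derive_shift_plane.
    apply: (varle_direction v vu lu (c1_shift z cf)); first by move=> x; exact: f1.
    apply: (compactly_contained_shift cc) => x Oxz.
    have := OU _ (i%:R * k) Oxz ik.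
    by rewrite /z /v scalerN addrNK.
  have h3 : e / (C + 1) * C <= e.
    by rewrite mulrAC ler_pdivrMr ?ltr_wpDl//; apply: ler_wpM2l; [exact: ltW|lra].
  have h4 : k * Iw u (fun x => 'D_v f (x + z)) <= k * (2 * `|v| * M) by rewrite ler_pM2l.
  have h5 : e / (C + 1) * k * C <= e * k by rewrite mulrAC ler_pM2r.
  have h6 : i.+1%:R = i%:R + 1 :> R by rewrite natr1.
  have -> : i.+1%:R * k * (2 * `|v| * M + e) =
      i%:R * k * (2 * `|v| * M + e) + (k * (2 * `|v| * M) + e * k) by rewrite h6; ring.
  move=> h7; rewrite addrC; apply: lerD; first exact: h7.
  by apply: (le_trans _ (lerD h4 h5)); rewrite -lerBlDl.
have := stp m.+1 (leqnn _); rewrite mk mul1r.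
by under eq_Iw do rewrite scale1r.
Qed.

(** The difference quotients of [f] have integral 0 by translation invariance, and they approximate
    the derivative uniformly. *)
Lemma Iw1_derive f (r : R) v : c1 f -> (forall x, ~ ball 0 r x -> f x = 0) ->
  Iw (cst 1) ('D_v f) = 0.
Proof.
move=> cf f0.
have l1 : lint (cst (1 : R)).
  by apply: (@lint_bounded _ _ 1); [exact: bfun_cst|move=> x /=; rewrite normr1].
have bf := c1_bsupp cf f0.
apply/eqP; rewrite -normr_le0; apply/ler_addgt0Pr => e e0; rewrite add0r.
pose C := L1 (cst 1) (r + 1 + 0); have C0 : 0 <= C by exact: L1_ge0.
have e1 : 0 < e / (C + 1) by rewrite divr_gt0// ltr_wpDl.
have [d d0 dP] := Iw_diff_quot 0 v l1 cf f0 e1.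
have d2 : 0 < d / 2 < d by apply/andP; split; lra.
have z0 : `|0 : plane R| <= 0 by rewrite normr0.
have := dP (d / 2) 0 d2 z0.
have -> : Iw (cst 1) (fun x => f (x + (0 + (d / 2) *: v)) - f (x + 0)) = 0.
  rewrite (IwB (f := fun x => f (x + (0 + (d / 2) *: v))) (g := fun x => f (x + 0)))//;
    [|exact: bsuppS..].
  by rewrite (Iw_shift (w := cst 1))// (Iw_shift (w := cst 1))// subrr.
under [X in _ * X]eq_Iw do rewrite addr0.
rewrite sub0r normrN normrM (gtr0_norm (_ : 0 < d / 2)); last by case/andP: d2.
have e2 : e / (C + 1) * C <= e.
  by rewrite mulrAC ler_pdivrMr ?ltr_wpDl//; apply: ler_wpM2l; [exact: ltW|lra].
have d20 : 0 < d / 2 by case/andP: d2.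
move=> h; rewrite -(ler_pM2l d20); apply: (le_trans h).
by rewrite -/C mulrAC mulrC ler_pM2l.
Qed.

Lemma Iw1_divergence U phi : test_field U phi -> Iw (cst 1) (divergence phi) = 0.
Proof.
move=> /test_field_c1[c1f c2f [r s]].
have l1 : lint (cst (1 : R)).
  by apply: (@lint_bounded _ _ 1); [exact: bfun_cst|move=> x /=; rewrite normr1].
have s1 x : ~ ball 0 r x -> (phi x).1 = 0 by move=> /s ->.
have s2 x : ~ ball 0 r x -> (phi x).2 = 0 by move=> /s ->.
rewrite (IwD (f := 'D_(1, 0) (fun x => (phi x).1)) (g := 'D_(0, 1) (fun x => (phi x).2)))//.
- by rewrite (Iw1_derive _ c1f s1) (Iw1_derive _ c2f s2) addr0.
- exact: c1_bsupp_derive c1f s1.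
- exact: c1_bsupp_derive c2f s2.
Qed.

End variation.

(** * Translation estimates by duality *)

Section translation.
Context {R : realType}.
Implicit Types (x y v z : plane R) (A O U : set (plane R)) (f g u w : plane R -> R).

Lemma indic1 A x : A x -> \1_A x = 1 :> R.
Proof. by move=> Ax; rewrite indicE mem_set. Qed.

Lemma indic0 A x : ~ A x -> \1_A x = 0 :> R.
Proof. by move=> Ax; rewrite indicE memNset. Qed.

Lemma Iw_abs_le w f : lint w -> bsupp f ->
  (`|Iw w f|%:E <= \int[mu]_x (`|w x| * `|f x|)%:E)%E.
Proof.
move=> lw sf; have iwf := lint_integrable lw sf.
rewrite /Iw EFin_normr_Rintegral//.
apply: le_trans (le_abse_integral mu measurableT (measurable_int _ iwf)) _.
by under eq_integral do rewrite abse_EFin normrM.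
Qed.

Lemma Iw_lint w f : lint w -> bsupp f -> (\int[mu]_x (w x * f x)%:E = (Iw w f)%:E)%E.
Proof. by move=> lw sf; rewrite /Iw /Rintegral fineK//; exact: (integrable_fin_num measurableT (lint_integrable lw sf)). Qed.

Lemma lintB u w : lint u -> lint w -> lint (u \- w).
Proof.
move=> [mu' iu] [mw iw]; split=> [|r]; first exact: bfunB.
have mb : bset (ball (0 : plane R) r) by exact: bset_ball.
apply: (@le_lt_trans _ _ (\int[mu]_(x in ball (0%R : plane R) r) (`|u x|%:E + `|w x|%:E))%E).
  apply: ge0_le_integral.
  - exact: mb.
  - by move=> x _; rewrite lee_fin.
  - by apply: measurable_funTS; apply: mEFin; apply: bfun_norm; exact: bfunB.
  - by apply: measurable_funTS; apply: (@mEFin _ (fun x => `|u x| + `|w x|)); apply: bfunD; exact: bfun_norm.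
  - by move=> x _; rewrite -EFinD lee_fin ler_normB.
rewrite ge0_integralD//.
- by apply: lte_add_pinfty; [exact: iu|exact: iw].
- by apply: measurable_funTS; apply: mEFin; exact: bfun_norm.
- by apply: measurable_funTS; apply: mEFin; exact: bfun_norm.
Qed.

Lemma ge0_integral_exhaust O (f : plane R -> \bar R) (c : \bar R) : bset O ->
  measurable_fun setT (f : mplane R -> \bar R) -> (forall x, 0 <= f x)%E ->
  (forall n : nat, (\int[mu]_(x in O `&` ball (0%R : plane R) n%:R) f x <= c)%E) ->
  (\int[mu]_(x in O) f x <= c)%E.
Proof.
move=> mO mf f0 fc.
pose F (n : nat) : set (mplane R) := O `&` ball (0 : plane R) n%:R.
have UF : \bigcup_n F n = O.
  apply/seteqP; split=> [x [n _ []]//|x Ox].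
  exists (Num.truncn `|x|).+1 => //; split => //.
  by rewrite plane_norm_lt truncnS_gt.
have mF n : measurable (F n) by apply: bsetI => //; exact: bset_ball.
have ndF : {homo F : n m / (n <= m)%N >-> (n <= m)%O}.
  move=> n m nm; apply/subsetPset => x [Ox xn]; split => //.
  by apply: le_ball xn; rewrite ler_nat.
have := @ge0_nondecreasing_set_cvg_integral _ _ R F f mu ndF mF
  (fun n => measurable_funTS mf) (fun n x _ => f0 x).
rewrite UF; apply: cvge_le; apply: nearW => n; exact: fc.
Qed.

(** The integral of |f| over [O] is the pairing of [f] with the sign [chi] of [f] on [O]. Replacing
    [chi] by a smooth [psi] supported in [O], the translation can be moved from [u] to [psi], where
    [varle_translate] applies. *)
Lemma translation_bounded u O U (M r : R) y : lint u -> varle u U M -> open O ->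
  O `<=` ball 0 r ->
  (forall x s, O x -> 0 <= s <= 1 -> U (x + s *: y)) ->
  (\int[mu]_(x in O) `|u (x + y)%R - u x|%:E <= (2 * `|y| * M)%:E)%E.
Proof.
move=> lu vu oO Or OU; pose f x := u (x + y) - u x.
have lf : lint f by exact: (lintB (lintS y lu) lu).
have mO := bset_open oO.
have finf : (\int[mu]_(x in O) `|f x|%:E < +oo)%E.
  apply: le_lt_trans (lf.2 r); apply: ge0_subset_integral => //.
  - exact: bset_ball.
  - by apply: measurable_funTS; apply: mEFin; apply: bfun_norm; exact: lf.1.
pose P := [set x | 0 <= f x].
have mP : bset P.
  have -> : P = f @^-1` `[0, +oo[.
    by apply/seteqP; split=> x /=; rewrite in_itv/= andbT.
  by apply: bset_preimage; [exact: lf.1|exact: measurable_itv].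
pose chi x : R := (\1_P x - \1_(~` P) x) * \1_O x.
have schi : bsupp chi.
  split.
    apply: bfunM; last exact: bfun_indic.
    by apply: bfunB; apply: bfun_indic => //; exact: bsetC.
  exists 1, r; split => // x.
    rewrite /chi !indicE in_setC.
    by case: (x \in P); case: (x \in O); rewrite /= ?sub0r ?subr0 ?mulr1 ?mulr0 ?mulN1r ?normrN ?normr1 ?normr0.
  by move=> nb; rewrite /chi !indicE (memNset (A := O)) ?mulr0// => /Or.
have fchi x : f x * chi x = `|f x| * \1_O x.
  rewrite /chi mulrA !indicE in_setC; congr (_ * _).
  have [Px|nPx] := pselect (P x).
    by rewrite (mem_set Px) subr0 mulr1 ger0_norm.
  rewrite (memNset nPx) sub0r mulrN1 ler0_norm//.
  by move/negP: nPx; rewrite -ltNge => /ltW.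
have -> : (\int[mu]_(x in O) `|u (x + y)%R - u x|%:E = (Iw f chi)%:E)%E.
  rewrite -Iw_lint// integral_mkcond; apply: eq_integral => x _.
  rewrite fchi patchE indicE; case: (x \in O); by rewrite ?mulr1 ?mulr0.
rewrite lee_fin; apply/ler_addgt0Pr => e e0.
have e2 : 0 < e / 2 by rewrite divr_gt0.
(* The positive and the negative part of the sign are approximated separately, since [smooth_approx]
   yields values in [0, 1]. *)
have [p [cp p01 sp Dp]] := smooth_approx oO lf.1 finf mP e2.
have [q [cq q01 sq Dq]] := smooth_approx oO lf.1 finf (bsetC mP) e2.
pose psi := p \- q.
have cpsi : c1 psi by exact: c1B.
have psi1 x : `|psi x| <= 1.
  have /andP[? ?] := p01 x; have /andP[? ?] := q01 x.
  by rewrite ler_norml /psi /=; apply/andP; split; lra.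
have ccpsi : compactly_contained [set x | psi x != 0] O.
  apply: (compactly_contained_sub _ (@subset_refl _ O) (compactly_containedU sp sq)) => x /= pq.
  have [p0|] := eqVneq (p x) 0; last by left.
  by right; move: pq; rewrite /psi /= p0 sub0r oppr_eq0.
have [n sn] := compactly_contained_ball ccpsi.
have psi0 x : ~ ball 0 n%:R x -> psi x = 0.
  by move=> nx; apply/eqP; apply/negPn/negP => px; apply: nx; exact: sn.
have spsi := c1_bsupp cpsi psi0.
have H1 : Iw f psi <= 2 * `|y| * M.
  have s1 : bsupp (fun x => psi (x - y)) by exact: bsuppS.
  have -> : Iw f psi = Iw u (fun x => psi (x - y) - psi x).
    rewrite (IwB (f := fun x => psi (x - y)) lu s1 spsi) -(Iw_shift y lu s1).
    under [X in _ = X - _]eq_Iw do rewrite addrK.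
    rewrite /Iw -RintegralB//; last 2 first.
    - exact: (lint_integrable (lintS y lu) spsi).
    - exact: (lint_integrable lu spsi).
    by apply: eq_Rintegral => x _; rewrite mulrBl.
  exact: (varle_translate lu vu OU cpsi psi1 ccpsi).
have H2 : Iw f (chi \- psi) <= e.
  have sd : bsupp (chi \- psi) by exact: bsuppB.
  apply: le_trans (ler_norm _) _; rewrite -lee_fin; apply: le_trans (Iw_abs_le lf sd) _.
  rewrite [e](_ : _ = e / 2 + e / 2); last by field.
  rewrite EFinD; apply: le_trans (leeD Dp Dq).
  have mm A (h : plane R -> R) : bset A -> bfun h ->
      measurable_fun (O : set (mplane R)) ((EFin \o (fun x => `|f x| * `|\1_A x - h x|)) : mplane R -> \bar R).
    move=> mA mh; apply: measurable_funTS; apply: mEFin; apply: bfunM; apply: bfun_norm.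
      exact: lf.1.
    by apply: bfunB => //; exact: bfun_indic.
  have bp : bfun p by apply: bfun_continuous; exact: c1_continuous.
  have bq : bfun q by apply: bfun_continuous; exact: c1_continuous.
  rewrite -ge0_integralD; [|exact: mO| | | |]; last 4 first.
  - by move=> x _; rewrite lee_fin mulr_ge0.
  - exact: mm.
  - by move=> x _; rewrite lee_fin mulr_ge0.
  - by apply: mm => //; exact: bsetC.
  rewrite [leRHS]integral_mkcond; apply: ge0_le_integral.
  - exact: measurableT.
  - by move=> x _; rewrite lee_fin mulr_ge0.
  - by apply: (@mEFin _ (fun x => `|f x| * `|(chi \- psi) x|)); apply: bfunM; apply: bfun_norm; [exact: lf.1|exact: sd.1].
  - apply/(measurable_restrictT _ mO); apply: emeasurable_funD.
      exact: mm.
    by apply: mm => //; exact: bsetC.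
  move=> x _; rewrite patchE; have [Ox|nOx] := pselect (O x).
    rewrite (mem_set Ox) -EFinD lee_fin -mulrDr; apply: ler_wpM2l => //.
    rewrite /chi /psi /= (indic1 Ox) mulr1.
    set a := \1_P x; set b := \1_(~` P) x.
    have -> : a - b - (p x - q x) = (a - p x) - (b - q x) by ring.
    exact: ler_normB.
  have px : p x = 0 by apply/eqP/negPn/negP => ?; apply: nOx; apply: (sp.2); exact: subset_closure.
  have qx : q x = 0 by apply/eqP/negPn/negP => ?; apply: nOx; apply: (sq.2); exact: subset_closure.
  have -> : (chi \- psi) x = 0 by rewrite /chi /psi /= px qx (indic0 nOx) mulr0 !subrr.
  by rewrite (memNset nOx) normr0 mulr0.
have := IwD lf spsi (bsuppB schi spsi).
rewrite (@eq_Iw _ _ _ chi); last by move=> x /=; rewrite addrC subrK.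
by move=> ->; exact: lerD.
Qed.

Lemma translation_le u O U (M : R) y : lint u -> varle u U M -> open O ->
  (forall x s, O x -> 0 <= s <= 1 -> U (x + s *: y)) ->
  (\int[mu]_(x in O) `|u (x + y)%R - u x|%:E <= (2 * `|y| * M)%:E)%E.
Proof.
move=> lu vu oO OU; apply: ge0_integral_exhaust.
- exact: bset_open.
- by apply: (@mEFin _ (fun x => `|u (x + y) - u x|)); apply: bfun_norm; apply: bfunB; [apply: bfunS|]; exact: lu.1.
- by move=> x; rewrite lee_fin.
move=> n; apply: (translation_bounded (r := n%:R) lu vu).
- by apply: openI => //; exact: ball_open.
- by move=> x [].
- by move=> x s [Ox _]; exact: OU.
Qed.

Lemma indic_diff A x y : `|\1_A y - \1_A x| = \1_[set x | A x <> A y] x :> R.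
Proof.
have [Ax|nAx] := pselect (A x); have [Ay|nAy] := pselect (A y).
- by rewrite (indic1 Ax) (indic1 Ay) indic0 ?subrr ?normr0//= => E; apply: E; exact/propext.
- by rewrite (indic1 Ax) (indic0 nAy) indic1 ?sub0r ?normrN ?normr1//= => E; apply: nAy; rewrite -E.
- by rewrite (indic0 nAx) (indic1 Ay) indic1 ?subr0 ?normr1//= => E; apply: nAx; rewrite E.
- by rewrite (indic0 nAx) (indic0 nAy) indic0 ?subrr ?normr0//= => E; apply: E; exact/propext.
Qed.

(** The symmetric difference of [A] and its translate by [- y], with memberships compared as
    propositions. *)
Definition sdiff A y : set (plane R) := [set x | A x <> A (x + y)].

Lemma sdiffE A y : sdiff A y = (A `\` [set x | A (x + y)]) `|` ([set x | A (x + y)] `\` A).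
Proof.
apply/seteqP; split=> x; rewrite /sdiff /=.
  move=> E; have [Ax|nAx] := pselect (A x); [left|right]; split => //.
    by move=> Ay; apply: E; exact/propext.
  by apply: contrapT => nAy; apply: E; exact/propext.
by move=> [[Ax nAy] E|[Ay nAx] E]; [apply: nAy; rewrite -E|apply: nAx; rewrite E].
Qed.

Lemma bset_sdiff A y : bset A -> bset (sdiff A y).
Proof.
by move=> mA; rewrite sdiffE; apply: bsetU; apply: bsetD => //; exact: bset_shift.
Qed.

(** The form in which perimeter bounds of sets enter measure estimates. The bound is in [U], the
    estimate on [O], and the segments from [O] must stay in [U]. *)
Lemma translation_set A O U (M : R) y : bset A -> varle \1_A U M -> open O ->
  (forall x s, O x -> 0 <= s <= 1 -> U (x + s *: y)) ->
  (mu (O `&` sdiff A y) <= (2 * `|y| * M)%:E)%E.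
Proof.
move=> mA vA oO OU; apply: le_trans (translation_le (lint_indic mA) vA oO OU).
have mD := bset_sdiff y mA.
suff -> : (\int[mu]_(x in O) `|\1_A (x + y)%R - \1_A x|%:E = mu (sdiff A y `&` O))%E.
  by rewrite setIC.
rewrite -integral_indic//; last exact: bset_open.
apply: eq_integral => x _; congr EFin.
exact: indic_diff.
Qed.

End translation.

Lemma ge0_integral_comb_le d (T : measurableType d) (R : realType)
    (m : {measure set T -> \bar R}) (p1 p2 : T -> \bar R) (a b c : R) :
  measurable_fun setT p1 -> measurable_fun setT p2 ->
  (forall t, 0 <= p1 t)%E -> (forall t, 0 <= p2 t)%E ->
  (\int[m]_t p1 t <= a%:E)%E -> (\int[m]_t p2 t <= b%:E)%E -> 0 <= c ->
  (\int[m]_t (c%:E * (p1 t + p2 t)) <= (c * (a + b))%:E)%E.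
Proof.
move=> m1 m2 g1 g2 i1 i2 c0.
rewrite ge0_integralZl//; last 2 first.
- exact: emeasurable_funD.
- by move=> t _; exact: adde_ge0.
rewrite ge0_integralD// EFinM EFinD; apply: lee_pmul => //; last exact: leeD.
by apply: adde_ge0; exact: integral_ge0.
Qed.

(** * Coarea inequality *)

Section coarea.
Context {R : realType}.
Implicit Types (x y v z : plane R) (A O U : set (plane R)) (f g u w : plane R -> R).

Lemma erosion_cc A U : open U -> compactly_contained A U ->
  exists2 h : R, 0 < h & forall x, A x -> ball x h `<=` U.
Proof.
move=> oU [cK KU].
have /compact_near_coveringP/(_ _ (0^'+ : set_system R)
    (fun d x => ball x d `<=` U)) := cK.
have FF : Filter (0^'+ : set_system R) by exact: _.
case/(_ FF _) => [x Kx|].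
  have /nbhs_ballP[q /= q0 qx] := open_nbhs_nbhs (conj oU (KU _ Kx)).
  exists (ball x (q / 2), [set d : R | d < q / 2]) => /=.
    split; first by apply: nbhsx_ballx; rewrite divr_gt0.
    by apply: nbhs_right_lt; rewrite divr_gt0.
  move=> [x' d] [/= xx' dq] y x'y; apply: qx.
  have -> : q = q / 2 + q / 2 by field.
  by apply: ball_triangle xx' _; apply: le_ball x'y; exact: ltW.
move=> d0 /= d0p H; exists (d0 / 2); first by rewrite divr_gt0.
move=> x Ax; apply: (H (d0 / 2)) => /=.
- by rewrite sub0r normrN gtr0_norm; lra.
- by rewrite divr_gt0.
- exact: subset_closure.
Qed.

Definition level w (t : R) : set (plane R) := [set x | t < w x].

Lemma bset_level w t : bfun w -> bset (level w t).
Proof.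
move=> mw; have -> : level w t = w @^-1` `]t, +oo[.
  by apply/seteqP; split=> x /=; rewrite /level /= in_itv/= andbT.
by apply: bset_preimage => //; exact: measurable_itv.
Qed.

Lemma measure_between (a b : R) :
  lebesgue_measure [set t | (t < a : Prop) <> (t < b : Prop)] = `|a - b|%:E.
Proof.
wlog ba : a b / b <= a => [H|].
  have [h|h] := leP b a; first exact: H.
  rewrite distrC -H; last exact: ltW.
  by congr (lebesgue_measure _); apply/seteqP; split=> t /= E /esym.
transitivity (lebesgue_measure `[b, a[%classic).
  congr (lebesgue_measure _); apply/seteqP; split=> t; rewrite /= in_itv/=.
    move=> E; apply/andP; split.
      rewrite leNgt; apply/negP => tb; apply: E; apply/propext.
      by split => // _; exact: lt_le_trans tb ba.
    apply: contrapT => ta; apply: E; apply/propext.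
    by split => // tb; case: ta; exact: lt_le_trans tb ba.
  by move=> /andP[bt ta] E; move: ta; rewrite E; apply/negP; rewrite -leNgt.
rewrite lebesgue_measure_itv/= lte_fin ger0_norm ?subr_ge0//.
have [//|h] := ltP b a.
by have -> : a = b; [apply/eqP; rewrite eq_le h|rewrite subrr].
Qed.

(** Tonelli on the region between the graphs of [u] and [w] over [O]; [measure_between] computes its
    vertical sections. *)
Lemma layer_cake O u w : bset O -> bfun u -> bfun w ->
  measurable_fun setT ((fun t => mu (O `&` [set x | level u t x <> level w t x])) :
     measurableTypeR R -> \bar R) /\
  (\int[lebesgue_measure]_t mu (O `&` [set x | level u t x <> level w t x]) =
   \int[mu]_(x in O) `|u x - w x|%:E)%E.
Proof.
move=> mO mu' mw.
pose L (f : plane R -> R) : set (plane R * R) := [set p | p.2 < f p.1].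
have mL f : bfun f -> measurable (L f : set (mplane R * measurableTypeR R)).
  move=> mf.
  have m1 : measurable_fun setT ((fun p => f p.1 - p.2) : mplane R * measurableTypeR R -> R).
    apply: measurable_funB; last exact: measurable_snd.
    by apply: (measurableT_comp mf); exact: measurable_fst.
  have -> : L f = (fun p => f p.1 - p.2) @^-1` `]0, +oo[.
    by apply/seteqP; split=> p; rewrite /L /= in_itv/= andbT subr_gt0.
  by rewrite -[X in measurable X]setTI; apply: m1 => //; exact: measurable_itv.
pose Z : set (plane R * R) := (fst @^-1` O) `&` ((L u `\` L w) `|` (L w `\` L u)).
have mZ : measurable (Z : set (mplane R * measurableTypeR R)).
  apply: measurableI.
    by rewrite -[X in measurable X]setTI; exact: (@measurable_fst _ _ (mplane R) (measurableTypeR R)).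
  by apply: measurableU; apply: measurableD; exact: mL.
have xorP (P Q : Prop) : (P <> Q) <-> (P /\ ~ Q \/ Q /\ ~ P).
  split.
    move=> E; have [p|np] := pselect P; [left|right]; split => //.
      by move=> q; apply: E; exact/propext.
    by apply: contrapT => nq; apply: E; exact/propext.
  by move=> [[p nq] E|[q np] E]; [apply: nq; rewrite -E|apply: np; rewrite E].
have yZ t : mu (O `&` [set x | level u t x <> level w t x]) = (mu \o ysection Z) t.
  rewrite /=; congr (mu _); apply/seteqP; split=> x.
    by move=> [Ox /= /xorP D]; apply/mem_set; split.
  by move=> /set_mem[Ox D]; split => //; exact/xorP.
split.
  under eq_fun do rewrite yZ.
  exact: (@measurable_fun_ysection _ _ (mplane R) (measurableTypeR R) R mu Z mZ).
transitivity (\int[lebesgue_measure]_t fubini_G mu (EFin \o \1_Z) t)%E.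
  apply: eq_integral => t _; rewrite yZ.
  have GE : fubini_G mu (EFin \o \1_Z) = mu \o ysection Z.
    exact: (@indic_fubini_tonelli_GE _ _ (mplane R) (measurableTypeR R) R mu Z mZ).
  by rewrite GE.
transitivity (\int[mu]_x fubini_F lebesgue_measure (EFin \o \1_Z) x)%E.
  exact: (esym (@indic_fubini_tonelli _ _ (mplane R) (measurableTypeR R) R mu lebesgue_measure Z mZ)).
rewrite [RHS]integral_mkcond; apply: eq_integral => x _.
transitivity (lebesgue_measure (xsection Z x)).
  have FE : fubini_F lebesgue_measure (EFin \o \1_Z) = lebesgue_measure \o xsection Z.
    exact: (@indic_fubini_tonelli_FE _ _ (mplane R) (measurableTypeR R) R lebesgue_measure Z mZ).
  by rewrite FE.
rewrite patchE; have [Ox|nOx] := pselect (O x); last first.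
  rewrite (memNset nOx).
  transitivity (lebesgue_measure (set0 : set R)); last by rewrite measure0.
  by congr (lebesgue_measure _); apply/seteqP; split=> // t /set_mem[].
rewrite (mem_set Ox).
rewrite -measure_between; congr (lebesgue_measure _); apply/seteqP; split=> t.
  by move=> /set_mem[_ D]; apply/xorP.
by move=> /xorP D; apply/mem_set; split.
Qed.

Lemma limn_einf_ge (s : nat -> \bar R) (c : \bar R) :
  (\forall n \near \oo, (c <= s n)%E) -> (c <= limn_einf s)%E.
Proof.
move=> [N _ cs]; rewrite limn_einf_lim; apply: lime_ge; first exact: is_cvg_einfs.
exists N => // n /= Nn; apply: le_ereal_inf_tmp => _ [k /= nk <-]; apply: cs.
exact: leq_trans Nn nk.
Qed.

Lemma limn_einf_le (s : nat -> \bar R) (c : \bar R) :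
  (forall n, (s n <= c)%E) -> (limn_einf s <= c)%E.
Proof.
move=> cs; rewrite limn_einf_lim; apply: lime_le; first exact: is_cvg_einfs.
apply: nearW => n; apply: le_trans (cs n); apply: ereal_inf_lbound.
by exists n => //=.
Qed.

(** The way back from translations to test functions: the measure of [sdiff], divided by the length
    of a short translation, controls the pairing of [\1_A] with a derivative. *)
Lemma diff_quot_le A f (e r : R) v : bset A -> c1 f -> (forall x, `|f x| <= 1) ->
  (forall x, ~ ball 0 r x -> f x = 0) -> 0 < e ->
  exists2 d : R, 0 < d & forall k O, 0 < k < d -> bset O -> (forall x, ~ O x -> f x = 0) ->
    ((Iw \1_A ('D_v f))%:E <= (k^-1)%:E * mu (O `&` sdiff A (k *: v)) + e%:E)%E.
Proof.
move=> mA cf f1 f0 e0.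
have lA := lint_indic mA.
have bf := c1_bsupp cf f0.
pose C := L1 \1_A (r + 1 + 0); have C0 : 0 <= C by exact: L1_ge0.
have e1 : 0 < e / (C + 1) by rewrite divr_gt0// ltr_wpDl.
(* The direction is [- v]: a change of variables turns [f (x - k v)] into [\1_A (x + k v)], which is
   what [sdiff] compares with [\1_A x]. *)
have [d d0 dP] := Iw_diff_quot 0 (- v) lA cf f0 e1.
exists d => // k O /andP[k0 kd] mO fO.
have k0d : 0 < k < d by rewrite k0.
have z0 : `|0 : plane R| <= 0 by rewrite normr0.
have := dP k 0 k0d z0; rewrite -/C.
under [X in _ - _ * X]eq_Iw do rewrite addr0.
have -> : Iw \1_A ('D_(- v) f) = - Iw \1_A ('D_v f).
  rewrite -[RHS]mulN1r -(IwZ (-1) lA (c1_bsupp_derive v cf f0)).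
  by apply: eq_Iw => x; rewrite (c1_derive_lin (- v) x cf) (c1_derive_lin v x cf) !mulNr -opprD mul1r.
rewrite mulrN opprK.
set D := Iw \1_A ('D_v f); set I := Iw _ _.
have -> : I = Iw (fun x => \1_A (x + k *: v) - \1_A x) f.
  have s1 : bsupp (fun x => f (x - k *: v)) by exact: bsuppS.
  have -> : I = Iw \1_A (fun x => f (x - k *: v)) - Iw \1_A f.
    rewrite -IwB//; apply: eq_Iw => x /=; by rewrite add0r scalerN addr0.
  rewrite -(Iw_shift (k *: v) lA s1).
  under [X in X - _ = _]eq_Iw do rewrite addrK.
  rewrite /Iw -RintegralB//; last 2 first.
  - exact: (lint_integrable (lintS _ lA) bf).
  - exact: (lint_integrable lA bf).
  by apply: eq_Rintegral => x _; rewrite mulrBl.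
set J := Iw _ _ => h.
have [->|mfin] := eqVneq (mu (O `&` sdiff A (k *: v))) +oo%E.
  by rewrite gt0_muley ?addye ?leey// lte_fin invr_gt0.
have mfin' : mu (O `&` sdiff A (k *: v)) \is a fin_num.
  by rewrite ge0_fin_numE ?ltey// measure_ge0.
have mD := bset_sdiff (k *: v) mA.
have hJ : `|J| <= fine (mu (O `&` sdiff A (k *: v))).
  have lJ : lint (fun x => \1_A (x + k *: v) - \1_A x).
    exact: (lintB (lintS _ lA) lA).
  rewrite -lee_fin fineK//; apply: le_trans (Iw_abs_le lJ bf) _.
  have mOD : bset (O `&` sdiff A (k *: v)) by exact: bsetI.
  rewrite -[leRHS](_ : \int[mu]_x (\1_(O `&` sdiff A (k *: v)) x)%:E = _)%E; last first.
    by rewrite (integral_indic _ measurableT mOD) setIT.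
  apply: ge0_le_integral.
  - exact: measurableT.
  - by move=> x _; rewrite lee_fin mulr_ge0.
  - apply: (@mEFin _ (fun x => `|\1_A (x + k *: v) - \1_A x| * `|f x|)).
    by apply: bfunM; apply: bfun_norm; [exact: lJ.1|exact: bf.1].
  - by apply: mEFin; exact: bfun_indic.
  - move=> x _; rewrite lee_fin indic_diff.
    have [Ox|/fO ->] := pselect (O x); last by rewrite normr0 mulr0.
    have [Dx|Dx] := pselect (sdiff A (k *: v) x).
      rewrite (indic1 (A := [set x0 | A x0 <> A (x + k *: v)]))//.
      by rewrite (indic1 (A := O `&` _))// mul1r.
    by rewrite (indic0 (A := [set x0 | A x0 <> A (x + k *: v)]))// mul0r.
rewrite -[mu _]fineK// -EFinM -EFinD lee_fin.
have h2 : e / (C + 1) * C <= e.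
  by rewrite mulrAC ler_pdivrMr ?ltr_wpDl//; apply: ler_wpM2l; [exact: ltW|lra].
rewrite -(ler_pM2l k0) mulrDr mulrA mulfV ?gt_eqF// mul1r.
have h3 : e / (C + 1) * k * C <= k * e by rewrite mulrAC mulrC ler_pM2l.
have h4 : k * D - `|J| <= `|J + k * D|.
  by rewrite (le_trans _ (ler_norm _))//; have := ler_norm (- J); rewrite normrN; lra.
move: h hJ h3 h4; lra.
Qed.

Lemma enorm_fst x : `|x.1| <= enorm x.
Proof. by rewrite /enorm -sqrtr_sqr ler_wsqrtr// lerDl sqr_ge0. Qed.

Lemma enorm_snd x : `|x.2| <= enorm x.
Proof. by rewrite /enorm -sqrtr_sqr ler_wsqrtr// lerDr sqr_ge0. Qed.

(* Level sets are measured by difference quotients, which disintegrate by the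
   layer cake formula; the price is the constant 4. *)
Lemma coarea w U (M : R) : lint w -> open U -> varle w U M ->
  exists g : R -> \bar R, [/\ measurable_fun setT (g : measurableTypeR R -> \bar R),
    forall t, (0 <= g t)%E, (\int[lebesgue_measure]_t g t <= (4 * M)%:E)%E &
    forall t phi, test_field U phi -> ((Iw \1_(level w t) (divergence phi))%:E <= g t)%E].
Proof.
move=> lw oU vw.
have M0 := varle_ge0 vw.
pose k n : R := n.+1%:R^-1; have k0 n : 0 < k n by rewrite invr_gt0.
(* The interior of an erosion: it is open, segments of length [k n] starting in it stay in [U], and
   the support of any given test field lies in it for [n] large. *)
pose O n : set (plane R) := [set x | ball x (2 * k n) `<=` U]^°.
have oO n : open (O n) by exact: open_interior.
have mO n : bset (O n) by exact: bset_open.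
pose e1 : plane R := (1, 0); pose e2 : plane R := (0, 1).
have n1 : `|e1| = 1 by rewrite plane_normE /= normr0 normr1; apply/max_idPl.
have n2 : `|e2| = 1 by rewrite plane_normE /= normr0 normr1; apply/max_idPr.
pose p n v t := mu (O n `&` sdiff (level w t) (k n *: v)).
have pP n v : `|v| = 1 -> measurable_fun setT (p n v : measurableTypeR R -> \bar R) /\
    (\int[lebesgue_measure]_t p n v t <= (k n * (2 * M))%:E)%E.
  move=> v1; have [mp ip] := layer_cake (mO n) lw.1 (bfunS (k n *: v) lw.1).
  split; first exact: mp.
  rewrite [leLHS]ip; under eq_integral do rewrite distrC.
  have := translation_le (O := O n) (y := k n *: v) lw vw (oO n).
  rewrite normrZ v1 mulr1 (gtr0_norm (k0 n)) mulrAC mulrC; apply.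
  move=> x s /interior_subset/= xU /andP[s0 s1]; apply: xU.
  rewrite -ball_normE /= opprD addNKr normrN normrZ (ger0_norm s0).
  rewrite normrZ v1 mulr1 (gtr0_norm (k0 n)).
  by have := k0 n; nra.
have p0 n v t : (0 <= p n v t)%E by exact: measure_ge0.
pose q n t : \bar R := ((k n)^-1%:E * (p n e1 t + p n e2 t))%E.
have q0 n t : (0 <= q n t)%E.
  by rewrite /q mule_ge0// ?lee_fin ?invr_ge0 ?(ltW (k0 n))// adde_ge0.
have mq n : measurable_fun setT (q n : measurableTypeR R -> \bar R).
  apply: emeasurable_funM; first exact: measurable_cst.
  by apply: emeasurable_funD; [case: (pP n e1 n1)|case: (pP n e2 n2)].
(* The lower limit is measurable in [t] and dominates all test fields at once. By Fatou its integral
   is at most 4 M: each of the two coordinate directions contributes 2 M. *)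
exists (fun t => limn_einf (q^~ t)); split.
- have -> : (fun t => limn_einf (q^~ t)) = (fun t => limn (einfs (q^~ t))).
    by apply/funext => t; rewrite limn_einf_lim.
  apply: (@emeasurable_fun_cvg _ (measurableTypeR R) R setT (fun n t => einfs (q^~ t) n)).
    by move=> n; exact: measurable_fun_einfs.
  by move=> t _; exact: is_cvg_einfs.
- by move=> t; apply: limn_einf_ge; exact: nearW.
- apply: le_trans (fatou lebesgue_measure (@measurableT _ (measurableTypeR R)) mq (fun n t _ => q0 n t)) _.
  apply: limn_einf_le => n.
  have [m1 i1] := pP n e1 n1; have [m2 i2] := pP n e2 n2.
  rewrite (_ : 4 * M = (k n)^-1 * (k n * (2 * M) + k n * (2 * M))); last first.
    by field; rewrite gt_eqF.
  have kn0 : 0 <= (k n)^-1 by rewrite invr_ge0 ltW.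
  exact: (ge0_integral_comb_le m1 m2 (p0 n e1) (p0 n e2) i1 i2 kn0).
move=> t phi tphi; apply/lee_addgt0Pr => e e0.
have ee : 0 < e / 2 by rewrite divr_gt0.
have [_ cphi p1] := tphi.
have [h h0 hU] := erosion_cc oU cphi.
have [c1f c2f [r sr]] := test_field_c1 tphi.
have mA := bset_level t lw.1; have lA := lint_indic mA.
have [d1 d10 D1] := diff_quot_le e1 mA c1f
  (fun x => le_trans (enorm_fst (phi x)) (p1 x)) (fun x nb => congr1 fst (sr x nb)) ee.
have [d2 d20 D2] := diff_quot_le e2 mA c2f
  (fun x => le_trans (enorm_snd (phi x)) (p1 x)) (fun x nb => congr1 snd (sr x nb)) ee.
have h3 : 0 < h / 3 by rewrite divr_gt0.
rewrite -leeBlDr//; apply: limn_einf_ge; near=> n.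
have kd1 : 0 < k n < d1.
  by rewrite k0 /k /=; near: n; exact: (near_infty_natSinv_lt (PosNum d10)).
have kd2 : 0 < k n < d2.
  by rewrite k0 /k /=; near: n; exact: (near_infty_natSinv_lt (PosNum d20)).
have kh : k n < h / 3 by near: n; exact: (near_infty_natSinv_lt (PosNum h3)).
have phiO x : ~ O n x -> phi x = 0.
  move=> nO; apply/eqP/negPn/negP => px; apply: nO; apply/nbhs_ballP.
  exists (k n) => /=; first exact: k0.
  move=> y xy z yz; apply: (hU x px); have -> : h = h / 3 + (h / 3 + h / 3) by field.
  apply: (le_ball (e1 := k n + 2 * k n)); first by move: kh; lra.
  exact: ball_triangle xy yz.
have H1 := D1 (k n) (O n) kd1 (mO n) (fun x nO => congr1 fst (phiO x nO)).
have H2 := D2 (k n) (O n) kd2 (mO n) (fun x nO => congr1 snd (phiO x nO)).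
rewrite leeBlDr//.
have -> : Iw \1_(level w t) (divergence phi) = Iw \1_(level w t) ('D_e1 (fun x => (phi x).1)) +
    Iw \1_(level w t) ('D_e2 (fun x => (phi x).2)).
  rewrite -(IwD lA); first by apply: eq_Iw.
    by apply: (c1_bsupp_derive _ c1f (r := r)) => x /sr ->.
  by apply: (c1_bsupp_derive _ c2f (r := r)) => x /sr ->.
rewrite EFinD; apply: le_trans (leeD H1 H2) _.
rewrite /q (ge0_muleDr _ (p0 n e1 t) (p0 n e2 t)).
rewrite [e in leRHS](_ : e = e / 2 + e / 2); last by field.
by rewrite EFinD addeACA.
Unshelve. all: by end_near. Qed.

End coarea.

(** * Operations on test fields and perimeters *)

Section perimeter.
Context {R : realType}.
Implicit Types (x y v z : plane R) (A B O U V L : set (plane R)) (f g u w eta : plane R -> R).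
Implicit Types phi psi : plane R -> plane R.

Lemma test_field_sub U V phi : U `<=` V -> test_field U phi -> test_field V phi.
Proof.
by move=> UV [c cc e]; split => //; exact: (compactly_contained_sub (@subset_refl _ _) UV cc).
Qed.

Lemma varle_sub w U V (M : R) : U `<=` V -> varle w V M -> varle w U M.
Proof. by move=> UV h phi /(test_field_sub UV)/h. Qed.

Lemma varle_le w U (M N : R) : M <= N -> varle w U M -> varle w U N.
Proof. by move=> MN h phi /h/le_trans; apply. Qed.

Lemma c1_deriveD f g v x : c1 f -> c1 g -> 'D_v (f \+ g) x = 'D_v f x + 'D_v g x.
Proof. by move=> cf cg; rewrite deriveD//; exact: c1_derivable. Qed.

Lemma test_field_add U V phi psi : U `&` V = set0 -> test_field U phi ->
  test_field V psi -> test_field (U `|` V) (phi \+ psi).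
Proof.
move=> UV [/C1P[c1 c2] cp ep] [/C1P[d1 d2] cq eq]; split.
- by apply/C1P; split; [exact: (c1D c1 d1)|exact: (c1D c2 d2)].
- have cp' := compactly_contained_sub (@subset_refl _ _) (@subsetUl _ U V) cp.
  have cq' := compactly_contained_sub (@subset_refl _ _) (@subsetUr _ U V) cq.
  apply: (compactly_contained_sub _ (@subset_refl _ _) (compactly_containedU cp' cq')) => x /=.
  by have [->|] := eqVneq (phi x) 0; [rewrite add0r; right|left].
- move=> x /=; have [->|px] := eqVneq (phi x) 0; first by rewrite add0r.
  have [->|qx] := eqVneq (psi x) 0; first by rewrite addr0.
  exfalso; suff : (U `&` V) x by rewrite UV.
  by split; [apply: cp.2|apply: cq.2]; exact: subset_closure.
Qed.

Lemma divergence_add U V phi psi : test_field U phi -> test_field V psi ->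
  divergence (phi \+ psi) = divergence phi \+ divergence psi.
Proof.
move=> /test_field_c1[c1 c2 _] /test_field_c1[d1 d2 _]; apply/funext => x.
rewrite /divergence /=.
have D a (f g : plane R -> R) := @c1_deriveD f g a x.
by rewrite (D _ _ _ c1 d1) (D _ _ _ c2 d2) addrACA.
Qed.

Definition smul eta phi x : plane R := eta x *: phi x.

(** The closed set [L] contains the support of [eta]; its intersection with the compact support of
    [phi] is compact and lies in [V], although neither [phi] nor [eta] is supported there alone. *)
Lemma test_field_smul U V L phi eta : test_field U phi -> c1 eta ->
  (forall x, 0 <= eta x <= 1) -> closed L -> (forall x, eta x != 0 -> L x) ->
  L `&` U `<=` V -> test_field V (smul eta phi).
Proof.
move=> [/C1P[c1f c2f] [cc cU] ep] ce e01 cL eL LV; split.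
- by apply/C1P; split; [exact: (c1M ce c1f)|exact: (c1M ce c2f)].
- pose C := closure [set x | phi x != 0] `&` L.
  have cC : compact C by apply: compact_closedI.
  have AC : [set x | smul eta phi x != 0] `<=` C.
    move=> x /= sx; split.
      by apply: subset_closure => /=; apply: contra_neq sx => p0; rewrite /smul p0 scaler0.
    by apply: eL; apply: contra_neq sx => p0; rewrite /smul p0 scale0r.
  have [n Cn] := compact_ball cC.
  apply: (compactly_contained_closed AC _ _ Cn).
    by apply: closedI => //; exact: closed_closure.
  by move=> x [/cU Ux Lx]; apply: LV.
- move=> x; rewrite /smul enormZ; have /andP[e0 e1] := e01 x.
  by rewrite (ger0_norm e0); apply: mulr_ile1 => //; exact: enorm_ge0.
Qed.

Definition gradsum f x : R := `|'D_(1, 0) f x| + `|'D_(0, 1) f x|.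

Lemma divergence_smul U phi eta x : test_field U phi -> c1 eta ->
  divergence (smul eta phi) x = eta x * divergence phi x +
    ('D_(1, 0) eta x * (phi x).1 + 'D_(0, 1) eta x * (phi x).2).
Proof.
move=> /test_field_c1[c1f c2f _] ce; rewrite /divergence /smul /=.
have D a (f g : plane R -> R) (cf : c1 f) (cg : c1 g) := @c1_deriveM _ f g a x cf cg.
rewrite (D _ _ _ ce c1f) (D _ _ _ ce c2f) mulrDr addrACA.
by congr (_ + (_ + _)); exact: mulrC.
Qed.

Lemma dot_grad_le U phi eta x : test_field U phi ->
  `|'D_(1, 0) eta x * (phi x).1 + 'D_(0, 1) eta x * (phi x).2| <= gradsum eta x.
Proof.
move=> [_ _ ep]; rewrite (le_trans (ler_normD _ _))// lerD// normrM ler_piMr//.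
  exact: le_trans (enorm_fst _) (ep x).
exact: le_trans (enorm_snd _) (ep x).
Qed.

Lemma bsupp_norm f : bsupp f -> bsupp (fun x => `|f x|).
Proof.
move=> [mf [M [r [M0 fM f0]]]]; split; first exact: bfun_norm.
exists M, r; split => // x; first by rewrite normr_id.
by move=> /f0 ->; rewrite normr0.
Qed.

Lemma bsupp_gradsum f (r : R) : c1 f -> (forall x, ~ ball 0 r x -> f x = 0) -> bsupp (gradsum f).
Proof.
move=> cf f0; apply: (@bsuppD _ (fun x => `|'D_(1, 0) f x|) (fun x => `|'D_(0, 1) f x|));
  by apply: bsupp_norm; exact: c1_bsupp_derive cf f0.
Qed.

Lemma gradsum_ge0 f x : 0 <= gradsum f x.
Proof. exact: addr_ge0. Qed.

Lemma Iw_le w f g : lint w -> bsupp f -> bsupp g -> (forall x, 0 <= w x) ->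
  (forall x, f x <= g x) -> Iw w f <= Iw w g.
Proof.
move=> lw sf sg w0 fg; rewrite -lee_fin -!Iw_lint//; apply: le_integral => //.
- exact: lint_integrable.
- exact: lint_integrable.
- by move=> x _; rewrite lee_fin ler_wpM2l.
Qed.

Lemma Iw_ge0 w f : (forall x, 0 <= w x) -> (forall x, 0 <= f x) -> 0 <= Iw w f.
Proof.
move=> w0 f0; apply: fine_ge0; apply: integral_ge0 => x _.
by rewrite lee_fin mulr_ge0.
Qed.

Lemma indic_nonneg A x : 0 <= \1_A x :> R.
Proof. by rewrite indicE ler0n. Qed.

(** The divergence of a test field has integral 0 over the plane, so passing to the complement
    amounts to changing the sign of the field. *)
Lemma varleC A U (M : R) : bset A -> varle \1_A U M -> varle \1_(~` A) U M.
Proof.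
move=> mA vA phi tphi.
have sd := bsupp_divergence tphi.
have tN : test_field U (fun x => (-1) *: phi x).
  case: tphi => /C1P[c1f c2f] cc ep; split.
  - apply/C1P; split.
    + exact: (c1M (c1_cst (-1)) c1f).
    + exact: (c1M (c1_cst (-1)) c2f).
  - apply: (compactly_contained_sub _ (@subset_refl _ _) cc) => x /=.
    by apply: contra_neq => ->; rewrite scaler0.
  - by move=> x; rewrite enormZ normrN normr1 mul1r.
have dN : divergence (fun x => (-1) *: phi x) = fun x => (-1) * divergence phi x.
  have [c1f c2f _] := test_field_c1 tphi.
  apply/funext => x; rewrite (@divergence_smul U phi (cst (-1)) x tphi (c1_cst (-1))).
  by rewrite !derive_cst !mul0r !addr0.
have := vA _ tN; rewrite dN IwZ//; last exact: lint_indic.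
suff -> : Iw \1_(~` A) (divergence phi) = - Iw \1_A (divergence phi) by rewrite mulN1r.
have l1 : lint (cst (1 : R)).
  by apply: (@lint_bounded _ _ 1); [exact: bfun_cst|move=> x /=; rewrite normr1].
have lA := lint_indic mA; have lC := lint_indic (bsetC mA).
apply/eqP; rewrite -addr_eq0 -(Iw1_divergence tphi); apply/eqP.
rewrite /Iw -RintegralD//; last 2 first.
- exact: (lint_integrable lC sd).
- exact: (lint_integrable lA sd).
apply: eq_Rintegral => x _; rewrite /= -mulrDl; congr (_ * _).
have [Ax|nAx] := pselect (A x).
  by rewrite (indic1 Ax) indic0 ?add0r// => /(_ Ax).
by rewrite (indic0 nAx) indic1 ?addr0.
Qed.

(** A real supremum, meaningful in the presence of some [varle] bound. Adding the perimeters in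
    disjoint sets needs actual values, whereas [varle] gives only upper bounds. *)
Definition per A U : R := sup [set Iw \1_A (divergence phi) | phi in test_field U].

Lemma per_bound A U (M : R) : varle \1_A U M -> varle \1_A U (per A U).
Proof.
move=> vA phi tphi; apply: sup_upper_bound; last by exists phi.
split; first by exists (Iw \1_A (divergence phi)), phi.
by exists M => _ [psi tpsi <-]; exact: vA.
Qed.

Lemma per_le A U (M : R) : varle \1_A U M -> per A U <= M.
Proof.
move=> vA; apply: ge_sup => [|_ [psi tpsi <-]]; last exact: vA.
by exists (Iw \1_A (divergence (cst 0))), (cst 0) => //; exact: test_field0.
Qed.

Lemma per_sub A U V (M : R) : U `<=` V -> varle \1_A V M -> per A U <= per A V.
Proof. by move=> UV vA; apply: per_le; exact: varle_sub UV (per_bound vA). Qed.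

Lemma per_ge0 A U (M : R) : varle \1_A U M -> 0 <= per A U.
Proof. by move=> /per_bound/varle_ge0. Qed.

(** Fields with supports in disjoint sets add up to a field of norm at most 1. *)
Lemma perD A U V (M : R) : bset A -> U `&` V = set0 -> varle \1_A (U `|` V) M ->
  per A U + per A V <= per A (U `|` V).
Proof.
move=> mA UV vA; have vAU := varle_sub (@subsetUl _ U V) vA.
rewrite -lerBrDr; apply: per_le => phi tphi.
rewrite lerBrDr addrC -lerBrDr; apply: per_le => psi tpsi.
rewrite lerBrDr -(IwD (lint_indic mA) (bsupp_divergence tpsi) (bsupp_divergence tphi)).
have <- := divergence_add tpsi tphi.
apply: (per_bound vA); rewrite setUC; apply: test_field_add => //.
by rewrite setIC.
Qed.

End perimeter.

(** * Quasiminimality on superlevel sets *)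

Section layer.
Context {R : realType}.
Implicit Types (x y z : plane R) (A B O U V L : set (plane R)) (f g u w eta v : plane R -> R).
Implicit Types phi psi : plane R -> plane R.

(* Only the removal of closed sets is used; addition is removal from the complement. *)
Definition qm (K : R) A B : Prop := forall U G (M : R), open U -> compactly_contained U B ->
  closed G -> compactly_contained G U -> varle \1_(A `\` G) U M -> varle \1_A U (K * M).

(** For [a > 0] it is 1 where v <= s and 0 where v >= s + 1 / (2 a). The transition takes half the
    height 1 / a of a slab, so that the support stays off the upper boundary of the slab. *)
Definition ramp (a s : R) v x : R := 1 - step (2 * a * (v x - s)).

Lemma ramp_arg (a s : R) v : c1 v -> c1 (fun x => 2 * a * (v x - s)).
Proof. by move=> cv; exact: (c1M (c1_cst (2 * a)) (c1B cv (c1_cst s))). Qed.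

Lemma c1_ramp (a s : R) v : c1 v -> c1 (ramp a s v).
Proof. by move=> cv; exact: (c1B (c1_cst 1) (c1_step (ramp_arg a s cv))). Qed.

Lemma ramp01 (a s : R) v x : 0 <= ramp a s v x <= 1.
Proof. by rewrite /ramp subr_ge0 step_le1 gerBl step_ge0. Qed.

Lemma derive_ramp (a s : R) v e x : c1 v ->
  'D_e (ramp a s v) x = - (step' (2 * a * (v x - s)) * (2 * a * 'D_e v x)).
Proof.
move=> cv; have ca := ramp_arg a s cv.
have -> : ramp a s v = cst 1 \+ (\- (step \o (fun x => 2 * a * (v x - s)))) by [].
rewrite c1_deriveD; [|exact: c1_cst|by apply: c1N; exact: c1_step].
rewrite derive_cst add0r deriveN; last by apply: c1_derivable; exact: c1_step.
rewrite derive_step//; congr (- (_ * _)).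
have -> : (fun x => 2 * a * (v x - s)) = cst (2 * a) \* (v \+ cst (- s)) by [].
have cv' : c1 (v \+ cst (- s)) by exact: (c1D cv (c1_cst (- s))).
rewrite (c1_deriveM e x (c1_cst (2 * a)) cv').
by rewrite derive_cst (c1_deriveD e x cv (c1_cst (- s))) derive_cst mulr0 !addr0.
Qed.

Definition slab v (s t : R) : set (plane R) := [set x | s < v x < t].

Lemma gradsum_ramp (a s : R) v x : 0 < a -> c1 v -> s < v x ->
  gradsum (ramp a s v) x <= 4 * a * (\1_(slab v s (s + a^-1)) x * gradsum v x).
Proof.
move=> a0 cv sv.
have e (d : plane R) : `|'D_d (ramp a s v) x| <= 4 * a * (\1_(slab v s (s + a^-1)) x * `|'D_d v x|).
  rewrite derive_ramp// normrN.
  have -> (b D : R) : `|b * (2 * a * D)| = `|b| * (2 * a * `|D|).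
    by rewrite normrM (normrM (2 * a)) (gtr0_norm (x := 2 * a))// mulr_gt0.
  have [h|h] := ltP (v x) (s + a^-1).
    rewrite indic1 ?mul1r; last by rewrite /slab /= sv h.
    have h1 := step'_bound (2 * a * (v x - s)).
    set d' := `|'D_d v x|; set t := `|step' _| in h1 *.
    have d0 : 0 <= d' by exact: normr_ge0.
    have ad : 0 <= 2 * a * d' by rewrite -mulrA; apply: mulr_ge0 => //; exact: mulr_ge0 (ltW a0) d0.
    by rewrite (_ : 4 * a * d' = 2 * (2 * a * d')); [exact: ler_wpM2r|ring].
  have h1 : 1 <= 2 * a * (v x - s).
    have : 1 <= a * (v x - s) by rewrite -ler_pdivrMl// mulr1 lerBrDl.
    by nra.
  rewrite step'_out ?normr0 ?mul0r; last by right.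
  by rewrite !mulr_ge0 ?indic_nonneg // ltW.
by rewrite /gradsum !mulrDr lerD.
Qed.

Lemma open_superlevel v (s : R) : continuous v -> open [set x | s < v x].
Proof. by move=> cv; apply: (@open_comp _ _ v [set t | s < t]) => //; exact: open_gt. Qed.

Lemma open_sublevel v (s : R) : continuous v -> open [set x | v x < s].
Proof. by move=> cv; apply: (@open_comp _ _ v [set t | t < s]) => //; exact: open_lt. Qed.

Lemma closed_sublevel v (s : R) : continuous v -> closed [set x | v x <= s].
Proof. by move=> cv; apply: (@closed_comp _ _ v [set t | t <= s]) => //; exact: closed_le. Qed.

Lemma closed_superlevel v (s : R) : continuous v -> closed [set x | s <= v x].
Proof. by move=> cv; apply: (@closed_comp _ _ v [set t | s <= t]) => //; exact: closed_ge. Qed.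

Lemma bset_slab v (s t : R) : continuous v -> bset (slab v s t).
Proof.
move=> cv; have -> : slab v s t = [set x | s < v x] `&` [set x | v x < t].
  by apply/seteqP; split=> x; rewrite /slab /= => /andP.
by apply: bset_open; apply: openI; [exact: open_superlevel|exact: open_sublevel].
Qed.

(** Product rule: [ramp] times a test field of {v > s} is a test field of the slab, which gives the
    perimeter of [A] there; the gradient of [ramp] gives the integral, with 4 a from |step'| <= 2
    and the inner factor 2 a. *)
Lemma varle_ramp A (P a s : R) v : bset A -> varle \1_A setT P -> c1 v ->
  (exists r : R, forall x, ~ ball 0 r x -> v x = 0) -> 0 < a ->
  varle (fun x => \1_A x * ramp a s v x) [set x | s < v x]
    (per A (slab v s (s + a^-1)) + 4 * a * Iw \1_(A `&` slab v s (s + a^-1)) (gradsum v)).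
Proof.
move=> mA vA cv [r v0] a0 phi tphi; set L := slab v s (s + a^-1).
have ce := c1_ramp a s cv; have cc := c1_continuous cv.
have tL : test_field L (smul (ramp a s v) phi).
  apply: (test_field_smul (L := [set x | v x <= s + (2 * a)^-1]) tphi ce).
  - by move=> x; exact: ramp01.
  - exact: closed_sublevel.
  - move=> x ex /=; rewrite leNgt; apply/negP => h; move: ex; rewrite /ramp step_ge1 ?subrr ?eqxx//.
    rewrite -ler_pdivrMl ?mulr_gt0// mulr1 lerBrDl; exact: ltW.
  - move=> x [/= h sv]; rewrite /L /slab /= sv; apply: le_lt_trans h _.
    by rewrite ltrD2l ltf_pV2 ?posrE ?mulr_gt0// ltr_pMl// ltr1n.
have lA := lint_indic mA.
have sdv := bsupp_divergence tphi.
have sL := bsupp_divergence tL.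
have sed : bsupp (fun x => ramp a s v x * divergence phi x).
  have : bsupp (divergence phi \* ramp a s v).
    apply: bsuppM => //; first by apply: bfun_continuous; exact: c1_continuous.
    by exists 1 => x; have /andP[? ?] := ramp01 a s v x; rewrite ger0_norm.
  by congr bsupp; apply/funext => x /=; rewrite mulrC.
pose dot x := 'D_(1, 0) (ramp a s v) x * (phi x).1 + 'D_(0, 1) (ramp a s v) x * (phi x).2.
have dotE : dot = divergence (smul (ramp a s v) phi) \- (fun x => ramp a s v x * divergence phi x).
  by apply/funext => x /=; rewrite (divergence_smul x tphi ce) addrC addKr.
have sdot : bsupp dot by rewrite dotE; exact: bsuppB.
have -> : Iw (fun x => \1_A x * ramp a s v x) (divergence phi) =
    Iw \1_A (divergence (smul (ramp a s v) phi)) - Iw \1_A dot.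
  rewrite -IwB// /Iw; apply: eq_Rintegral => x _ /=.
  by rewrite dotE /= subKr mulrA.
apply: lerD.
  by apply: (per_bound (M := P)) => //; exact: varle_sub vA.
have sg := bsupp_gradsum cv v0.
have mL : bset L by exact: bset_slab.
have sgL : bsupp (fun x => 4 * a * (\1_L x * gradsum v x)).
  apply: bsuppZ; have : bsupp (gradsum v \* \1_L).
    apply: bsuppM => //; first exact: bfun_indic.
    by exists 1 => x; rewrite indicE; case: (_ \in _); rewrite ?normr0 ?normr1.
  by congr bsupp; apply/funext => x /=; rewrite mulrC.
have -> : 4 * a * Iw \1_(A `&` L) (gradsum v) = Iw \1_A (fun x => 4 * a * (\1_L x * gradsum v x)).
  rewrite -IwZ//; last by apply: lint_indic; exact: bsetI.
  by rewrite /Iw; apply: eq_Rintegral => x _; rewrite indicI /=; ring.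
rewrite -mulN1r -IwZ//; apply: Iw_le => //.
- exact: bsuppZ.
move=> x; rewrite mulN1r; apply: (le_trans (ler_norm _)); rewrite normrN.
have [sv|nsv] := pselect (s < v x).
  by apply: (le_trans (dot_grad_le _ _ tphi)); exact: gradsum_ramp.
have -> : dot x = 0.
  have -> : dot x = 'D_(1, 0) (ramp a s v) x * (phi x).1 + 'D_(0, 1) (ramp a s v) x * (phi x).2 by [].
  have -> : phi x = 0.
    apply/eqP/negPn/negP => px; apply: nsv; case: tphi => _ [_ cs] _.
    by apply: cs; exact: subset_closure.
  by rewrite (mulr0 ('D_(1, 0) (ramp a s v) x)) (mulr0 ('D_(0, 1) (ramp a s v) x)) addr0.
by rewrite normr0 !mulr_ge0 ?indic_nonneg ?gradsum_ge0// ltW.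
Qed.

(** The interval ]0, 1[ has length 1, so a nonnegative function cannot exceed its integral by [e] on
    all of it. *)
Lemma ex_small_level (g : R -> \bar R) (M e : R) :
  measurable_fun setT (g : measurableTypeR R -> \bar R) -> (forall t, 0 <= g t)%E ->
  (\int[lebesgue_measure]_t g t <= M%:E)%E -> 0 < e ->
  exists2 t : R, 0 < t < 1 & (g t <= (M + e)%:E)%E.
Proof.
move=> mg g0 ig e0; apply: contrapT => nex.
have gt t : 0 < t < 1 -> ((M + e)%:E <= g t)%E.
  by move=> t01; rewrite leNgt; apply/negP => gt; apply: nex; exists t => //; exact: ltW.
have E (c : R) : (\int[lebesgue_measure]_(t in `]0%R, 1%R[) (cst c%:E t) = c%:E)%E.
  rewrite integral_cst; last exact: measurable_itv.
  transitivity (c%:E * lebesgue_measure `]0%R, 1%R[%classic)%E; first by [].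
  by rewrite lebesgue_measure_itv/= lte_fin ltr01 oppr0 adde0 mule1.
have : (\int[lebesgue_measure]_(t in `]0%R, 1%R[) (cst (M + e)%:E t) <= M%:E)%E.
  apply: le_trans ig.
  apply: (@le_trans _ _ (\int[lebesgue_measure]_(t in `]0%R, 1%R[) g t)%E).
    have [h|h] := leP 0 (M + e).
      apply: ge0_le_integral.
      - exact: measurable_itv.
      - by move=> t _; rewrite lee_fin.
      - exact: measurable_cst.
      - exact: measurable_funTS.
      - by move=> t /=; rewrite in_itv/= => /gt.
    rewrite E; apply: (@le_trans _ _ 0%E); last by apply: integral_ge0 => t _.
    by rewrite lee_fin ltW.
  apply: ge0_subset_integral.
  - exact: measurable_itv.
  - exact: measurableT.
  - exact: mg.
  - by move=> t _.
  - by [].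
rewrite E lee_fin; lra.
Qed.

(** Coarea for [\1_A * ramp] in {v > s} provides a level set that is a competitor for [A], namely
    [A] without a closed set [G], of perimeter at most 4 times the variation given by
    [varle_ramp]. *)
Lemma per_layer (K : R) A B (P a s : R) v : 0 <= K -> bset A -> varle \1_A setT P ->
  qm K A B -> c1 v -> compactly_contained [set x | v x != 0] B -> 0 <= s -> 0 < a ->
  per A [set x | s < v x] <= K * (4 * (per A (slab v s (s + a^-1)) +
    4 * a * Iw \1_(A `&` slab v s (s + a^-1)) (gradsum v))).
Proof.
move=> K0 mA vA qA cv vB s0 a0; set L := slab v s (s + a^-1).
have [n vn] := compactly_contained_ball vB.
have v0 x : ~ ball 0 n%:R x -> v x = 0.
  by move=> nx; apply/eqP/negPn/negP => vx; apply: nx; exact: vn.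
have cc := c1_continuous cv.
pose w x := \1_A x * ramp a s v x.
pose U := [set x | s < v x].
have oU : open U by exact: open_superlevel.
have UV x : U x -> v x != 0 by move=> /(le_lt_trans s0); rewrite lt0r => /andP[].
have cU : compactly_contained U B.
  exact: (compactly_contained_sub UV (@subset_refl _ B) vB).
have lw : lint w.
  apply: (@lint_bounded _ _ 1).
    by apply: bfunM; [exact: bfun_indic|apply: bfun_continuous; apply: c1_continuous; exact: c1_ramp].
  move=> x; have /andP[r0 r1] := ramp01 a s v x.
  by rewrite /w indicE; case: (_ \in _); rewrite ?mul1r ?mul0r ?normr0// ger0_norm.
have vw : varle w U (per A L + 4 * a * Iw \1_(A `&` L) (gradsum v)).
  by apply: (varle_ramp (P := P)) => //; exists n%:R.
set V := per A L + _ in vw *.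
have [g [mg g0 ig gP]] := coarea lw oU vw.
apply/ler_addgt0Pr => e e0.
have e1 : 0 < e / (K + 1) by rewrite divr_gt0// ltr_wpDl.
have [t /andP[t0 t1] gt] := ex_small_level mg g0 ig e1.
(* As 0 < t < 1, the level set {\1_A ramp > t} is exactly [A] without [G], and [G] stays inside {v >
   s}, where [step] is positive. *)
pose G := [set x | 1 - t <= step (2 * a * (v x - s))].
have cG : closed G.
  by apply: (@closed_superlevel (step \o (fun x => 2 * a * (v x - s)))); apply: c1_continuous; apply: c1_step; exact: ramp_arg.
have GU : G `<=` U.
  move=> x Gx; rewrite /U /= ltNge; apply/negP => vs.
  move: Gx; rewrite /G /= step_le0; first by lra.
  by rewrite mulr_ge0_le0 ?subr_le0// mulr_ge0// ltW.
have cGU : compactly_contained G U.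
  apply: (compactly_contained_closed (@subset_refl _ G) cG GU (r := n%:R)).
  by move=> x /GU/UV; exact: vn.
have lE : level w t = A `\` G.
  apply/seteqP; split=> x; rewrite /level /w /=.
    have [Ax|nAx] := pselect (A x); last by rewrite (indic0 nAx) mul0r; lra.
    by rewrite (indic1 Ax) mul1r /ramp => h; split => //; rewrite /G /=; move: h; lra.
  move=> [Ax nG]; rewrite (indic1 Ax) mul1r /ramp ltrBrDl addrC -ltrBrDl ltNge.
  exact/negP.
have vG : varle \1_(A `\` G) U (4 * V + e / (K + 1)).
  move=> phi tphi; rewrite -lee_fin -lE; exact: le_trans (gP t phi tphi) gt.
have := per_le (qA U G _ oU cU cG cGU vG); move/le_trans; apply.
rewrite mulrDr lerD2l mulrCA ler_piMr//; first exact: ltW.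
by rewrite ler_pdivrMr ?mul1r ?lerDl// ltr_wpDl.
Qed.

(* Averaging [per_layer] over the J layers of height 1 / J and letting J tend
   to infinity removes the contribution of the perimeter of A in the layers. *)
Lemma varle_gt1 (K : R) A B (P : R) v : 0 <= K -> bset A -> varle \1_A setT P ->
  qm K A B -> c1 v -> compactly_contained [set x | v x != 0] B ->
  varle \1_A [set x | 1 < v x] (16 * K * Iw \1_A (gradsum v)).
Proof.
move=> K0 mA vA qA cv vB.
have cc := c1_continuous cv; have lA := lint_indic mA.
have [n vn] := compactly_contained_ball vB.
have v0 x : ~ ball 0 n%:R x -> v x = 0.
  by move=> nx; apply/eqP/negPn/negP => vx; apply: nx; exact: vn.
have sg := bsupp_gradsum cv v0.
set I := Iw \1_A (gradsum v).
have P0 : 0 <= P := varle_ge0 vA.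
have vS U : varle \1_A U P by apply: varle_sub vA.
suff : per A [set x | 1 < v x] <= 16 * K * I.
  by move=> h; apply: (varle_le h); exact: per_bound (vS _).
apply/ler_addgt0Pr => e e0.
(* With J layers the perimeters of [A] in the layers sum to at most P, so their average contributes
   4 K P / J; J is chosen to make this at most [e]. *)
have e1 : 0 < e / (4 * K * P + 1) by rewrite divr_gt0// ltr_wpDl// !mulr_ge0.
have [m me] := ex_natSinv_lt e1.
set J := m.+1 in me; have J0 : 0 < (J%:R : R) by [].
pose L j := slab v (j%:R / J%:R) (j%:R / J%:R + J%:R^-1).
(* [W j] is disjoint from the layer [L j], and both lie in [W j.+1]: this is what the two inductions
   below use to add perimeters and integrals layer by layer. *)
pose W j := [set x | v x < j%:R / J%:R].
have jS j : j.+1%:R / J%:R = j%:R / J%:R + J%:R^-1 :> R.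
  by rewrite -natr1 mulrDl mul1r.
have oW j : bset (W j) by apply: bset_open; exact: open_sublevel.
have mL j : bset (L j) by exact: bset_slab.
have WL j : W j `&` L j = set0.
  by apply/seteqP; split=> // x [/= h /andP[h1 _]]; move: (lt_trans h h1); rewrite ltxx.
have WLS j : W j `|` L j `<=` W j.+1.
  move=> x [/= h|/andP[_ h]]; rewrite /W /= jS//.
  by apply: lt_trans h _; rewrite ltrDl invr_gt0.
have sumper k : \sum_(j < k) per A (L j) <= per A (W k).
  elim: k => [|k ih]; first by rewrite big_ord0; exact: per_ge0 (vS _).
  rewrite big_ord_recr /=; apply: le_trans (per_sub (WLS k) (vS _)).
  by apply: le_trans (perD mA (WL k) (vS _)); exact: lerD.
have sumI k : \sum_(j < k) Iw \1_(A `&` L j) (gradsum v) <= Iw \1_(A `&` W k) (gradsum v).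
  have II C : bset C -> Iw \1_(A `&` C) (gradsum v) = Iw \1_A (fun x => \1_C x * gradsum v x).
    by move=> mC; rewrite /Iw; apply: eq_Rintegral => x _; rewrite indicI /=; ring.
  have sC C : bset C -> bsupp (fun x => \1_C x * gradsum v x).
    move=> mC; have : bsupp (gradsum v \* \1_C).
      apply: bsuppM => //; first exact: bfun_indic.
      by exists 1 => x; rewrite indicE; case: (_ \in _); rewrite ?normr0 ?normr1.
    by congr bsupp; apply/funext => x /=; rewrite mulrC.
  elim: k => [|k ih].
    by rewrite big_ord0; apply: Iw_ge0 => x; [exact: indic_nonneg|exact: gradsum_ge0].
  rewrite big_ord_recr /=; apply: le_trans (lerD ih (lexx _)) _.
  rewrite !II// -IwD//; [|exact: sC..]; apply: Iw_le => //.
  - by apply: bsuppD; exact: sC.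
  - exact: sC.
  move=> x /=; rewrite -mulrDl; apply: ler_wpM2r; first exact: gradsum_ge0.
  have [Wx|nWx] := pselect (W k x).
    rewrite (indic1 Wx) indic0 ?addr0; last by move=> Lx; have : (W k `&` L k) x by []; rewrite WL.
    by rewrite indic1//; apply: WLS; left.
  rewrite (indic0 nWx) add0r; have [Lx|nLx] := pselect (L k x).
    by rewrite (indic1 Lx) indic1//; apply: WLS; right.
  by rewrite (indic0 nLx) indic_nonneg.
(* The slope is J, the inverse of the height of a layer. The gradient terms carry the factor 4 J,
   and averaging over J layers leaves 4 * 4 K = 16 K times the whole integral. *)
have key (j : nat) : (j < J)%N ->
    per A [set x | 1 < v x] <= K * (4 * (per A (L j) + 4 * J%:R * Iw \1_(A `&` L j) (gradsum v))).
  move=> jJ; apply: le_trans (per_layer K0 mA vA qA cv vB (s := j%:R / J%:R) _ J0).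
    apply: per_sub (vS _) => x /=; apply: le_lt_trans.
    by rewrite ler_pdivrMr// mul1r ler_nat ltnW.
  by rewrite divr_ge0.
have : \sum_(j < J) per A [set x | 1 < v x] <=
    \sum_(j < J) K * (4 * (per A (L j) + 4 * J%:R * Iw \1_(A `&` L j) (gradsum v))).
  by apply: ler_sum => j _; exact: key.
rewrite sumr_const card_ord -[leLHS]mulr_natl -mulr_sumr -mulr_sumr big_split /= -mulr_sumr.
have h1 := le_trans (sumper J) (per_le (vS _)).
have h2 : \sum_(j < J) Iw \1_(A `&` L j) (gradsum v) <= I.
  apply: le_trans (sumI J) _.
  have mAW : bset (A `&` W J) by exact: bsetI.
  rewrite -lee_fin /I -!Iw_lint//; last exact: lint_indic.
  apply: le_integral => //.
  - by apply: lint_integrable => //; exact: lint_indic.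
  - exact: lint_integrable.
  - move=> x _; rewrite lee_fin; apply: ler_wpM2r; first exact: gradsum_ge0.
    by rewrite indicI /= ler_piMr// ?indic_nonneg// indicE lern1 leq_b1.
set S1 := \sum_(j < J) _ in h1 *; set S2 := \sum_(j < J) _ in h2 *.
set p := per A _ => H.
have H2 : J%:R * p <= J%:R * (16 * K * I) + 4 * K * P.
  apply: (le_trans H).
  have h3 : K * (4 * S1) <= 4 * K * P by rewrite mulrCA mulrA; apply: ler_wpM2l; rewrite ?mulr_ge0.
  have h4 : K * (4 * (4 * J%:R * S2)) <= J%:R * (16 * K * I).
    have -> : K * (4 * (4 * J%:R * S2)) = (16 * K * J%:R) * S2 by ring.
    have -> : J%:R * (16 * K * I) = (16 * K * J%:R) * I by ring.
    by apply: ler_wpM2l; rewrite ?mulr_ge0.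
  by rewrite 2!mulrDr addrC lerD.
have H3 : 4 * K * P <= J%:R * e.
  have : J%:R^-1 * (4 * K * P + 1) < e by rewrite -ltr_pdivlMr// ltr_wpDl// !mulr_ge0.
  rewrite ltr_pdivrMl// => h; apply: le_trans (ltW h); by rewrite lerDl.
by rewrite -(ler_pM2l J0) mulrDr (le_trans H2)// lerD2l.
Qed.

End layer.

(** * Caccioppoli inequality and density *)

Section density.
Context {R : realType}.
Implicit Types (x y z : plane R) (A B O U V L : set (plane R)) (f g u w eta v : plane R -> R).

Lemma Iw_indic_bound A V f (c : R) : bset A -> bset V -> bsupp f -> 0 <= c ->
  (forall x, `|f x| <= c * \1_V x) -> ((Iw \1_A f)%:E <= c%:E * mu (A `&` V))%E.
Proof.
move=> mA mV sf c0 fc; have mAV : bset (A `&` V) by exact: bsetI.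
rewrite -(Iw_lint (lint_indic mA) sf).
apply: (@le_trans _ _ (\int[mu]_x (c%:E * (\1_(A `&` V) x)%:E))%E).
  apply: (@le_trans _ _ (\int[mu]_x `|\1_A x * f x|%:E)%E).
    apply: le_trans (lee_abs _) _; apply: le_trans (le_abse_integral _ _ _) _ => //.
    by apply: (@mEFin _ (fun x => \1_A x * f x)); apply: bfunM; [exact: bfun_indic|exact: sf.1].
  apply: ge0_le_integral.
  - exact: measurableT.
  - by move=> x _; rewrite lee_fin.
  - by apply: (@mEFin _ (fun x => `|\1_A x * f x|)); apply: bfun_norm; apply: bfunM; [exact: bfun_indic|exact: sf.1].
  - by apply: (@mEFin _ (fun x => c * \1_(A `&` V) x)); apply: bfunM; [exact: bfun_cst|exact: bfun_indic].
  - move=> x _; rewrite -EFinM lee_fin normrM indicI /= mulrCA ger0_norm ?indic_nonneg//.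
    by apply: ler_wpM2l; [exact: indic_nonneg|exact: fc].
rewrite ge0_integralZl//; last by apply/measurable_EFinP; exact: bfun_indic.
apply: lee_pmul => //; first by apply: integral_ge0 => x _; rewrite lee_fin indic_nonneg.
by rewrite (integral_indic _ measurableT mAV) setIT.
Qed.

(** The constant is 2 directions times 16 nodes within 2h times the Lipschitz constant 8 / h. The
    grid must be large enough to contain [V] with a margin, so that the hats sum to 1 there. *)
Lemma gradsum_cutoff N (h r : R) V x : 0 < h -> V `<=` ball 0 r -> r + 1 < N%:R * h ->
  gradsum (cutoff N h V) x <= 16 * 16 / h * \1_V x.
Proof.
move=> h0 Vr rN.
have e (d : plane R) : `|d| = 1 -> `|'D_d (cutoff N h V) x| <= 8 * 16 / h * \1_V x.
  move=> d1; have [xN|xN] := ltP `|x| (N%:R * h); last first.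
    rewrite (derive_supp (r := r) d (c1_cutoff N h V)).
    - by rewrite normr0 mulr_ge0 ?indic_nonneg // divr_ge0 ?mulr_ge0// ltW.
    - move=> y yr; apply/eqP/negPn/negP => cy; apply: yr; apply: Vr.
      by have [_ cs] := cutoff_cc N V h0; apply: cs; exact: subset_closure.
    - by rewrite plane_norm_lt => xr; move: rN xN xr; lra.
  apply: (le_trans (grid_derive _ 0 _ h0 xN)); rewrite d1 mulr1.
  have [Vx|nVx] := pselect (V x); last first.
    rewrite (indic0 nVx) mulr0 big1 ?mulr0// => i _; rewrite big1// => j _.
    have [s|s] := pselect (ball (node N h i j) (2 * h) `<=` V).
      by rewrite indic0 ?mul0r// => /s.
    by rewrite asboolF// subr0 normr0 mulr0.
  rewrite (indic1 Vx) mulr1 (_ : 8 * 16 / h = 8 / h * 16); last by field; rewrite gt_eqF.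
  apply: ler_wpM2l; first by rewrite divr_ge0// ltW.
  apply: (le_trans _ (count_nodes N x 2 h0)); apply: ler_sum => i _; apply: ler_sum => j _.
  rewrite ler_piMr ?indic_nonneg// subr0.
  by case: (`[< _ >]); rewrite ?normr1 ?normr0.
have n1 : `|((1, 0) : plane R)| = 1 by rewrite plane_normE /= normr0 normr1; apply/max_idPl.
have n2 : `|((0, 1) : plane R)| = 1 by rewrite plane_normE /= normr0 normr1; apply/max_idPr.
rewrite (_ : 16 * 16 / h * _ = 8 * 16 / h * \1_V x + 8 * 16 / h * \1_V x).
  by apply: lerD; exact: e.
by rewrite -mulrDl -mulrDl; congr (_ / _ * _); rewrite -mulrDl; congr (_ * _); ring.
Qed.

Lemma ball_fin A z (r : R) : bset A -> mu (A `&` ball z r) \is a fin_num.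
Proof.
move=> mA; rewrite ge0_fin_numE ?measure_ge0//.
have mb : bset (ball z r) by exact: bset_ball.
have mbr : bset (ball z `|r|) by exact: bset_ball.
apply: (@le_lt_trans _ _ (mu (ball z `|r|))).
  apply: le_measure; rewrite ?inE //; first exact: bsetI.
  by move=> x [_]; apply: le_ball; exact: ler_norm.
suff -> : mu (ball z `|r|) = ((2 * `|r|) ^+ 2)%:E by exact: ltry.
exact: mu_ball.
Qed.

(** [varle_gt1] for twice a cutoff of mesh [d / 3]: the cutoff is 1 at points whose ball of three
    mesh widths lies in the larger ball, so {v > 1} contains [ball z rho]. *)
Lemma caccioppoli (K : R) A B (P rho d : R) z : 0 <= K -> bset A -> varle \1_A setT P ->
  qm K A B -> 0 < rho -> 0 < d -> ball z (rho + d) `<=` B ->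
  varle \1_A (ball z rho) (16 * K * (2 * (16 * 16 / (d / 3))) * fine (mu (A `&` ball z (rho + d)))).
Proof.
move=> K0 mA vA qA r0 d0 zB.
pose V := ball z (rho + d); pose h := d / 3.
have h0 : 0 < h by rewrite divr_gt0.
pose r := `|z| + rho + d.
have Vr : V `<=` ball 0 r.
  move=> x; rewrite plane_norm_lt /V -ball_normE /= => xz.
  have -> : x = z - (z - x) by rewrite subKr.
  by rewrite (le_lt_trans (ler_normB _ _))// /r -addrA ltrD2l.
pose N := (Num.truncn ((r + 1) / h)).+1.
have rN : r + 1 < N%:R * h by rewrite -ltr_pdivrMr// truncnS_gt.
have cc := c1_cutoff N h V.
have cV := cutoff_cc N V h0.
have c0 x : ~ ball 0 r x -> cutoff N h V x = 0.
  move=> xr; apply/eqP/negPn/negP => cx; apply: xr; apply: Vr.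
  by case: cV => _; apply; exact: subset_closure.
pose v x := 2 * cutoff N h V x.
have cv : c1 v by exact: (c1M (c1_cst 2) cc).
have v0 x : ~ ball 0 r x -> v x = 0 by move=> /c0; rewrite /v => ->; rewrite mulr0.
have vB : compactly_contained [set x | v x != 0] B.
  apply: (compactly_contained_sub _ zB cV) => x /=.
  by apply: contra_neq; rewrite /v => ->; rewrite mulr0.
have mV : bset V by exact: bset_ball.
have gv x : `|gradsum v x| <= 2 * (16 * 16 / h) * \1_V x.
  rewrite ger0_norm ?gradsum_ge0//.
  have -> : gradsum v x = 2 * gradsum (cutoff N h V) x.
    have D e : 'D_e v x = 2 * 'D_e (cutoff N h V) x.
      by rewrite (c1_deriveM e x (c1_cst 2) cc) derive_cst mulr0 addr0.
    have E (a : R) : `|2 * a| = 2 * `|a| by rewrite normrM normr_nat.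
    by rewrite /gradsum mulrDr; congr (_ + _); rewrite -E; congr (`|_|); exact: D.
  have := gradsum_cutoff x h0 Vr rN; set i := \1_V x => H.
  by rewrite -mulrA; exact: ler_wpM2l.
have sg := bsupp_gradsum cv v0.
have c512 : 0 <= 2 * (16 * 16 / h) by rewrite mulr_ge0// divr_ge0 ?mulr_ge0// ltW.
have Ib := Iw_indic_bound mA mV sg c512 gv.
have fm := ball_fin z (rho + d) mA.
rewrite -(fineK fm) -EFinM lee_fin in Ib.
have vg := varle_gt1 K0 mA vA qA cv vB.
apply: (@varle_sub _ _ _ [set x | 1 < v x]).
  move=> x zx; rewrite /v /= cutoff1//; first by rewrite mulr1 ltr1n.
    have /Vr : V x by apply: le_ball zx; rewrite lerDl ltW.
    by rewrite plane_norm_lt => /ltW/le_trans; apply; move: rN; lra.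
  rewrite /h mulrCA mulfV ?mulr1//.
  by move=> y; exact: ball_triangle.
apply: (varle_le _ vg).
set m := fine _ in Ib *.
by rewrite -[leRHS]mulrA; apply: ler_wpM2l => //; rewrite mulr_ge0.
Qed.

Lemma measurable_ball_mass A (r : R) : bset A ->
  measurable_fun setT ((fun x => mu (A `&` ball x r)) : mplane R -> \bar R).
Proof.
move=> mA.
pose Z : set (plane R * plane R) := [set p | A p.2 /\ ball (0 : plane R) r (p.2 - p.1)].
have mZ : measurable (Z : set (mplane R * mplane R)).
  have -> : Z = (snd @^-1` A) `&` ((fun p => p.2 - p.1) @^-1` (ball (0 : plane R) r)) by [].
  apply: measurableI.
    by rewrite -[X in measurable X]setTI; exact: (@measurable_snd _ _ (mplane R) (mplane R)).
  have ma : measurable_fun setT ((fun p => p.2 - p.1) : mplane R * mplane R -> mplane R).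
    apply: (@measurable_fun_pair _ _ _ (mplane R * mplane R)%type (measurableTypeR R)
      (measurableTypeR R) (fun p => p.2.1 - p.1.1) (fun p => p.2.2 - p.1.2)).
      apply: (@measurable_funB _ (mplane R * mplane R)%type R setT (fst \o snd) (fst \o fst)).
        by apply: measurableT_comp; [exact: measurable_fst|exact: measurable_snd].
      by apply: measurableT_comp; exact: measurable_fst.
    apply: (@measurable_funB _ (mplane R * mplane R)%type R setT (snd \o snd) (snd \o fst)).
      by apply: measurableT_comp; exact: measurable_snd.
    by apply: measurableT_comp; [exact: measurable_snd|exact: measurable_fst].
  by rewrite -[X in measurable X]setTI; apply: ma => //; exact: bset_ball.
have -> : (fun x => mu (A `&` ball x r)) = mu \o xsection Z.
  apply/funext => x /=; congr (mu _); apply/seteqP; split=> y.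
    move=> [Ay xy]; apply/mem_set; split => //=.
    by rewrite -(ball_addr x) subrK.
  by move=> /set_mem[Ay /= xy]; split => //; rewrite -[y](subrK x) ball_addr.
exact: (@measurable_fun_xsection _ _ (mplane R) (mplane R) R mu Z mZ).
Qed.

Lemma half_square (a b s : R) : a + b = (2 * s) ^+ 2 -> a <= 2 * s ^+ 2 -> 2 * s ^+ 2 <= b.
Proof. by rewrite (_ : (2 * s) ^+ 2 = 2 * s ^+ 2 + 2 * s ^+ 2); [lra|ring]. Qed.

(** A substitute for the relative isoperimetric inequality. The ball of radius s is a square of area
    4 s^2, at most half filled by [A], so each point of [A] sees 2 s^2 of the complement; averaging
    the translation estimate over |y| < s gives 2 s^2 times the mass <= 2 s p (2 s)^2. *)
Lemma mass_perimeter A (p rho s : R) z : bset A -> 0 < rho -> 0 < s ->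
  varle \1_A (ball z (rho + s)) p ->
  fine (mu (A `&` ball z (rho + s))) <= 2 * s ^+ 2 ->
  fine (mu (A `&` ball z rho)) <= 4 * s * p.
Proof.
move=> mA r0 s0 vA ms.
have fm t := ball_fin z t mA.
set X := A `&` ball z rho.
have mX : bset X by apply: bsetI => //; exact: bset_ball.
have p0 := varle_ge0 vA.
have M0 : (0 <= (2 * s * p)%:E)%E by rewrite lee_fin !mulr_ge0// ltW.
have XYM y : ball 0 s y -> (mu (X `&` [set x | (~` A) (x + y)%R]) <= (2 * s * p)%:E)%E.
  rewrite plane_norm_lt => ys.
  have oz : open (ball z rho) by exact: ball_open.
  have tr := @translation_set _ A (ball z rho) _ p y mA vA oz.
  apply: (@le_trans _ _ (mu (ball z rho `&` sdiff A y))).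
    apply: le_measure; rewrite ?inE.
    - by apply: bsetI => //; apply: bset_shift; exact: bsetC.
    - by apply: bsetI; [exact: bset_ball|exact: bset_sdiff].
    - by move=> x [[Ax zx] /= nA]; split => // E; apply: nA; rewrite -E.
  apply: le_trans (tr _) _.
    move=> x t zx /andP[t0 t1]; apply: ball_triangle zx _.
    rewrite -ball_normE /= opprD addNKr normrN normrZ (ger0_norm t0).
    by apply: le_lt_trans ys; rewrite ler_piMl.
  by rewrite lee_fin; apply: ler_wpM2r => //; apply: ler_wpM2l => //; exact: ltW.
have T := tonelli_ball mX (bsetC mA) (ltW s0) M0 XYM.
have low x : X x -> ((2 * s ^+ 2)%:E <= mu (~` A `&` ball x s))%E.
  move=> [_ zx].
  have mb : bset (ball x s) by exact: bset_ball.
  have mAb : bset (A `&` ball x s) by exact: bsetI.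
  have mCb : bset (~` A `&` ball x s) by apply: bsetI => //; exact: bsetC.
  have E : (mu (A `&` ball x s) + mu (~` A `&` ball x s) = ((2 * s) ^+ 2)%:E)%E.
    transitivity (mu (ball x s)); last by apply: mu_ball; exact: ltW.
    transitivity (mu ((A `&` ball x s) `|` (~` A `&` ball x s))).
      apply/esym/measureU => //; apply/seteqP; split=> // y [[Ay _] [nAy _]]; exact: nAy.
    congr (mu _); rewrite -setIUl setUv; exact: setTI.
  have f1 := ball_fin x s mA; have f2 := ball_fin x s (bsetC mA).
  have le1 : fine (mu (A `&` ball x s)) <= 2 * s ^+ 2.
    have mbb : bset (A `&` ball z (rho + s)) by apply: bsetI => //; exact: bset_ball.
    have le0 : (mu (A `&` ball x s) <= mu (A `&` ball z (rho + s)))%E.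
      apply: le_measure; [by rewrite inE|by rewrite inE|].
      by move=> y [Ay xy]; split => //; exact: ball_triangle zx xy.
    exact: (le_trans (fine_le f1 (fm (rho + s)) le0) ms).
  move: E; rewrite -(fineK f1) -(fineK f2) -EFinD => -[E].
  rewrite lee_fin; exact: half_square E le1.
have : ((2 * s ^+ 2)%:E * mu X <= (2 * s * p)%:E * ((2 * s) ^+ 2)%:E)%E.
  apply: le_trans T.
  have -> : ((2 * s ^+ 2)%:E * mu X = \int[mu]_(x in X) cst (2 * s ^+ 2)%:E x)%E.
    by rewrite integral_cst.
  apply: ge0_le_integral.
  - exact: mX.
  - by move=> x _; rewrite lee_fin mulr_ge0// sqr_ge0.
  - exact: measurable_cst.
  - by apply: measurable_funTS; apply: measurable_ball_mass; exact: bsetC.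
  - exact: low.
rewrite -(fineK (fm rho)) -!EFinM lee_fin.
set m := fine _ => h.
have s2 : 0 < 2 * s ^+ 2 by rewrite mulr_gt0// exprn_gt0.
by rewrite -(ler_pM2l s2) (le_trans h)// le_eqVlt; apply/orP; left; apply/eqP; ring.
Qed.

(** The choice of lengths in one iteration step: [s + d = r tau / 4] is the shrinkage of the radius,
    shared between [mass_perimeter] (s) and [caccioppoli] (d), and [s] is so small that the mass
    loses a factor 16. *)
Lemma decay_step (k1 tau r m m' s d : R) :
  0 <= k1 -> 0 < tau <= 1 -> 0 < r ->
  s = (16 * 32 * (k1 + 1))^-1 * (r * tau) -> d = r * tau / 4 - s ->
  [/\ 0 < s, 0 < d & 4 * s * (k1 / d) <= 1 / 16].
Proof.
move=> k10 /andP[t0 t1] r0 sE dE.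
have rt : 0 < r * tau by rewrite mulr_gt0.
set sig := (_)^-1 in sE.
have K1 : 0 < 16 * 32 * (k1 + 1) by rewrite !mulr_gt0// ltr_wpDl.
have sig0 : 0 < sig by rewrite invr_gt0.
have sigE : sig * (16 * 32 * (k1 + 1)) = 1 by rewrite mulVf// gt_eqF.
have sig8 : sig <= 1 / 8.
  have h : 0 <= sig * k1 by exact: (mulr_ge0 (ltW sig0) k10).
  move: sigE h; lra.
have s0 : 0 < s by rewrite sE mulr_gt0.
have d8 : r * tau / 8 <= d.
  have : s <= 1 / 8 * (r * tau) by rewrite sE ler_pM2r.
  by rewrite dE; lra.
have d0 : 0 < d by apply: lt_le_trans d8; rewrite divr_gt0.
split => //; rewrite mulrA ler_pdivrMr//.
apply: (@le_trans _ _ (1 / 16 * (r * tau / 8))); last by rewrite ler_pM2l ?divr_gt0.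
have -> : 4 * s * k1 = 4 * (sig * k1) * (r * tau) by rewrite sE; ring.
have : 4 * (sig * k1) <= 1 / 16 * (1 / 8) by move: sigE; lra.
by move=> h; rewrite (_ : 1 / 16 * (r * tau / 8) = 1 / 16 * (1 / 8) * (r * tau)); [rewrite ler_pM2r|ring].
Qed.

(* De Giorgi iteration: [mass_perimeter] and [caccioppoli] on shrinking squares. *)
Lemma density (K : R) : 0 <= K -> exists2 eps : R, 0 < eps &
  forall A B P z (r : R), bset A -> varle \1_A setT P -> qm K A B -> 0 < r ->
    ball z r `<=` B -> (mu (A `&` ball z r) <= (eps * r ^+ 2)%:E)%E ->
    mu (A `&` ball z (r / 2)) = 0%E.
Proof.
move=> K0; pose k1 := 16 * K * (2 * (16 * 16)) * 3.
have k10 : 0 <= k1 by rewrite !mulr_ge0.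
pose sig := (16 * 32 * (k1 + 1))^-1.
have sig0 : 0 < sig by rewrite invr_gt0 !mulr_gt0// ltr_wpDl.
exists (2 * sig ^+ 2); first by rewrite mulr_gt0// exprn_gt0.
move=> A B P z r mA vA qA r0 zB small.
have fm t := ball_fin z t mA.
pose m t := fine (mu (A `&` ball z t)).
have mmono s t : s <= t -> m s <= m t.
  move=> st; apply: (fine_le (fm s) (fm t)).
  have mb q : bset (A `&` ball z q) by apply: bsetI => //; exact: bset_ball.
  apply: le_measure; [by rewrite inE; exact: mb|by rewrite inE; exact: mb|].
  by move=> x [Ax xs]; split => //; apply: le_ball xs.
have c0 : 0 < 2 * sig ^+ 2 * r ^+ 2 by rewrite pmulr_lgt0 ?exprn_gt0// mulr_gt0// exprn_gt0.
pose tau k : R := 2^-1 ^+ k.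
have tau01 k : 0 < tau k <= 1.
  by rewrite exprn_gt0 ?invr_gt0// exprn_ile1// ?invr_ge0// invf_le1// ler1n.
have tauS k : tau k.+1 = tau k / 2 by rewrite /tau exprSr.
pose rho k := r / 2 + r * tau k / 2.
(* The power 4 matches a gain of 1 / 16 per halving of [tau]. Any power of at least 2 keeps the
   half-filling condition [m <= 2 s ^+ 2], where [s = sig r tau]; at k = 0 the bound is the
   smallness hypothesis, which fixes [eps = 2 sig ^+ 2]. *)
have it k : m (rho k) <= tau k ^+ 4 * (2 * sig ^+ 2 * r ^+ 2).
  elim: k => [|k ih].
    rewrite /rho /tau expr0 mulr1 -splitr expr1n mul1r.
    by rewrite -lee_fin /m fineK.
  pose s := sig * (r * tau k); pose d := r * tau k / 4 - s.
  have [s0 d0 sd] := decay_step 0 0 k10 (tau01 k) r0 (erefl s) (erefl d).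
  have /andP[t0 t1] := tau01 k.
  have rt : 0 < r * tau k by rewrite mulr_gt0.
  have rho0 : 0 < rho k.+1 by rewrite /rho tauS; move: rt; lra.
  have rsd : rho k.+1 + s + d = rho k by rewrite /rho /d tauS; field.
  have rr : rho k <= r.
    have h : r * tau k <= r by apply: ler_piMr => //; exact: ltW.
    by rewrite /rho; lra.
  have ca : varle \1_A (ball z (rho k.+1 + s)) (k1 / d * m (rho k)).
    rewrite -rsd (_ : k1 / d = 16 * K * (2 * (16 * 16 / (d / 3)))).
      apply: caccioppoli K0 mA vA qA _ d0 _; first exact: addr_gt0.
      by rewrite rsd; apply: subset_trans zB; exact: le_ball.
    by rewrite /k1; field; rewrite gt_eqF.
  have mp := mass_perimeter mA rho0 s0 ca.
  have m0 : 0 <= m (rho k) by apply: fine_ge0; exact: measure_ge0.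
  have {}mp : m (rho k.+1) <= 4 * s * (k1 / d * m (rho k)).
    apply: mp; apply: (le_trans (mmono _ (rho k) _)); first by rewrite -rsd lerDl ltW.
    apply: (le_trans ih); rewrite /s !exprMn.
    have -> : 2 * (sig ^+ 2 * (r ^+ 2 * tau k ^+ 2)) = tau k ^+ 2 * (2 * sig ^+ 2 * r ^+ 2) by ring.
    apply: ler_wpM2r; first exact: ltW.
    by apply: ler_wiXn2l => //; exact: ltW.
  apply: (le_trans mp); rewrite tauS.
  apply: (@le_trans _ _ (1 / 16 * m (rho k))).
    by rewrite (mulrA (4 * s)); exact: ler_wpM2r.
  apply: (@le_trans _ _ (1 / 16 * (tau k ^+ 4 * (2 * sig ^+ 2 * r ^+ 2)))).
    by apply: ler_wpM2l => //; rewrite divr_ge0.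
  rewrite le_eqVlt; apply/orP; left; apply/eqP; by field.
have {}it k : m (r / 2) <= tau k * (2 * sig ^+ 2 * r ^+ 2).
  have /andP[t0 t1] := tau01 k.
  apply: (le_trans (mmono _ (rho k) _)).
    by rewrite /rho lerDl divr_ge0// mulr_ge0 ?ltW.
  apply: (le_trans (it k)); apply: ler_wpM2r; first exact: ltW.
  by rewrite -[leRHS]expr1; apply: ler_wiXn2l => //; exact: ltW.
suff m0 : m (r / 2) <= 0.
  have : m (r / 2) = 0 by apply/eqP; rewrite eq_le m0; apply: fine_ge0; exact: measure_ge0.
  by move=> E; rewrite -(fineK (fm (r / 2))); congr EFin.
apply/ler_addgt0Pr => e e0; rewrite add0r.
have e1 : 0 < e / (2 * sig ^+ 2 * r ^+ 2) by rewrite divr_gt0.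
have [k ke] := ex_natSinv_lt e1.
apply: (le_trans (it k)); rewrite -ler_pdivlMr//; apply: (le_trans _ (ltW ke)).
rewrite /tau exprVn lef_pV2 ?posrE ?exprn_gt0//.
by rewrite -natrX ler_nat; exact: ltn_expl.
Qed.

End density.

(** * Triple junctions *)

Section lines.
Local Open Scope nat_scope.
Implicit Types (a : nat -> bool) (n i j k : nat).

Definition changes a n : nat := \sum_(i < n) (a i != a i.+1).

Definition tame a n : Prop :=
  forall i j, i < n -> j < n -> a i != a i.+1 -> a j != a j.+1 -> i = j.

Lemma changes_ge a n : (a 0 != a n) <= changes a n.
Proof.
rewrite /changes; elim: n => [|n ih]; first by rewrite big_ord0 eqxx.
rewrite big_ord_recr /=; apply: leq_trans (leq_add ih (leqnn _)).
by case: (a 0); case: (a n); case: (a n.+1).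
Qed.

(** Such a line has two changes at least, one more than its end points can force. *)
Lemma wild_changes a n : ~ tame a n -> (a 0 != a n).+1 <= changes a n.
Proof.
move=> /asboolPn; rewrite /tame => na.
have [i [j [ij jn ci cj]]] : exists i j, [/\ i < j, j < n, a i != a i.+1 & a j != a j.+1].
  apply: contrapT => nex; move/negP: na; apply; apply/asboolP => i j ilt jlt ci cj.
  by case: (ltngtP i j) => // lt; exfalso; apply: nex; [exists i, j|exists j, i].
apply: (@leq_trans 2); first by case: (_ != _).
have jn' := ltn_trans ij jn.
rewrite /changes (bigD1 (Ordinal jn)) //= (bigD1 (Ordinal jn')) /=; last first.
  by rewrite -val_eqE /= neq_ltn ij.
by rewrite ci cj addnA leq_addr.
Qed.

Lemma tame_left a n i k : tame a n -> i < n -> a i != a i.+1 -> k <= i -> a k = a i.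
Proof.
move=> ta lt ci; elim: i lt ci k => [|i _] lt ci k; first by rewrite leqn0 => /eqP ->.
move=> ki; have H m : m <= i.+1 -> a (i.+1 - m) = a i.+1.
  elim: m => [|m ih] mi; first by rewrite subn0.
  rewrite -(ih (ltnW mi)); apply/eqP/negPn/negP => c.
  have E : i.+1 - m = (i.+1 - m.+1).+1 by lia.
  rewrite E in c.
  have := ta _ i.+1 _ lt c ci; have : i.+1 - m.+1 < n by lia.
  by move=> h /(_ h); lia.
by have := H (i.+1 - k); rewrite subKn// => ->//; lia.
Qed.

Lemma tame_right a n i k : tame a n -> i < n -> a i != a i.+1 -> i < k <= n -> a k = a i.+1.
Proof.
move=> ta lt ci /andP[ik kn].
have -> : k = i.+1 + (k - i.+1) by lia.
have : i.+1 + (k - i.+1) <= n by lia.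
elim: (k - i.+1) => [|m ih] h; first by rewrite addn0.
rewrite -ih; last by lia.
rewrite addnS; apply/eqP/negPn/negP => c.
have := ta (i.+1 + m) i _ lt _ ci; rewrite eq_sym in c.
have h' : i.+1 + m < n by lia.
by move=> /(_ h' c); lia.
Qed.

Lemma tame_const a n k : tame a n -> a 0 = a n -> k <= n -> a k = a 0.
Proof.
move=> ta a0n kn.
have [[i /andP[lt ci]]|nc] := pselect (exists i, (i < n) && (a i != a i.+1)).
  exfalso; move: (ci); rewrite -(tame_left ta lt ci (leq0n i)) a0n.
  have nn : i < n <= n by rewrite lt leqnn.
  by rewrite (tame_right ta lt ci nn) eqxx.
elim: k kn => // k ih kn; rewrite -ih; last exact: ltnW.
by apply/esym/eqP/negPn/negP => c; apply: nc; exists k; rewrite kn.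
Qed.

Section corners.
Variables (f h g : nat -> nat -> bool) (n : nat).
Hypothesis fh : forall i j, f i j -> h i j -> False.
Hypothesis fg : forall i j, f i j -> g i j -> False.
Hypothesis hg : forall i j, h i j -> g i j -> False.

Definition corner i j := [&& f i j, h i.+1 j & g i j.+1].

Definition tame_grid (A : nat -> nat -> bool) : Prop :=
  (forall j, j <= n -> tame (A^~ j) n) /\ (forall i, i <= n -> tame (A i) n).

Hypotheses (tf : tame_grid f) (th : tame_grid h) (tg : tame_grid g).

(** Each phase changes at the corner and, on a tame line, nowhere else. Hence the phases seen at a
    corner continue along its row and its column up to the sides of the square. *)
Lemma cornerP i j : i < n -> j < n -> corner i j ->
  [/\ forall k, k <= i -> f k j, forall k, i < k <= n -> h k j,
      forall k, k <= j -> f i k & forall k, j < k <= n -> g i k].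
Proof.
move=> lti ltj /and3P[fij hij gij].
have nf1 : ~~ f i.+1 j by apply/negP => /fh/(_ hij).
have nf2 : ~~ f i j.+1 by apply/negP => /fg/(_ gij).
have nh1 : ~~ h i j by apply/negP => /(fh fij).
have ng1 : ~~ g i j by apply/negP => /(fg fij).
have cf1 : f i j != f i.+1 j by rewrite fij (negbTE nf1).
have cf2 : f i j != f i j.+1 by rewrite fij (negbTE nf2).
have ch : h i j != h i.+1 j by rewrite hij (negbTE nh1).
have cg : g i j != g i j.+1 by rewrite gij (negbTE ng1).
split=> k kk.
- by rewrite (@tame_left (f^~ j) n i k (tf.1 _ (ltnW ltj)) lti cf1 kk).
- by rewrite (@tame_right (h^~ j) n i k (th.1 _ (ltnW ltj)) lti ch kk).
- by rewrite (@tame_left (f i) n j k (tf.2 _ (ltnW lti)) ltj cf2 kk).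
- by rewrite (@tame_right (g i) n j k (tg.2 _ (ltnW lti)) ltj cg kk).
Qed.

(** At the node (i', j) the first corner forces phase [h], whereas the second forces [f] if j <= j'
    and [g] otherwise. *)
Lemma corner_lt i j i' j' : i < n -> j < n -> i' < n -> j' < n ->
  corner i j -> corner i' j' -> ~ i < i'.
Proof.
move=> lti ltj lti' ltj' c c' ii'.
have [_ H _ _] := cornerP lti ltj c; have [_ _ F' G'] := cornerP lti' ltj' c'.
have hij : h i' j by apply: H; rewrite ii' ltnW.
have [jj'|jj'] := leqP j j'; first exact: (fh (F' _ jj') hij).
by apply: (hg hij); apply: G'; rewrite jj' ltnW.
Qed.

Lemma corner_uniq i j i' j' : i < n -> j < n -> i' < n -> j' < n ->
  corner i j -> corner i' j' -> i = i' /\ j = j'.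
Proof.
move=> lti ltj lti' ltj' c c'.
have ii' : i = i'.
  have := corner_lt lti ltj lti' ltj' c c'; have := corner_lt lti' ltj' lti ltj c' c.
  by move=> /negP + /negP; rewrite -!leqNgt => h1 h2; apply/eqP; rewrite eqn_leq h1 h2.
split => //; subst i'.
have [_ _ F G] := cornerP lti ltj c; have [_ _ F' G'] := cornerP lti ltj' c'.
apply/eqP/negPn/negP; rewrite neq_ltn => /orP[jj|jj].
  by apply: (fg (F' j.+1 jj)); apply: G; rewrite leqnn.
by apply: (fg (F j'.+1 jj)); apply: G'; rewrite leqnn.
Qed.

(** Otherwise the line of first index 0 would be all [f], that of first index n all [h], and the
    vertex (n, 0) would lie in both. Charging the corner to differences between vertices is what
    makes the count integrable: such a difference integrates to O(n h). *)
Lemma corner_far i j : i < n -> j < n -> corner i j ->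
  0 < (f 0 0 != f 0 n) + (f 0 0 != f n 0) + (h n 0 != h n n).
Proof.
move=> lti ltj c; have [F H _ _] := cornerP lti ltj c.
have f0j := F 0 (leq0n _).
have hnj : h n j by apply: H; rewrite lti leqnn.
rewrite !addn_gt0 !lt0b; apply: contrapT => /negP.
rewrite !negb_or !negbK => /andP[/andP[/eqP f1 /eqP f2] /eqP h1].
have e1 : f 0 j = f 0 0 by apply: (tame_const (n := n)) => //; [exact: tf.2|exact: ltnW].
have e2 : h n j = h n 0 by apply: (tame_const (n := n)) => //; [exact: th.2|exact: ltnW].
by apply: (@fh n 0); [rewrite -f2 -e1|rewrite -e2].
Qed.

Lemma sum_corner :
  \sum_(i < n) \sum_(j < n) corner i j <=
  (f 0 0 != f 0 n) + (f 0 0 != f n 0) + (h n 0 != h n n).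
Proof.
have [[[i j] /= c]|nc] := pselect (exists p : 'I_n * 'I_n, corner p.1 p.2).
  apply: leq_trans (corner_far (ltn_ord i) (ltn_ord j) c).
  have u (k l : 'I_n) : corner k l -> (k = i) /\ (l = j).
    by move=> ckl; have [/val_inj -> /val_inj ->] :=
      corner_uniq (ltn_ord k) (ltn_ord l) (ltn_ord i) (ltn_ord j) ckl c.
  rewrite (bigD1 i) //= (bigD1 j) //= !big1 ?addn0 ?leq_b1//.
    move=> k ki; apply: big1 => l _; case: (boolP (corner k l)) => // /u[ki' _].
    by rewrite ki' eqxx in ki.
  move=> l lj; case: (boolP (corner i l)) => // /u[_ lj'].
  by rewrite lj' eqxx in lj.
rewrite big1 // => i _; rewrite big1 // => j _.
by case: (boolP (corner i j)) => // c; exfalso; apply: nc; exists (i, j).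
Qed.

End corners.

Definition ends (A : nat -> nat -> bool) n :=
  \sum_(j < n.+1) (A 0 j != A n j) + \sum_(i < n.+1) (A i 0 != A i n).

Definition total (A : nat -> nat -> bool) n :=
  \sum_(j < n.+1) changes (A^~ j) n + \sum_(i < n.+1) changes (A i) n.

Lemma ends_total A n : ends A n <= total A n.
Proof.
by apply: leq_add; apply: leq_sum => k _; [exact: (changes_ge (A^~ k))|exact: (changes_ge (A k))].
Qed.

Lemma ends_total_wild A n : ~ tame_grid n A -> (ends A n).+1 <= total A n.
Proof.
rewrite /tame_grid => /not_andP[] /existsNP[k /not_implyP[kn w]].
  rewrite /ends /total -addSn leq_add//; last first.
    by apply: leq_sum => i _; exact: (changes_ge (A i)).
  have kn' : k < n.+1 by [].
  rewrite (bigD1 (Ordinal kn')) //= [in leqRHS](bigD1 (Ordinal kn')) //= -addSn leq_add//.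
    exact: (wild_changes w).
  by apply: leq_sum => j _; exact: (changes_ge (A^~ j)).
rewrite /ends /total -addnS leq_add//.
  by apply: leq_sum => j _; exact: (changes_ge (A^~ j)).
have kn' : k < n.+1 by [].
rewrite (bigD1 (Ordinal kn')) //= [in leqRHS](bigD1 (Ordinal kn')) //= -addSn leq_add//.
  exact: (wild_changes w).
by apply: leq_sum => i _; exact: (changes_ge (A i)).
Qed.

(* On a grid whose lines change colour at most once there is at most one corner. *)
Lemma corners_le (f h g : nat -> nat -> bool) n :
  (forall i j, f i j -> h i j -> False) -> (forall i j, f i j -> g i j -> False) ->
  (forall i j, h i j -> g i j -> False) ->
  \sum_(i < n) \sum_(j < n) corner f h g i j + n ^ 2 * (ends f n + ends h n + ends g n) <=
  n ^ 2 * (total f n + total h n + total g n) +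
  ((f 0 0 != f 0 n) + (f 0 0 != f n 0) + (h n 0 != h n n)).
Proof.
move=> fh fg hg.
have [ef eh eg] : [/\ ends f n <= total f n, ends h n <= total h n & ends g n <= total g n].
  by split; exact: ends_total.
have [[tf [th tg]]|nt] := pselect (tame_grid n f /\ tame_grid n h /\ tame_grid n g).
  rewrite addnC; apply: leq_add; last exact: sum_corner.
  by apply: leq_mul => //; apply: leq_add => //; exact: leq_add.
(* Some line is not tame: the totals exceed the ends by at least 1, and the weight n^2 pays for all
   n^2 possible corners. *)
apply: leq_trans (leq_addr _ _).
have w : (ends f n + ends h n + ends g n).+1 <= total f n + total h n + total g n.
  have [tf|/ends_total_wild wf] := pselect (tame_grid n f); last by lia.
  have [th|/ends_total_wild wh] := pselect (tame_grid n h); last by lia.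
  have [tg|/ends_total_wild wg] := pselect (tame_grid n g); last by lia.
  by case: nt.
apply: leq_trans (leq_mul (leqnn _) w); rewrite mulnS leq_add//.
apply: (@leq_trans (\sum_(i < n) \sum_(j < n) 1)).
  by apply: leq_sum => i _; apply: leq_sum => j _; exact: leq_b1.
by rewrite sum_nat_const card_ord sum_nat_const card_ord muln1.
Qed.

End lines.

(** * Integrating the lattice count over the base point *)

Section corner_measure.
Context {R : realType}.
Implicit Types (x y z v w d : plane R) (A F G H : set (plane R)).

(** Counts of lattice configurations as functions of the base point, with their integral;
    inequalities between natural numbers are integrated term by term in this form. *)
Definition itn (N : plane R -> nat) (a : R) : Prop :=
  bfun (fun x => (N x)%:R) /\ (\int[mu]_x ((N x)%:R)%:E = a%:E)%E.

Lemma itnD N1 N2 a1 a2 : itn N1 a1 -> itn N2 a2 -> itn (fun x => N1 x + N2 x)%N (a1 + a2).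
Proof.
move=> [m1 i1] [m2 i2]; split.
  have -> : (fun x => (N1 x + N2 x)%:R) = (fun x => (N1 x)%:R) \+ (fun x => (N2 x)%:R : R).
    by apply/funext => x; rewrite natrD.
  exact: bfunD.
transitivity (\int[mu]_x (((N1 x)%:R)%:E + ((N2 x)%:R)%:E))%E.
  by apply: eq_integral => x _; rewrite natrD EFinD.
rewrite ge0_integralD//.
- by rewrite i1 i2.
- by apply: (@mEFin _ (fun x => (N1 x)%:R)).
- by apply: (@mEFin _ (fun x => (N2 x)%:R)).
Qed.

Lemma itnM N (k : nat) a : itn N a -> itn (fun x => k * N x)%N (k%:R * a).
Proof.
move=> iN; elim: k => [|k ih].
  split; first by have -> : (fun x => (0 * N x)%:R) = cst (0 : R) by []; exact: bfun_cst.
  by rewrite mul0r; under eq_integral do rewrite mul0n; rewrite integral0.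
have := itnD iN ih; congr itn; last by rewrite -natr1; ring.
Qed.

Lemma itn_sum (n : nat) (N : nat -> plane R -> nat) (a : nat -> R) :
  (forall i, itn (N i) (a i)) -> itn (fun x => \sum_(i < n) N i x)%N (\sum_(i < n) a i).
Proof.
move=> iN; elim: n => [|n ih].
  rewrite big_ord0; have -> : (fun x => \sum_(i < 0) N i x)%N = fun=> 0%N.
    by apply/funext => x; rewrite big_ord0.
  by split; [exact: bfun_cst|rewrite integral0].
rewrite big_ord_recr /=; have := itnD ih (iN n); congr itn.
by apply/funext => x; rewrite big_ord_recr.
Qed.

Lemma itn_le N1 N2 a1 a2 : itn N1 a1 -> itn N2 a2 -> (forall x, (N1 x <= N2 x)%N) -> a1 <= a2.
Proof.
move=> [m1 i1] [m2 i2] le; rewrite -lee_fin -i1 -i2; apply: ge0_le_integral.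
- exact: measurableT.
- by move=> x _; rewrite lee_fin.
- exact: (@mEFin _ (fun x => (N1 x)%:R)).
- exact: (@mEFin _ (fun x => (N2 x)%:R)).
- by move=> x _; rewrite lee_fin ler_nat.
Qed.

Lemma itn_set A z (a : R) : bset A -> mu A = a%:E -> itn (fun x => (x + z \in A) : nat) a.
Proof.
move=> mA Aa.
have E : (fun x => ((x + z \in A) : nat)%:R) = (fun x => \1_A (x + z)) :> (plane R -> R).
  by apply/funext => x; rewrite indicE.
split; first by rewrite E; apply: bfunS; exact: bfun_indic.
transitivity (\int[mu]_x (\1_A (x + z)%R)%:E)%E.
  by apply: eq_integral => x _; rewrite indicE.
have m1 : measurable_fun setT ((fun x => (\1_A x)%:E) : mplane R -> \bar R).
  by apply/measurable_EFinP; exact: bfun_indic.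
rewrite (ge0_integral_shift z m1); last by move=> x; rewrite lee_fin.
by rewrite (integral_indic _ measurableT mA) setIT -Aa.
Qed.

Definition dlt A y : R := fine (mu (sdiff A y)).

(** One of the three phases will be the complement of E, of infinite measure; only its differences
    with translates are finite. *)
Definition finite_diff A : Prop := forall y, (mu (sdiff A y) < +oo)%E.

Lemma dltE A y : finite_diff A -> mu (sdiff A y) = (dlt A y)%:E.
Proof. by move=> fA; rewrite /dlt fineK// ge0_fin_numE// measure_ge0. Qed.

Definition dlt3 F H G y : R := dlt F y + dlt H y + dlt G y.

Definition lat v w (i j : nat) : plane R := i%:R *: v + j%:R *: w.

Definition color A v w x i j : bool := x + lat v w i j \in A.

Lemma itn_color A v w i j i' j' d : bset A -> finite_diff A ->
  lat v w i' j' = lat v w i j + d ->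
  itn (fun x => (color A v w x i j != color A v w x i' j') : nat) (dlt A d).
Proof.
move=> mA fA E; have := itn_set (lat v w i j) (bset_sdiff d mA) (dltE d fA).
congr itn; apply/funext => x; congr nat_of_bool.
rewrite /color E (_ : x + (lat v w i j + d) = x + lat v w i j + d); last exact: addrA.
move: (x + lat v w i j) => y.
have [Ay|nAy] := pselect (A y); have [Ad|nAd] := pselect (A (y + d)).
- by rewrite (mem_set Ay) (mem_set Ad) /= memNset// /sdiff /=; apply; exact/propext.
- by rewrite (mem_set Ay) (memNset nAd) /= mem_set// /sdiff /= => e; apply: nAd; rewrite -e.
- by rewrite (memNset nAy) (mem_set Ad) /= mem_set// /sdiff /= => e; apply: nAy; rewrite e.
- by rewrite (memNset nAy) (memNset nAd) /= memNset// /sdiff /=; apply; exact/propext.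
Qed.

Lemma itn_ends A v w n : bset A -> finite_diff A ->
  itn (fun x => ends (color A v w x) n) (n.+1%:R * (dlt A (n%:R *: v) + dlt A (n%:R *: w))).
Proof.
move=> mA fA; rewrite mulrDr.
have sc (a : R) : n.+1%:R * a = \sum_(j < n.+1) a by rewrite sumr_const card_ord mulr_natl.
rewrite !sc; apply: itnD.
  apply: (@itn_sum n.+1 (fun j x => (color A v w x 0 j != color A v w x n j) : nat) (fun=> dlt A (n%:R *: v))) => j.
  by apply: itn_color => //; rewrite /lat scale0r add0r addrC.
apply: (@itn_sum n.+1 (fun j x => (color A v w x j 0 != color A v w x j n) : nat) (fun=> dlt A (n%:R *: w))) => j.
by apply: itn_color => //; rewrite /lat scale0r addr0.
Qed.

Lemma itn_total A v w n : bset A -> finite_diff A ->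
  itn (fun x => total (color A v w x) n) (n.+1%:R * (n%:R * (dlt A v + dlt A w))).
Proof.
move=> mA fA; rewrite !mulrDr.
have sc k (a : R) : k%:R * a = \sum_(j < k) a by rewrite sumr_const card_ord mulr_natl.
rewrite !(sc n.+1); apply: itnD.
  apply: (@itn_sum n.+1 (fun j x => changes ((color A v w x)^~ j) n) (fun=> n%:R * dlt A v)) => j.
  rewrite sc; apply: (@itn_sum n (fun i x => (color A v w x i j != color A v w x i.+1 j) : nat) (fun=> dlt A v)) => i.
  by apply: itn_color => //; rewrite /lat -natr1 scalerDl scale1r addrAC.
apply: (@itn_sum n.+1 (fun j x => changes (color A v w x j) n) (fun=> n%:R * dlt A w)) => i.
rewrite sc; apply: (@itn_sum n (fun j x => (color A v w x i j != color A v w x i j.+1) : nat) (fun=> dlt A w)) => j.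
by apply: itn_color => //; rewrite /lat -natr1 scalerDl scale1r addrA.
Qed.

Definition triple F H G v w : set (plane R) :=
  F `&` [set x | H (x + v)] `&` [set x | G (x + w)].

Lemma bset_triple F H G v w : bset F -> bset H -> bset G -> bset (triple F H G v w).
Proof. by move=> mF mH mG; apply: bsetI; [apply: bsetI => //|]; exact: bset_shift. Qed.

Lemma triple_fin F H G v w : bset F -> bset H -> bset G -> F `&` H = set0 -> finite_diff F ->
  mu (triple F H G v w) \is a fin_num.
Proof.
move=> mF mH mG FH fF; rewrite ge0_fin_numE ?measure_ge0//.
apply: le_lt_trans (fF v); apply: le_measure; rewrite ?inE.
- exact: bset_triple.
- exact: bset_sdiff.
- move=> x [[Fx Hx] _] e; have : (F `&` H) (x + v) by split => //; rewrite -e.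
  by rewrite FH.
Qed.

(** [corners_le] on the lattice x + i v + j w, integrated over x. By translation invariance each of
    the n^2 cells contributes the same measure of triples, and a comparison of two nodes with offset
    d contributes [dlt A d]. *)
Lemma triple_le F H G v w n : bset F -> bset H -> bset G ->
  F `&` H = set0 -> F `&` G = set0 -> H `&` G = set0 ->
  finite_diff F -> finite_diff H -> finite_diff G ->
  n%:R ^+ 2 * fine (mu (triple F H G v w)) +
    n%:R ^+ 2 * (n.+1%:R * (dlt3 F H G (n%:R *: v) + dlt3 F H G (n%:R *: w))) <=
  n%:R ^+ 2 * (n.+1%:R * (n%:R * (dlt3 F H G v + dlt3 F H G w))) +
    (dlt F (n%:R *: w) + dlt F (n%:R *: v) + dlt H (n%:R *: w)).
Proof.
move=> mF mH mG FH FG HG fF fH fG.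
have dis A B x i j : A `&` B = set0 -> color A v w x i j -> color B v w x i j -> False.
  by move=> AB /set_mem Ax /set_mem Bx; have : (A `&` B) (x + lat v w i j) by []; rewrite AB.
pose cf := color F v w; pose ch := color H v w; pose cg := color G v w.
have le x := @corners_le (cf x) (ch x) (cg x) n
  (fun i j => @dis _ _ x i j FH) (fun i j => @dis _ _ x i j FG) (fun i j => @dis _ _ x i j HG).
have i1 : itn (fun x => \sum_(i < n) \sum_(j < n) corner (cf x) (ch x) (cg x) i j)%N
    (n%:R ^+ 2 * fine (mu (triple F H G v w))).
  have sc k (a : R) : k%:R * a = \sum_(j < k) a by rewrite sumr_const card_ord mulr_natl.
  rewrite expr2 -mulrA sc.
  apply: (@itn_sum n (fun i x => \sum_(j < n) corner (cf x) (ch x) (cg x) i j)%N (fun=> n%:R * fine _)) => i.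
  rewrite sc; apply: (@itn_sum n (fun j x => corner (cf x) (ch x) (cg x) i j : nat) (fun=> fine _)) => j.
  have := itn_set (lat v w i j) (bset_triple v w mF mH mG) (esym (fineK (triple_fin v w mF mH mG FH fF))).
  congr itn; apply/funext => x; congr nat_of_bool; rewrite /corner /cf /ch /cg /color.
  have -> : lat v w i.+1 j = lat v w i j + v by rewrite /lat -natr1 scalerDl scale1r addrAC.
  have -> : lat v w i j.+1 = lat v w i j + w by rewrite /lat -natr1 scalerDl scale1r addrA.
  rewrite !(addrA x); set y := x + lat v w i j; apply/idP/and3P.
    by move=> /set_mem[[Fy Hy] Gy]; split; exact: mem_set.
  by move=> [/set_mem Fy /set_mem Hy /set_mem Gy]; apply/mem_set.
have i2 : itn (fun x => n ^ 2 * (ends (cf x) n + ends (ch x) n + ends (cg x) n))%N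
    (n%:R ^+ 2 * (n.+1%:R * (dlt3 F H G (n%:R *: v) + dlt3 F H G (n%:R *: w)))).
  rewrite -natrX; apply: itnM.
  have := itnD (itnD (itn_ends v w n mF fF) (itn_ends v w n mH fH)) (itn_ends v w n mG fG).
  by rewrite -!mulrDr (addrACA (dlt F _)) (addrACA (dlt F _ + _)).
have i3 : itn (fun x => n ^ 2 * (total (cf x) n + total (ch x) n + total (cg x) n))%N
    (n%:R ^+ 2 * (n.+1%:R * (n%:R * (dlt3 F H G v + dlt3 F H G w)))).
  rewrite -natrX; apply: itnM.
  have := itnD (itnD (itn_total v w n mF fF) (itn_total v w n mH fH)) (itn_total v w n mG fG).
  by rewrite -!mulrDr (addrACA (dlt F _)) (addrACA (dlt F _ + _)).
have i4 : itn (fun x => (cf x 0 0 != cf x 0 n) + (cf x 0 0 != cf x n 0) + (ch x n 0 != ch x n n))%N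
    (dlt F (n%:R *: w) + dlt F (n%:R *: v) + dlt H (n%:R *: w)).
  apply: itnD; first apply: itnD.
  - by apply: itn_color => //; rewrite /lat !scale0r !add0r.
  - by apply: itn_color => //; rewrite /lat !scale0r !add0r addr0.
  - by apply: itn_color => //; rewrite /lat scale0r addr0.
exact: (itn_le (itnD i1 i2) (itnD i3 i4) le).
Qed.

End corner_measure.

(** * Smallness of triple junctions *)

Section three_phases.
Context {R : realType}.
Implicit Types (x y z v w d : plane R) (A F G H : set (plane R)).

Definition diff_le A (P : R) : Prop := forall y, (mu (sdiff A y) <= (P * `|y|)%:E)%E.

Lemma diff_le_fin A (P : R) : diff_le A P -> finite_diff A.
Proof. by move=> dA y; apply: le_lt_trans (dA y) _; exact: ltry. Qed.

Lemma dlt_le A (P : R) y : diff_le A P -> dlt A y <= P * `|y|.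
Proof. by move=> dA; rewrite -lee_fin -(dltE y (diff_le_fin dA)). Qed.

Lemma dlt_ge0 A y : 0 <= dlt A y.
Proof. by apply: fine_ge0; exact: measure_ge0. Qed.

Lemma mu_setU2 A B : bset A -> bset B -> (mu (A `|` B) <= mu A + mu B)%E.
Proof. by move=> mA mB; apply: measureU2. Qed.

Lemma dlt_add A y y' : bset A -> finite_diff A -> dlt A (y + y') <= dlt A y + dlt A y'.
Proof.
move=> mA fA.
suff : (mu (sdiff A (y + y')%R) <= mu (sdiff A y) + mu (sdiff A y'))%E.
  by rewrite (dltE (y + y') fA) (dltE y fA) (dltE y' fA) -EFinD lee_fin.
rewrite -(mu_shift y (bset_sdiff y' mA)).
have ms : bset [set x | sdiff A y' (x + y)] by apply: bset_shift; exact: bset_sdiff.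
apply: (le_trans _ (mu_setU2 (bset_sdiff y mA) ms)).
apply: le_measure; rewrite ?inE.
- exact: bset_sdiff.
- by apply: bsetU => //; exact: bset_sdiff.
- move=> x /=; rewrite /sdiff /= addrA => n.
  have [e|ne] := pselect (A x = A (x + y)); last by left.
  by right; rewrite -e.
Qed.

Definition dyad (k : nat) : R := 2^-1 ^+ k.

Lemma dyad_gt0 k : 0 < dyad k.
Proof. by rewrite exprn_gt0// invr_gt0. Qed.

Lemma dyadD k m : dyad (k + m) = dyad k * dyad m.
Proof. exact: exprD. Qed.

Lemma dyadV m : (2 ^ m)%:R * dyad m = 1.
Proof. by rewrite natrX /dyad -exprMn mulfV ?expr1n. Qed.

(** The translation quotient at scale 2^-k. A translation by 2h is two translations by h, so it is
    nondecreasing in [k]; under [diff_le] it is bounded, and its increments over a fixed number of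
    scales tend to 0. *)
Definition scaled A v k : R := dlt A (dyad k *: v) / dyad k.

Lemma scaledS A v k : bset A -> finite_diff A -> scaled A v k <= scaled A v k.+1.
Proof.
move=> mA fA; rewrite /scaled.
have h0 := dyad_gt0 k.+1.
have E : dyad k = dyad k.+1 + dyad k.+1 by rewrite /dyad exprSr; field.
have : dlt A (dyad k *: v) <= dlt A (dyad k.+1 *: v) + dlt A (dyad k.+1 *: v).
  by rewrite E scalerDl; exact: dlt_add.
rewrite E; move: (dlt A ((dyad k.+1 + dyad k.+1) *: v)) (dlt A (dyad k.+1 *: v)).
move: (dyad k.+1) h0 => h h0 a b ab; rewrite ler_pdivrMr ?addr_gt0//.
by have -> : b / h * (h + h) = b + b by field; rewrite gt_eqF.
Qed.

Lemma scaled_cauchy A v (P : R) m : bset A -> diff_le A P -> forall e, 0 < e ->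
  \forall k \near \oo, scaled A v (k + m) - scaled A v k <= e.
Proof.
move=> mA dA e e0; have fA := diff_le_fin dA.
have nd : nondecreasing_seq (scaled A v).
  by apply/nondecreasing_seqP => k; exact: scaledS.
have ub : has_ubound (range (scaled A v)).
  exists (P * `|v|) => _ [k _ <-]; rewrite /scaled ler_pdivrMr ?dyad_gt0//.
  by rewrite (le_trans (dlt_le _ dA))// normrZ (gtr0_norm (dyad_gt0 k)) mulrCA mulrC.
have := nondecreasing_cvgn nd ub; set l := sup _ => cl.
have := cl => /cvgrPdist_lt/(_ _ e0); apply: filterS => k lk.
have : scaled A v (k + m) <= l.
  by apply: sup_ubound => //; exists (k + m)%N.
by move: lk; rewrite ltr_norml => /andP[_]; lra.
Qed.

Section uniform.
Variables (F H G : set (plane R)) (P : R).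
Hypotheses (mF : bset F) (mH : bset H) (mG : bset G).
Hypotheses (FH : F `&` H = set0) (FG : F `&` G = set0) (HG : H `&` G = set0).
Hypotheses (dF : diff_le F P) (dH : diff_le H P) (dG : diff_le G P).

Let zeta v w : R := fine (mu (triple F H G v w)).

Let defect_scale (n h a b : R) : 0 < n -> 0 < h ->
  n * a - b = n * h * (a / h - b / (n * h)).
Proof. by move=> n0 h0; field; apply/andP; split; rewrite gt_eqF. Qed.

Let eps_scale (N n h e : R) : 0 < n -> 0 < N ->
  N * (6 * (n * h * (e / (12 * N * n)))) = e / 2 * h.
Proof. by move=> n0 N0; field; apply/andP; split; rewrite gt_eqF. Qed.

(** [triple_le] between the scales [h = dyad (k + m)] and [n h = dyad k], with [n = 2 ^ m]. The
    excess of totals over ends is governed by increments of [scaled], and the vertex term, of order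
    n h, is divided by the n^2 cells. *)
Lemma triple_limit v w (e : R) : 0 < e ->
  \forall k \near \oo, zeta (dyad k *: v) (dyad k *: w) <= e * dyad k.
Proof.
move=> e0; pose M := `|v| + `|w| + 1.
have M0 : 0 < M by rewrite ltr_wpDl// addr_ge0.
have P0 : 0 <= P.
  have := dlt_le (1, 0) dF; rewrite plane_normE /= normr0 normr1.
  have -> : Num.max 1 0 = 1 :> R by apply/max_idPl.
  by rewrite mulr1; apply: le_trans; exact: dlt_ge0.
have e1 : 0 < e / (6 * P * M + 1) by rewrite divr_gt0// ltr_wpDl// !mulr_ge0// ltW.
(* First n is taken so large that the vertex term, at most 3 P M n h, is at most half of the target;
   only then is [k] sent to infinity. *)
have [m0 m0e] := ex_natSinv_lt e1.
pose m := m0.+1; pose n := (2 ^ m)%N.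
have n0 : 0 < (n%:R : R) by rewrite ltr0n expn_gt0.
have n1 : 0 < (n.+1%:R : R) by [].
have nPM : 3 * P * M <= e / 2 * n%:R.
  have h1 : 6 * P * M + 1 < e * m0.+1%:R.
    move: m0e; rewrite -[X in X < _]mul1r ltr_pdivrMr// mulrAC ltr_pdivlMr.
      by rewrite mul1r.
    by rewrite ltr_wpDl// !mulr_ge0// ltW.
  have h2 : e * m0.+1%:R <= e * n%:R.
    by rewrite ler_pM2l// ler_nat; apply: ltnW; exact: ltn_expl.
  lra.
(* Six increments, for three phases and two directions, each weighted by (n + 1) n h, must sum to at
   most e h / 2. *)
pose e2 := e / (12 * n.+1%:R * n%:R).
have e20 : 0 < e2 by rewrite divr_gt0// !mulr_gt0.
have cau A u : bset A -> diff_le A P ->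
    \forall k \near \oo, scaled A u (k + m) - scaled A u k <= e2.
  by move=> mA dA; exact: scaled_cauchy dA _ e20.
have near_shift (Q : nat -> Prop) : (\forall k \near \oo, Q (k + m)%N) -> \forall k \near \oo, Q k.
  move=> [N _ QN]; exists (N + m)%N => // k /= Nk.
  have mk : (m <= k)%N := leq_trans (leq_addl N m) Nk.
  by rewrite -(subnK mk); apply: QN; rewrite /= -(leq_add2r m) subnK.
apply: near_shift.
have FI (Q1 Q2 : nat -> Prop) : (\forall k \near \oo, Q1 k) -> (\forall k \near \oo, Q2 k) ->
    \forall k \near \oo, Q1 k /\ Q2 k by exact: filterI.
have C := FI _ _ (FI _ _ (cau F v mF dF) (FI _ _ (cau H v mH dH) (cau G v mG dG)))
  (FI _ _ (cau F w mF dF) (FI _ _ (cau H w mH dH) (cau G w mG dG))).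
apply: filterS C => k [[v1 [v2 v3]] [w1 [w2 w3]]].
pose h := dyad (k + m); have h0 : 0 < h by exact: dyad_gt0.
have nh : n%:R * h = dyad k by rewrite /h dyadD mulrCA dyadV mulr1.
have one A u : bset A -> diff_le A P -> scaled A u (k + m) - scaled A u k <= e2 ->
    n%:R * dlt A (h *: u) - dlt A (n%:R *: (h *: u)) <= n%:R * h * e2.
  move=> mA dA; rewrite /scaled -/h -nh scalerA => le.
  have -> : n%:R * dlt A (h *: u) - dlt A ((n%:R * h) *: u) =
      n%:R * h * (dlt A (h *: u) / h - dlt A ((n%:R * h) *: u) / (n%:R * h)).
    by exact: defect_scale.
  by rewrite ler_pM2l ?mulr_gt0.
have {}v1 := one F v mF dF v1; have {}v2 := one H v mH dH v2; have {}v3 := one G v mG dG v3.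
have {}w1 := one F w mF dF w1; have {}w2 := one H w mH dH w2; have {}w3 := one G w mG dG w3.
have := triple_le (h *: v) (h *: w) n mF mH mG FH FG HG (diff_le_fin dF) (diff_le_fin dH) (diff_le_fin dG).
rewrite -/(zeta _ _) /dlt3; set z := zeta _ _.
have fb A u : diff_le A P -> `|u| <= M -> dlt A (n%:R *: (h *: u)) <= n%:R * h * (P * M).
  move=> dA uM; apply: (le_trans (dlt_le _ dA)).
  rewrite scalerA normrZ gtr0_norm ?mulr_gt0// mulrCA.
  by apply: ler_wpM2l; [rewrite ltW ?mulr_gt0|apply: ler_wpM2l].
have vM : `|v| <= M by rewrite /M -addrA lerDl addr_ge0.
have wM : `|w| <= M by rewrite /M addrAC lerDr addr_ge0.
have := fb F w dF wM; have := fb F v dF vM; have := fb H w dH wM.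
move: v1 v2 v3 w1 w2 w3.
move: (dlt F (h *: v)) (dlt H (h *: v)) (dlt G (h *: v)) (dlt F (h *: w)) (dlt H (h *: w)) (dlt G (h *: w)).
move: (dlt F (n%:R *: (h *: v))) (dlt H (n%:R *: (h *: v))) (dlt G (n%:R *: (h *: v))).
move: (dlt F (n%:R *: (h *: w))) (dlt H (n%:R *: (h *: w))) (dlt G (n%:R *: (h *: w))).
move=> Fw Hw Gw Fv Hv Gv fv hv gv fw hw gw v1 v2 v3 w1 w2 w3 b1 b2 b3 key.
have nn0 : 0 < (n%:R : R) ^+ 2 by rewrite exprn_gt0.
rewrite -(ler_pM2l nn0).
have S : n%:R * (fv + hv + gv + (fw + hw + gw)) - (Fv + Hv + Gv + (Fw + Hw + Gw)) <=
    6 * (n%:R * h * e2) by move: v1 v2 v3 w1 w2 w3; lra.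
have S2 : n.+1%:R * (6 * (n%:R * h * e2)) = e / 2 * h.
  exact: eps_scale.
have S3 : n%:R ^+ 2 * (n.+1%:R * (n%:R * (fv + hv + gv + (fw + hw + gw)))) -
    n%:R ^+ 2 * (n.+1%:R * (Fv + Hv + Gv + (Fw + Hw + Gw))) <= n%:R ^+ 2 * (e / 2 * h).
  rewrite -S2 -mulrBr -mulrBr; apply: ler_wpM2l; first exact: ltW.
  by apply: ler_wpM2l => //; exact: ltW.
have S4 : Fw + Fv + Hw <= n%:R ^+ 2 * (e / 2 * h).
  apply: (@le_trans _ _ (n%:R * h * (3 * P * M))); first by move: b1 b2 b3; lra.
  have -> : n%:R ^+ 2 * (e / 2 * h) = n%:R * h * (e / 2 * n%:R) by ring.
  by apply: ler_wpM2l => //; rewrite ltW// mulr_gt0.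
have -> : n%:R ^+ 2 * (e * h) = n%:R ^+ 2 * (e / 2 * h) + n%:R ^+ 2 * (e / 2 * h) by field.
by move: key S3 S4; lra.
Qed.

(** A triple for (v, w) that is not one for (v', w') has a change of phase between x + v and x + v',
    or between x + w and x + w'. This equicontinuity makes the limit uniform on compact sets of
    directions. *)
Lemma triple_lip v w v' w' : zeta v w <= zeta v' w' + (P * `|v' - v| + P * `|w' - w|).
Proof.
have ft a b := triple_fin a b mF mH mG FH (diff_le_fin dF).
have mt a b := bset_triple a b mF mH mG.
pose S A (a a' : plane R) := [set x | sdiff A (a' - a) (x + a)].
have mS A a a' : bset A -> bset (S A a a') by move=> mA; apply: bset_shift; exact: bset_sdiff.
have muS A a a' : bset A -> diff_le A P -> (mu (S A a a') <= (P * `|a' - a|)%:E)%E.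
  move=> mA dA; apply: le_trans (dA (a' - a)).
  suff : mu (S A a a') = mu (sdiff A (a' - a)) by move->.
  by apply: mu_shift; exact: bset_sdiff.
rewrite -lee_fin /zeta !EFinD !fineK//.
apply: (le_trans _ (leeD (lexx _) (leeD (muS H v v' mH dH) (muS G w w' mG dG)))).
apply: (le_trans _ (leeD (lexx _) (mu_setU2 (mS H v v' mH) (mS G w w' mG)))).
have mU : bset (S H v v' `|` S G w w') by apply: bsetU; exact: mS.
apply: (le_trans _ (mu_setU2 (mt v' w') mU)).
apply: le_measure; rewrite ?inE.
- exact: mt.
- exact: bsetU.
- move=> x [[Fx Hx] Gx].
  have [Hx'|nH] := pselect (H (x + v')); last first.
    right; left; rewrite /S /sdiff /= => e; apply: nH.
    by move: Hx => /=; rewrite e -addrA subrKC.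
  have [Gx'|nG] := pselect (G (x + w')); first by left.
  right; right; rewrite /S /sdiff /= => e; apply: nG.
  by move: Gx => /=; rewrite e -addrA subrKC.
Qed.

(* o(|v| + |w|): near the scale [dyad k] the quotients dlt(A; v) / |v| no longer
   increase, so that [triple_le] leaves no room for corners. *)
Lemma triple_uniform (M e : R) : 0 < e ->
  \forall k \near \oo, forall v w, `|v| <= M -> `|w| <= M ->
    zeta (dyad k *: v) (dyad k *: w) <= e * dyad k.
Proof.
move=> e0.
pose D : set (plane R) := [set x | `|x| <= M].
have cD : compact D.
  apply: (@plane_compact _ _ (M + 1)).
    apply: (@closed_comp _ _ (fun x : plane R => `|x|) [set t | t <= M]); last exact: closed_le.
    by move=> x _; exact: norm_continuous.
  by move=> x xM; rewrite plane_norm_lt; apply: (le_lt_trans xM); rewrite ltrDl.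
have cK : compact (D `*` D) by exact: compact_setX.
have /compact_near_coveringP/(_ _ (\oo : set_system nat)
    (fun k (p : plane R * plane R) => zeta (dyad k *: p.1) (dyad k *: p.2) <= e * dyad k)) := cK.
have FF : Filter (\oo : set_system nat) by exact: _.
have P0 : 0 <= P.
  have := dlt_le (1, 0) dF; rewrite plane_normE /= normr0 normr1.
  have -> : Num.max 1 0 = 1 :> R by apply/max_idPl.
  by rewrite mulr1; apply: le_trans; exact: dlt_ge0.
case/(_ FF _) => [[v w] [Dv Dw]|].
  have e2 : 0 < e / 2 by rewrite divr_gt0.
  have q0 : 0 < e / 2 / (2 * P + 1) by rewrite !divr_gt0// ltr_wpDl// mulr_ge0.
  exists (ball (v, w) (e / 2 / (2 * P + 1)), [set k | zeta (dyad k *: v) (dyad k *: w) <= e / 2 * dyad k]).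
    split; first exact: nbhsx_ballx.
    exact: triple_limit.
  move=> [[v' w'] k] [[/= vv' ww'] zk].
  apply: (le_trans (triple_lip _ _ (dyad k *: v) (dyad k *: w))).
  have h0 := dyad_gt0 k.
  rewrite -!scalerBr !normrZ (gtr0_norm h0).
  move: vv' ww'; rewrite -!ball_normE /=; set q := _ / (_ + 1) in q0 * => vq wq.
  have E : q * (2 * P + 1) = e / 2 by rewrite /q divfK// gt_eqF// ltr_wpDl// mulr_ge0.
  have h1 : P * (dyad k * `|v - v'|) <= P * q * dyad k.
    by rewrite mulrCA mulrC; apply: ler_wpM2r; [exact: ltW|apply: ler_wpM2l => //; exact: ltW].
  have h2 : P * (dyad k * `|w - w'|) <= P * q * dyad k.
    by rewrite mulrCA mulrC; apply: ler_wpM2r; [exact: ltW|apply: ler_wpM2l => //; exact: ltW].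
  apply: (le_trans (lerD zk (lerD h1 h2))).
  have -> : e / 2 * dyad k + (P * q * dyad k + P * q * dyad k) = (e / 2 + 2 * P * q) * dyad k by ring.
  apply: ler_wpM2r; first exact: ltW.
  by move: E q0; lra.
by move=> N _ HN; exists N => // k Nk v w vM wM; exact: (HN k Nk (v, w)).
Qed.

End uniform.

End three_phases.

(** * Extension of sets *)

Section collar.
Context {R : realType}.
Implicit Types (x y z v w : plane R) (A F G H : set (plane R)).
Variables (E Om : set (plane R)) (P eps delta : R).
Hypotheses (mE : bset E) (vE : varle \1_E setT P) .
Hypotheses (eps0 : 0 < eps) (delta0 : 0 < delta).
Hypothesis densC : forall z r, 0 < r <= delta -> ~ Om z ->
  ((eps * r ^+ 2)%:E <= mu (~` E `&` ball z r))%E.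

Definition collar (h : R) : set (plane R) := \bigcup_(z in ~` Om) ball z h.

Lemma open_collar h : open (collar h).
Proof. by apply: bigcup_open => z _; exact: ball_open. Qed.

Lemma mu_le A B : bset A -> bset B -> A `<=` B -> (mu A <= mu B)%E.
Proof. by move=> mA mB AB; apply: le_measure; rewrite ?inE. Qed.

Lemma diff_le_E : diff_le E (2 * P).
Proof.
move=> y; have := @translation_set _ E setT setT P y mE vE openT (fun _ _ _ _ => I).
by rewrite setTI mulrAC.
Qed.

Lemma sdiffC A y : sdiff (~` A) y = sdiff A y.
Proof.
apply/seteqP; split=> x; rewrite /sdiff /= => n e; apply: n; first by rewrite e.
apply/propext; split=> a; apply: contrapT => b.
  by move: b; rewrite -e; apply.
by move: b; rewrite e; apply.
Qed.

(** A point of the collar is within h of a point outside [Om], so the complement of [E] has mass at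
    least eps h^2 in its 2h-ball. Averaging the hypothesis over |w| < 2h gives eps h^2 mu X <= M (4
    h)^2. *)
Lemma collar_mass X (M h : R) : bset X -> 0 < h <= delta -> X `<=` collar h -> 0 <= M ->
  (forall w, `|w| <= 2 * h -> (mu (X `&` [set x | (~` E) (x + w)%R]) <= M%:E)%E) ->
  (mu X <= (16 / eps * M)%:E)%E.
Proof.
move=> mX hd XD M0 XM; have /andP[h0 _] := hd.
have mC := bsetC mE.
have h20 : 0 <= 2 * h by rewrite mulr_ge0// ltW.
have T : (\int[mu]_(x in X) mu (~` E `&` ball x (2 * h)) <= M%:E * ((2 * (2 * h)) ^+ 2)%:E)%E.
  apply: tonelli_ball => // w; rewrite plane_norm_lt => wh; apply: XM; exact: ltW.
have e0 : 0 < eps * h ^+ 2 by rewrite mulr_gt0// exprn_gt0.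
have L : ((eps * h ^+ 2)%:E * mu X <= \int[mu]_(x in X) mu (~` E `&` ball x (2 * h)))%E.
  have -> : ((eps * h ^+ 2)%:E * mu X = \int[mu]_(x in X) cst (eps * h ^+ 2)%:E x)%E.
    by rewrite integral_cst.
  apply: ge0_le_integral.
  - exact: mX.
  - by move=> x _; rewrite lee_fin ltW.
  - exact: measurable_cst.
  - by apply: measurable_funTS; exact: measurable_ball_mass.
  - move=> x /XD[z nz zx]; apply: (le_trans (densC hd nz)); apply: mu_le.
    + by apply: bsetI => //; exact: bset_ball.
    + by apply: bsetI => //; exact: bset_ball.
    + move=> y [nE zy]; split => //; have -> : 2 * h = h + h by ring.
      by apply: ball_triangle zy; exact: ball_sym.
have := le_trans L T; rewrite -EFinM -lee_pdivlMl// => /le_trans; apply.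
rewrite -EFinM lee_fin le_eqVlt; apply/orP; left; apply/eqP; field.
by apply/andP; split; rewrite gt_eqF.
Qed.

(** The bound is linear in [h]: it makes the crude translation estimate for [F] possible, and later
    shows that [E] has no mass outside [Om]. *)
Lemma collar_E h : 0 < h <= delta -> (mu (E `&` collar h) <= (16 / eps * (2 * P * (2 * h)))%:E)%E.
Proof.
move=> hd; have P0 := varle_ge0 vE; have /andP[h0 _] := hd.
have mD : bset (collar h) by apply: bset_open; exact: open_collar.
apply: (collar_mass _ hd).
- exact: bsetI.
- by move=> x [].
- by rewrite !mulr_ge0// ltW.
move=> w wh; apply: (@le_trans _ _ (2 * P * `|w|)%:E); last first.
  by rewrite lee_fin; apply: ler_wpM2l => //; rewrite mulr_ge0.
apply: le_trans (diff_le_E w); apply: mu_le.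
- by apply: bsetI; [exact: bsetI|apply: bset_shift; exact: bsetC].
- exact: bset_sdiff.
- by move=> x [[Ex _] nE] e; apply: nE; rewrite -e.
Qed.

(** The 3/2 r leaves r for the segment of a translation and r / 2 for taking the interior, which
    together stay within the collar width 2 r of [innerP]. *)
Definition inner (r : R) : set (plane R) := [set x | ball x (3 / 2 * r) `<=` Om]^°.

Lemma innerP x r : 0 < r -> ~ collar (2 * r) x -> inner r x.
Proof.
move=> r0 nD; apply/nbhs_ballP; exists (r / 2) => /=; first by rewrite divr_gt0.
move=> y xy z yz; apply: contrapT => nz; apply: nD; exists z => //.
apply: ball_sym; have -> : 2 * r = r / 2 + 3 / 2 * r by field.
exact: ball_triangle xy yz.
Qed.

Lemma inner_translate F (p r : R) w : bset F -> varle \1_F Om p -> 0 < r -> `|w| <= r ->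
  (mu (inner r `&` sdiff F w) <= (2 * r * p)%:E)%E.
Proof.
move=> mF vF r0 wr; have p0 := varle_ge0 vF.
apply: (@le_trans _ _ (2 * `|w| * p)%:E).
  apply: (translation_set mF vF); first exact: open_interior.
  move=> x s /interior_subset/= xO /andP[s0 s1]; apply: xO.
  rewrite -ball_normE /= opprD addNKr normrN normrZ (ger0_norm s0).
  by have := normr_ge0 w; nra.
by rewrite lee_fin; apply: ler_wpM2r => //; apply: ler_wpM2l.
Qed.

Section set.
Variables (F : set (plane R)) (p rho : R) (z0 : plane R).
Hypotheses (mF : bset F) (FE : F `<=` E) (vF : varle \1_F Om p).
Hypotheses (Fz : F `<=` ball z0 rho).
Let H := E `\` F.
Let p0 := varle_ge0 vF.
Let P0 := varle_ge0 vE.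
Let mH : bset H := bsetD mE mF.

(** The pairs x, x + w with one point in each of the two phases inside [E]; their measure controls
    the gradient of the interpolated density ratios. *)
Definition cross w : set (plane R) := F `&` [set x | (E `\` F) (x + w)].

Lemma bset_cross w : bset (cross w).
Proof. by apply: bsetI => //; exact: bset_shift. Qed.

Lemma cross_le r w : 0 < r -> `|w| <= r ->
  (mu (cross w) <= (2 * r * p)%:E + mu (cross w `&` collar (2 * r)))%E.
Proof.
move=> r0 wr.
have mD : bset (collar (2 * r)) by apply: bset_open; exact: open_collar.
have mI : bset (inner r `&` sdiff F w).
  by apply: bsetI; [apply: bset_open; exact: open_interior|exact: bset_sdiff].
have mX := bset_cross w.
apply: (le_trans _ (leeD (inner_translate mF vF r0 wr) (lexx _))).
apply: (le_trans _ (mu_setU2 mI (bsetI mX mD))).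
apply: mu_le => //; first by apply: bsetU => //; exact: bsetI.
move=> x Xx; have [Dx|nDx] := pselect (collar (2 * r) x); first by right.
left; split; first exact: innerP.
by case: Xx => Fx [_ nF] e; apply: nF; rewrite -e.
Qed.

(** The terms come from the translation of [E], from pairs with segment in [Om], from pairs in the
    collar, and, when 2 |w| > delta, from the area of a ball containing [F]. *)
Let c1 := 2 * P + 2 * p + 16 / eps * (2 * P * 4) + 8 * `|rho| ^+ 2 / delta.

(** A first, crude bound: it says that [F] has finite perimeter in the plane, but its constant
    involves [P] and is not a multiple of [p]. It suffices for the hypotheses of [triple_uniform],
    which then gives the sharp estimate. *)
Lemma leave_le w : (mu (F `&` [set x | (~` F) (x + w)%R]) <= (c1 * `|w|)%:E)%E.
Proof.
have [->|w0] := eqVneq w 0.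
  rewrite normr0 mulr0 (_ : _ `&` _ = set0) ?measure0//.
  by apply/seteqP; split=> // x [Fx]; rewrite /= addr0 => /(_ Fx).
have r0 : 0 < `|w| by rewrite normr_gt0.
have mC : bset (F `&` [set x | (~` F) (x + w)]).
  by apply: bsetI => //; apply: bset_shift; exact: bsetC.
have t1 : 0 <= 16 / eps * (2 * P * 4) by rewrite mulr_ge0 ?divr_ge0 ?mulr_ge0// ltW.
have t2 : 0 <= 8 * `|rho| ^+ 2 / delta by rewrite divr_ge0 ?mulr_ge0 ?sqr_ge0// ltW.
have [wd|wd] := leP (2 * `|w|) delta; last first.
  apply: (@le_trans _ _ (mu (ball z0 `|rho|))).
    apply: mu_le => //; first exact: bset_ball.
    by move=> x [/Fz zx _]; apply: le_ball zx; exact: ler_norm.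
  suff : (((2 * `|rho|) ^+ 2)%:E <= (c1 * `|w|)%:E)%E.
    by apply: le_trans; rewrite le_eqVlt; apply/orP; left; apply/eqP; exact: mu_ball.
  rewrite lee_fin; apply: (@le_trans _ _ (8 * `|rho| ^+ 2 / delta * `|w|)).
    rewrite mulrAC ler_pdivlMr// exprMn.
    by have := sqr_ge0 `|rho|; nra.
  by apply: ler_wpM2r; [exact: ltW|rewrite /c1 lerDr !addr_ge0// mulr_ge0].
have hd : 0 < 2 * `|w| <= delta by rewrite mulr_gt0.
have mX := bset_cross w.
have mD : bset (collar (2 * `|w|)) by apply: bset_open; exact: open_collar.
apply: (@le_trans _ _ (mu (sdiff E w `|` cross w))).
  apply: mu_le => //; first by apply: bsetU => //; exact: bset_sdiff.
  move=> x [Fx /= nF]; have [Ew|nEw] := pselect (E (x + w)); first by right; split.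
  by left => e; apply: nEw; rewrite -e; exact: FE.
apply: (le_trans (mu_setU2 (bset_sdiff w mE) mX)).
have XE : (mu (cross w `&` collar (2 * `|w|)) <= (16 / eps * (2 * P * (2 * (2 * `|w|))))%:E)%E.
  apply: le_trans (collar_E hd); apply: mu_le; [exact: bsetI|exact: bsetI|].
  by move=> x [[/FE]].
apply: (le_trans (leeD (diff_le_E w) (le_trans (cross_le r0 (lexx _)) (leeD (lexx _) XE)))).
rewrite -!EFinD lee_fin.
have -> : 2 * P * `|w| + (2 * `|w| * p + 16 / eps * (2 * P * (2 * (2 * `|w|)))) =
  (2 * P + 2 * p + 16 / eps * (2 * P * 4)) * `|w| by ring.
by apply: ler_wpM2r; [exact: ltW|rewrite /c1 lerDl].
Qed.

Lemma diff_le_F : exists c, diff_le F c.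
Proof.
exists (2 * c1) => w.
have mC y : bset (F `&` [set x | (~` F) (x + y)]).
  by apply: bsetI => //; apply: bset_shift; exact: bsetC.
pose S := [set x | (F `&` [set x | (~` F) (x + (- w))]) (x + w)].
have mS : bset S by exact: bset_shift.
have muS : (mu S <= (c1 * `|w|)%:E)%E.
  rewrite -[in leRHS](normrN w); apply: le_trans (leave_le (- w)).
  suff : mu S = mu (F `&` [set x | (~` F) (x + (- w))]) by move->.
  exact: mu_shift.
have -> : (2 * c1 * `|w|)%:E = ((c1 * `|w|)%:E + (c1 * `|w|)%:E)%E by rewrite -EFinD; congr EFin; ring.
apply: (le_trans _ (leeD (leave_le w) muS)); apply: (le_trans _ (mu_setU2 (mC w) mS)).
apply: mu_le; [exact: bset_sdiff|exact: bsetU|].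
rewrite sdiffE => x [[Fx nF]|[Fw nF]]; [by left|right].
by split => //=; rewrite addrK.
Qed.

(* A pair x, x + w whose segment may leave Om comes with a third point, in the
   complement of E, and such triples are controlled by [triple_uniform]. *)
Lemma cross_small (M eta : R) : 0 < M -> 0 < eta ->
  \forall k \near \oo, forall w, `|w| <= M * dyad k ->
    (mu (cross w) <= ((2 * M * p + eta) * dyad k)%:E)%E.
Proof.
move=> M0 eta0; have [c dF] := diff_le_F.
pose Q := 2 * P + `|c|; have mC := bsetC mE.
have P2 : 0 <= 2 * P by rewrite mulr_ge0.
have dE' : diff_le (~` E) Q.
  move=> y; rewrite sdiffC; apply: (le_trans (diff_le_E y)); rewrite lee_fin.
  by apply: ler_wpM2r => //; rewrite /Q lerDl.
have dF' : diff_le F Q.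
  move=> y; apply: (le_trans (dF y)); rewrite lee_fin; apply: ler_wpM2r => //.
  by rewrite /Q (le_trans (ler_norm c))// lerDr.
have dH' : diff_le H Q.
  move=> y; rewrite /Q mulrDl EFinD.
  apply: (le_trans _ (leeD (diff_le_E y) (_ : (mu (sdiff F y) <= _)%E))); last first.
    apply: (le_trans (dF y)); rewrite lee_fin; apply: ler_wpM2r => //; exact: ler_norm.
  apply: (le_trans _ (mu_setU2 (bset_sdiff y mE) (bset_sdiff y mF))).
  apply: mu_le; [exact: bset_sdiff|by apply: bsetU; exact: bset_sdiff|].
  move=> x; rewrite /sdiff /= => n.
  have [e|] := pselect (E x = E (x + y)); last by left.
  by right => e'; apply: n; rewrite /H /setD /mkset e e'.
have FH : F `&` H = set0 by rewrite /H setDE setIC -setIA setICl setI0.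
have FG : F `&` ~` E = set0 by apply/seteqP; split=> // x [/FE].
have HG : H `&` ~` E = set0 by apply/seteqP; split=> // x [[]].
(* [collar_mass] multiplies the measure of the triples by 16 / eps. *)
pose e := eta * eps / 16; have e0 : 0 < e by rewrite divr_gt0// mulr_gt0.
have M40 : 0 < 4 * M by rewrite mulr_gt0.
(* With r = M dyad k the collar has width 2 r, and [collar_mass] uses translations of length up to 4
   r; hence the range 4 M. *)
have U := triple_uniform mF mH mC FH FG HG dF' dH' dE' (4 * M) e0.
have dd0 : 0 < delta / (2 * M) by rewrite divr_gt0// mulr_gt0.
have S : \forall k \near \oo, dyad k < delta / (2 * M) :> R.
  have : (2^-1 : R) ^+ n @[n --> \oo] --> 0 by apply: cvg_expr; rewrite gtr0_norm; lra.
  move=> /cvgrPdist_lt/(_ _ dd0); apply: filterS => k.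
  by rewrite sub0r normrN gtr0_norm ?dyad_gt0.
apply: filterS2 U S => k U kd w wM.
have h0 : 0 < dyad k :> R := dyad_gt0 k.
pose r := M * dyad k; have r0 : 0 < r by rewrite mulr_gt0.
have hd : 0 < 2 * r <= delta.
  rewrite mulr_gt0//= /r mulrA; move: kd; rewrite ltr_pdivlMr ?mulr_gt0// mulrC; exact: ltW.
apply: (le_trans (cross_le r0 wM)).
have mD : bset (collar (2 * r)) by apply: bset_open; exact: open_collar.
have mX := bset_cross w.
have XE : (mu (cross w `&` collar (2 * r)) <= (16 / eps * (e * dyad k))%:E)%E.
  apply: (collar_mass _ hd).
  - exact: bsetI.
  - by move=> x [].
  - by rewrite mulr_ge0// ltW.
  move=> w' w'r.
  have fin := triple_fin w w' mF mH mC FH (diff_le_fin dF').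
  apply: (@le_trans _ _ (mu (triple F H (~` E) w w'))).
    apply: mu_le.
    + by apply: bsetI; [exact: bsetI|exact: bset_shift].
    + exact: bset_triple.
    + by move=> x [[Xx _] nE].
  rewrite -(fineK fin) lee_fin.
  have sc (y : plane R) : y = dyad k *: ((dyad k)^-1 *: y).
    by rewrite scalerA mulfV ?gt_eqF// scale1r.
  rewrite (sc w) (sc w'); apply: U.
    rewrite normrZ gtr0_norm ?invr_gt0// ler_pdivrMl// mulrC; apply: (le_trans wM).
    by apply: ler_wpM2r; [exact: ltW|move: M0; lra].
  rewrite normrZ gtr0_norm ?invr_gt0// ler_pdivrMl// mulrC; apply: (le_trans w'r).
  by rewrite /r le_eqVlt; apply/orP; left; apply/eqP; ring.
apply: (le_trans (leeD (lexx _) XE)); rewrite -EFinD lee_fin.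
rewrite le_eqVlt; apply/orP; left; apply/eqP; rewrite /r /e; field.
by rewrite gt_eqF.
Qed.

End set.

End collar.

(** * Density ratios on a grid *)

Section grid_average.
Context {R : realType}.
Implicit Types (x y z v w : plane R) (A F G H : set (plane R)).

Lemma tonelli_weight F (q : plane R -> \bar R) (r : R) : bset F -> 0 <= r ->
  measurable_fun setT (q : mplane R -> \bar R) -> (forall x, 0 <= q x)%E ->
  measurable_fun setT ((fun y => \int[mu]_(x in F `&` ball y r) q x)%E : mplane R -> \bar R) /\
  (\int[mu]_y \int[mu]_(x in F `&` ball y r) q x =
   \int[mu]_(x in F) (q x * ((2 * r) ^+ 2)%:E))%E.
Proof.
move=> mF r0 mq q0.
pose Z : set (plane R * plane R) := [set p | F p.2 /\ ball (0 : plane R) r (p.2 - p.1)].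
have mZ : measurable (Z : set (mplane R * mplane R)).
  have -> : Z = (snd @^-1` F) `&` ((fun p => p.2 - p.1) @^-1` (ball (0 : plane R) r)) by [].
  apply: measurableI.
    by rewrite -[X in measurable X]setTI; exact: (@measurable_snd _ _ (mplane R) (mplane R)).
  have ma : measurable_fun setT ((fun p => p.2 - p.1) : mplane R * mplane R -> mplane R).
    apply: (@measurable_fun_pair _ _ _ (mplane R * mplane R)%type (measurableTypeR R)
      (measurableTypeR R) (fun p => p.2.1 - p.1.1) (fun p => p.2.2 - p.1.2)).
      apply: (@measurable_funB _ (mplane R * mplane R)%type R setT (fst \o snd) (fst \o fst)).
        by apply: measurableT_comp; [exact: measurable_fst|exact: measurable_snd].
      by apply: measurableT_comp; exact: measurable_fst.
    apply: (@measurable_funB _ (mplane R * mplane R)%type R setT (snd \o snd) (snd \o fst)).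
      by apply: measurableT_comp; exact: measurable_snd.
    by apply: measurableT_comp; [exact: measurable_snd|exact: measurable_fst].
  by rewrite -[X in measurable X]setTI; apply: ma => //; exact: bset_ball.
have ZE y x : Z (y, x) <-> F x /\ ball y r x.
  by rewrite /Z /= -(ball_addr y) subrK.
pose f (p : mplane R * mplane R) : \bar R := (q p.2 * (\1_Z p)%:E)%E.
have mf : measurable_fun setT f.
  apply: emeasurable_funM.
    by apply: (measurableT_comp mq); exact: measurable_snd.
  by apply/measurable_EFinP; exact: measurable_indic.
have f0 p : (0 <= f p)%E by rewrite mule_ge0// lee_fin.
have FT := @fubini_tonelli _ _ (mplane R) (mplane R) R mu mu f mf f0.
have E1 y : (\int[mu]_(x in F `&` ball y r) q x = \int[mu]_x f (y, x))%E.
  rewrite integral_mkcond; apply: eq_integral => x _.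
  rewrite patchE /f /= indicE; have [h|h] := pselect ((F `&` ball y r) x).
    by rewrite (mem_set h) (mem_set (proj2 (ZE y x) h)) mule1.
  have nZ : ~ Z (y, x) by move=> z; exact: (h (proj1 (ZE y x) z)).
  by rewrite (memNset h) (memNset nZ) mule0.
split.
  have -> : (fun y => \int[mu]_(x in F `&` ball y r) q x)%E = fubini_F mu f.
    by apply/funext => y; exact: E1.
  exact: (@measurable_fun_fubini_tonelli_F _ _ (mplane R) (mplane R) R mu f mf f0).
transitivity (\int[mu]_y \int[mu]_x f (y, x))%E.
  by apply: eq_integral => y _; exact: E1.
rewrite FT [RHS]integral_mkcond; apply: eq_integral => x _.
have mb : bset (ball x r) by exact: bset_ball.
rewrite patchE; have [Fx|nFx] := pselect (F x).
  rewrite (mem_set Fx).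
  transitivity (\int[mu]_y (q x * (\1_(ball x r) y)%:E))%E.
    apply: eq_integral => y _; rewrite /f /= !indicE.
    have [h|h] := pselect (ball x r y).
      have hZ : Z (y, x) by exact: (proj2 (ZE y x) (conj Fx (ball_sym h))).
      by rewrite (mem_set h) (mem_set hZ).
    have nZ : ~ Z (y, x) by move=> z; exact: (h (ball_sym (proj1 (ZE y x) z).2)).
    by rewrite (memNset h) (memNset nZ).
  have m1 : measurable_fun setT ((fun y => (\1_(ball x r) y)%:E) : mplane R -> \bar R).
    by apply/measurable_EFinP; exact: bfun_indic.
  have p1 y : setT y -> (0 <= (\1_(ball x r) y)%:E :> \bar R)%E.
    by move=> _; rewrite lee_fin.
  rewrite (ge0_integralZl _ measurableT m1 p1 (q0 x)); congr (q x * _)%E.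
  by rewrite (integral_indic _ measurableT mb) setIT; exact: mu_ball.
rewrite (memNset nFx); under eq_integral => y _.
  have nZ : ~ Z (y, x) by move=> z; exact: (nFx (proj1 (ZE y x) z).1).
  rewrite /f /= indicE (memNset nZ) mule0.
  over.
by rewrite integral0.
Qed.

Lemma frac_le (a b a' b0 : R) : 0 <= a -> a <= a' -> 0 < b0 -> b0 <= b -> a / b <= a' / b0.
Proof.
move=> a0 aa b00 bb; have b1 : 0 < b by exact: lt_le_trans bb.
apply: ler_pM => //; first by rewrite invr_ge0 ltW.
by rewrite lef_pV2.
Qed.

(** The numerator of the difference is [a c' - a' c], small as soon as either phase is scarce. The
    product [a' c'] is what turns the gradient bound into a count of pairs of points in different
    phases. *)
Lemma ratio_diff (a c a' c' b0 : R) : 0 <= a <= a' -> 0 <= c <= c' -> 0 < b0 -> b0 <= a + c ->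
  `|a / (a + c) - a' / (a' + c')| <= a' * c' / b0 ^+ 2.
Proof.
move=> /andP[a0 aa] /andP[c0 cc] b00 b0b.
have b1 : 0 < a + c by exact: lt_le_trans b0b.
have bb : a + c <= a' + c' by exact: lerD.
have b1' : 0 < a' + c' by exact: lt_le_trans bb.
have -> : a / (a + c) - a' / (a' + c') = (a * c' - a' * c) / ((a + c) * (a' + c')).
  by field; apply/andP; split; rewrite gt_eqF.
rewrite normrM [X in _ * X]gtr0_norm ?invr_gt0 ?mulr_gt0//.
apply: ler_pM; [exact: normr_ge0|by rewrite invr_ge0 ltW ?mulr_gt0| |].
  have h1 : 0 <= a * c' by rewrite mulr_ge0// (le_trans c0).
  have h2 : 0 <= a' * c by rewrite mulr_ge0// (le_trans a0).
  have h3 : a * c' <= a' * c' by rewrite ler_wpM2r// (le_trans c0).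
  have h4 : a' * c <= a' * c' by rewrite ler_wpM2l// (le_trans a0).
  by rewrite ler_norml; apply/andP; split; move: h1 h2 h3 h4; lra.
rewrite lef_pV2 ?posrE ?mulr_gt0 ?exprn_gt0//.
by rewrite expr2; apply: ler_pM; [exact: ltW|exact: ltW|exact: b0b|exact: le_trans b0b bb].
Qed.

Section pointwise.
Variables (E F : set (plane R)) (eps delta h : R) (N : nat).
Hypotheses (oE : open E) (mF : bset F) (FE : F `<=` E).
Hypotheses (eps0 : 0 < eps) (h0 : 0 < h) (hd : 8 * h <= delta).
Hypothesis densE : forall z r, 0 < r <= delta -> (0 < mu (E `&` ball z (r / 2)))%E ->
  ((eps * r ^+ 2)%:E <= mu (E `&` ball z r))%E.
Let H := E `\` F.
Let mE : bset E := bset_open oE.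
Let mH : bset H := bsetD mE mF.

Definition mass A z (r : R) : R := fine (mu (A `&` ball z r)).

Lemma massE A z r : bset A -> mu (A `&` ball z r) = (mass A z r)%:E.
Proof. by move=> mA; rewrite /mass fineK//; exact: ball_fin. Qed.

Lemma mass_ge0 A z r : 0 <= mass A z r.
Proof. by apply: fine_ge0; exact: measure_ge0. Qed.

Lemma mass_le A B z y r s : bset A -> bset B -> A `<=` B -> ball z r `<=` ball y s ->
  mass A z r <= mass B y s.
Proof.
move=> mA mB AB zy; apply: (fine_le (ball_fin z r mA) (ball_fin y s mB)); apply: mu_le.
- by apply: bsetI => //; exact: bset_ball.
- by apply: bsetI => //; exact: bset_ball.
- by move=> x [/AB Bx /zy].
Qed.

Lemma massD z r : mass E z r = mass F z r + mass H z r.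
Proof.
apply: EFin_inj.
suff : (mu (E `&` ball z r) = mu (F `&` ball z r) + mu (H `&` ball z r))%E.
  by rewrite (massE z r mE) (massE z r mF) (massE z r mH).
have mb : bset (ball z r) by exact: bset_ball.
transitivity (mu ((F `&` ball z r) `|` (H `&` ball z r))).
  congr (mu _); apply/seteqP; split=> x; last by move=> [[/FE Ex zx]|[[Ex _] zx]].
  by move=> [Ex zx]; have [Fx|nF] := pselect (F x); [left|right].
apply: measureU; [exact: bsetI|exact: bsetI|].
by apply/seteqP; split=> // x [[Fx _] [[_ nF] _]]; exact: nF.
Qed.

(** The radius 8h exceeds the reach of a hat: if a point of the open set E lies within 2h of the
    node, E has mass in the ball of half the radius, 4h, and [densE] bounds the denominator below.
    At a node without mass of E the quotient is 0, by division by zero. *)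
Definition density_ratio (i j : nat) : R := mass F (node N h i j) (8 * h) / mass E (node N h i j) (8 * h).

Lemma density_ratio_ge0 i j : 0 <= density_ratio i j.
Proof. by rewrite divr_ge0// mass_ge0. Qed.

Lemma density_ratio_le1 i j : density_ratio i j <= 1.
Proof.
rewrite /density_ratio; have := mass_ge0 E (node N h i j) (8 * h).
rewrite le_eqVlt => /orP[/eqP <-|b0]; first by rewrite invr0 mulr0.
by rewrite ler_pdivrMr// mul1r massD lerDl mass_ge0.
Qed.

Let b0 := eps * (8 * h) ^+ 2.

Lemma b0_gt0 : 0 < b0.
Proof. by rewrite mulr_gt0// exprn_gt0// mulr_gt0. Qed.

Lemma near_node y i j : E y -> ball (node N h i j) (2 * h) y ->
  [/\ b0 <= mass E (node N h i j) (8 * h),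
      mass F (node N h i j) (8 * h) <= mass F y (10 * h) &
      mass H (node N h i j) (8 * h) <= mass H y (10 * h)].
Proof.
move=> Ey ny.
have sub : ball (node N h i j) (8 * h) `<=` ball y (10 * h).
  move=> x nx; have -> : 10 * h = 2 * h + 8 * h by ring.
  by apply: ball_triangle nx; exact: ball_sym.
split; last 2 first.
- exact: mass_le.
- exact: mass_le.
rewrite -lee_fin -(massE _ _ mE); apply: densE; first by rewrite hd mulr_gt0.
have [q /= q0 qE] : exists2 q : R, 0 < q & ball y q `<=` E `&` ball y h.
  have /nbhs_ballP[q /= q0 qE] := open_nbhs_nbhs (conj oE Ey).
  exists (Num.min q h); first by rewrite lt_min q0.
  move=> x; move=> xq; split; first by apply: qE; apply: le_ball xq; rewrite ge_min lexx.
  by apply: le_ball xq; rewrite ge_min lexx orbT.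
apply: (@lt_le_trans _ _ (mu (ball y q))).
  suff : (0 < ((2 * q) ^+ 2)%:E :> \bar R)%E.
    by move/lt_le_trans; apply; rewrite le_eqVlt; apply/orP; left; apply/eqP/esym/mu_ball/ltW.
  by rewrite lte_fin exprn_gt0// mulr_gt0.
apply: mu_le; first exact: bset_ball.
  by apply: bsetI => //; exact: bset_ball.
move=> x /qE[Ex yx]; split => //.
have -> : 8 * h / 2 = 2 * h + 2 * h by field.
apply: ball_triangle ny _; apply: le_ball yx; by move: h0; lra.
Qed.

(** [grid_derive] with [c0] the ratio of the masses in the 10h-ball around [y] itself, which
    contains the 8h-balls of the at most 16 nodes within 2h of [y]. *)
Lemma grid_derive_le y v : E y -> `|y| < N%:R * h ->
  `|'D_v (grid N h density_ratio) y| <= 8 / h * `|v| * (16 * (mass F y (10 * h) * mass H y (10 * h) / b0 ^+ 2)).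
Proof.
move=> Ey yN; set a' := mass F y _; set c' := mass H y _.
apply: (le_trans (grid_derive _ (a' / (a' + c')) _ h0 yN)).
apply: ler_wpM2l; first by rewrite mulr_ge0// divr_ge0// ltW.
have a0 : 0 <= a' by exact: mass_ge0.
have c0 : 0 <= c' by exact: mass_ge0.
have q0 : 0 <= a' * c' / b0 ^+ 2 by exact: (divr_ge0 (mulr_ge0 a0 c0) (sqr_ge0 b0)).
apply: (@le_trans _ _ ((\sum_(i < (2 * N).+1) \sum_(j < (2 * N).+1)
    \1_(ball (node N h i j) (2 * h)) y) * (a' * c' / b0 ^+ 2))); last first.
  by apply: ler_wpM2r => //; exact: (count_nodes N y 2 h0).
rewrite mulr_suml; apply: ler_sum => i _; rewrite mulr_suml; apply: ler_sum => j _.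
have [ny|ny] := pselect (ball (node N h i j) (2 * h) y); last by rewrite (indic0 ny) !mul0r.
rewrite (indic1 ny) !mul1r /density_ratio.
have [b0b aa cc] := near_node Ey ny.
have aa' := introT andP (conj (mass_ge0 F (node N h i j) (8 * h)) aa).
have cc' := introT andP (conj (mass_ge0 H (node N h i j) (8 * h)) cc).
rewrite massD in b0b *; exact: (ratio_diff aa' cc' b0_gt0 b0b).
Qed.

(** The distance of a nodal value from 0 or 1 is measured by the mass of the other phase near [y];
    averaged over the nodes, this yields the convergence to the indicator of [F]. *)
Lemma density_ratio_near y i j : E y -> ball (node N h i j) h y ->
  density_ratio i j <= mass F y (10 * h) / b0 /\ 1 - density_ratio i j <= mass H y (10 * h) / b0.
Proof.
move=> Ey ny; have ny2 : ball (node N h i j) (2 * h) y by apply: le_ball ny; move: h0; lra.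
have [b0b aa cc] := near_node Ey ny2.
have b00 := b0_gt0.
have b1 : 0 < mass E (node N h i j) (8 * h) by exact: lt_le_trans b0b.
rewrite /density_ratio; split.
  exact: frac_le (mass_ge0 _ _ _) _ b00 b0b.
rewrite [X in X - _](_ : 1 = mass E (node N h i j) (8 * h) / mass E (node N h i j) (8 * h)); last first.
  by rewrite mulfV// gt_eqF.
rewrite -mulrBl [X in X - _]massD addrC addKr.
exact: frac_le (mass_ge0 _ _ _) _ b00 b0b.
Qed.

Lemma grid_le_mass y : E y -> grid N h density_ratio y <= mass F y (10 * h) / b0.
Proof.
move=> Ey; set q := _ / b0; have q0 : 0 <= q by rewrite divr_ge0 ?mass_ge0// ltW// b0_gt0.
apply: (@le_trans _ _ ((\sum_(i < (2 * N).+1) \sum_(j < (2 * N).+1) hat2 N h i j y) * q)); last first.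
  by rewrite ler_piMl//; exact: sum_hat2_le1.
rewrite /grid mulr_suml; apply: ler_sum => i _; rewrite mulr_suml; apply: ler_sum => j _.
have [ny|ny] := pselect (ball (node N h i j) h y); last by rewrite hat2_out// mulr0 mul0r.
by rewrite mulrC; apply: (ler_wpM2l (hat2_ge0 N h i j y)); exact: (density_ratio_near Ey ny).1.
Qed.

Lemma grid_ge_mass y : E y -> `|y| <= N%:R * h -> 1 - grid N h density_ratio y <= mass H y (10 * h) / b0.
Proof.
move=> Ey yN; set q := _ / b0; have q0 : 0 <= q by rewrite divr_ge0 ?mass_ge0// ltW// b0_gt0.
rewrite -[X in X - _](sum_hat2 h0 yN).
apply: (@le_trans _ _ ((\sum_(i < (2 * N).+1) \sum_(j < (2 * N).+1) hat2 N h i j y) * q)); last first.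
  by rewrite ler_piMl//; exact: sum_hat2_le1.
rewrite /grid -sumrB mulr_suml; apply: ler_sum => i _; rewrite -sumrB mulr_suml; apply: ler_sum => j _.
have [ny|ny] := pselect (ball (node N h i j) h y); last by rewrite hat2_out// mulr0 mul0r subr0.
rewrite -[X in X - _]mul1r -mulrBl mulrC; apply: ler_wpM2l; first exact: hat2_ge0.
by case: (density_ratio_near Ey ny).
Qed.

Lemma grid_supp (rho : R) z y : F `<=` ball z rho -> grid N h density_ratio y != 0 -> ball z (rho + 9 * h) y.
Proof.
move=> Fz gy.
have [i [j /andP[pij hij]]] : exists i j, (density_ratio i j != 0) && (hat2 N h i j y != 0).
  apply: contrapT => nex; move/negP: gy; apply; apply/eqP.
  rewrite /grid big1// => i _; rewrite big1// => j _.
  have [->|pij] := eqVneq (density_ratio i j) 0; first by rewrite mul0r.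
  have [->|hij] := eqVneq (hat2 N h i j y) 0; first by rewrite mulr0.
  by exfalso; apply: nex; exists (i : nat), (j : nat); rewrite pij hij.
have ny : ball (node N h i j) h y.
  by apply: contrapT => ny; move/negP: hij; apply; apply/eqP; exact: hat2_out.
have [x [Fx nx]] : exists x, (F `&` ball (node N h i j) (8 * h)) x.
  apply: contrapT => nex; move/negP: pij; apply; apply/eqP.
  suff -> : density_ratio i j = 0 by [].
  rewrite /density_ratio /mass (_ : F `&` _ = set0) ?measure0 ?mul0r//.
  by apply/seteqP; split=> // x Fx; apply: nex; exists x.
have -> : rho + 9 * h = rho + (8 * h + h) by ring.
apply: ball_triangle (Fz _ Fx) _.
by apply: ball_triangle (ball_sym nx) ny.
Qed.

End pointwise.

End grid_average.

(** * Passage to the limit for one set *)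

Section extension.
Context {R : realType}.
Implicit Types (x y z v w : plane R) (A F G H : set (plane R)).
Variables (E : set (plane R)) (P K eps delta : R).
Hypotheses (oE : open E) (vE : varle \1_E setT P) (K0 : 0 <= K).
Hypotheses (eps0 : 0 < eps) (delta0 : 0 < delta).
Hypothesis qE : forall z, qm K E (ball z delta).
Hypothesis densC : forall z r, 0 < r <= delta -> ~ E z ->
  ((eps * r ^+ 2)%:E <= mu (~` E `&` ball z r))%E.
Hypothesis densE : forall z r, 0 < r <= delta -> (0 < mu (E `&` ball z (r / 2)))%E ->
  ((eps * r ^+ 2)%:E <= mu (E `&` ball z r))%E.
Let mE : bset E := bset_open oE.
Let lE := lint_indic mE.

Section scale.
Variables (F : set (plane R)) (z0 : plane R) (h M : R).
Hypotheses (mF : bset F) (FE : F `<=` E) (Fz : F `<=` ball z0 (delta / 2)).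
Hypotheses (h0 : 0 < h) (hd : 10 * h <= delta / 2) (M0 : 0 <= M).
Let H := E `\` F.
Let mH : bset H := bsetD mE mF.
Hypothesis small : forall w, `|w| <= 20 * h -> (mu (cross E F w) <= M%:E)%E.

Let rho := `|z0| + delta / 2 + 9 * h.
Let N := (Num.truncn ((rho + 1) / h)).+1.
Let rN : rho + 1 < N%:R * h.
Proof. by rewrite -ltr_pdivrMr// truncnS_gt. Qed.
Let b0 := eps * (8 * h) ^+ 2.
Let b00 : 0 < b0 := b0_gt0 eps0 h0.
Let r := 10 * h.
Let r0 : 0 < r. Proof. by rewrite mulr_gt0. Qed.
Let v := grid N h (density_ratio E F h N).
Let cv : c1 v := c1_grid N h (density_ratio E F h N).
Let h8 : 8 * h <= delta.
Proof. by move: hd h0; lra. Qed.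

Let vsupp y : v y != 0 -> ball z0 (delta / 2 + 9 * h) y.
Proof. by move=> vy; exact: (grid_supp h0 Fz vy). Qed.

Let ball_rho y (s : R) : ball z0 s y -> `|y| < `|z0| + s.
Proof.
rewrite -ball_normE /= => zy; have -> : y = z0 - (z0 - y) by rewrite subKr.
by rewrite (le_lt_trans (ler_normB _ _))// ltrD2l.
Qed.

Let v0 y : ~ ball 0 rho y -> v y = 0.
Proof.
move=> nb; apply/eqP/negPn/negP => vy; apply: nb; rewrite plane_norm_lt.
by rewrite /rho -addrA; exact: ball_rho (vsupp vy).
Qed.

Let sg : bsupp (gradsum v) := bsupp_gradsum cv v0.
(** Two directions, the Lipschitz constant 8 / h of the hats, at most 16 nodes, and the squared
    lower bound [b0] of the masses of E. *)
Let kappa := 2 * (8 / h * (16 / b0 ^+ 2)).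

Let kappa0 : 0 <= kappa.
Proof.
have i1 : 0 <= 8 / h by rewrite divr_ge0// ltW.
have i2 : 0 <= 16 / b0 ^+ 2 by rewrite divr_ge0// sqr_ge0.
by rewrite /kappa; apply: mulr_ge0 => //; exact: mulr_ge0.
Qed.

Let grad_pt y : E y -> gradsum v y <= kappa * (mass F y r * mass H y r).
Proof.
move=> Ey; have m0 : 0 <= mass F y r * mass H y r by rewrite mulr_ge0 ?mass_ge0.
have [yN|yN] := ltP `|y| (N%:R * h); last first.
  have D0 e : 'D_e v y = 0.
    apply: (derive_supp e cv v0); rewrite plane_norm_lt => yr.
    by move: rN yN yr; lra.
  by rewrite /gradsum !D0 normr0 addr0; exact: mulr_ge0.
have n1 : `|((1, 0) : plane R)| = 1 by rewrite plane_normE /= normr0 normr1; apply/max_idPl.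
have n2 : `|((0, 1) : plane R)| = 1 by rewrite plane_normE /= normr0 normr1; apply/max_idPr.
have d1 := grid_derive_le oE mF FE eps0 h0 h8 densE (1, 0) Ey yN.
have d2 := grid_derive_le oE mF FE eps0 h0 h8 densE (0, 1) Ey yN.
rewrite n1 mulr1 in d1; rewrite n2 mulr1 in d2.
apply: (le_trans (lerD d1 d2)); rewrite -/b0 -/H -/r /kappa.
set m := mass F y r * mass H y r.
by rewrite le_eqVlt; apply/orP; left; apply/eqP; ring.
Qed.

Let cross_FH w : ball 0 (2 * r) w -> (mu (F `&` [set x | H (x + w)%R]) <= M%:E)%E.
Proof. by rewrite plane_norm_lt => /ltW wr; apply: small; move: wr; rewrite /r; lra. Qed.

Let cross_HF w : ball 0 (2 * r) w -> (mu (H `&` [set x | F (x + w)%R]) <= M%:E)%E.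
Proof.
rewrite plane_norm_lt => /ltW wr.
have mX := bset_cross mE mF (- w).
have -> : H `&` [set x | F (x + w)] = [set x | cross E F (- w) (x + w)].
  apply/seteqP; split=> x; first by move=> [Hx Fx]; split => //=; rewrite addrK.
  by move=> [Fx /=]; rewrite addrK => Hx; split.
apply: (@le_trans _ _ (mu (cross E F (- w)))); last first.
  by apply: small; rewrite normrN; move: wr; rewrite /r; lra.
by rewrite le_eqVlt; apply/orP; left; apply/eqP; exact: mu_shift.
Qed.

Let M0e : (0 <= M%:E)%E. Proof. by rewrite lee_fin. Qed.
Let r2 : 0 <= 2 * r. Proof. by rewrite mulr_ge0// ltW. Qed.

(** The product of masses in [grad_pt] counts pairs of a point of [F] and a point of [H] in
    [ball y r]. Integrated over [y], each point of [F] is counted (2 r)^2 times, its partner lies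
    within 2 r of it, and [tonelli_ball] bounds such pairs by [M]. *)
Lemma grad_le : Iw \1_E (gradsum v) <=
  kappa * (M * (2 * (2 * r)) ^+ 2 * (2 * r) ^+ 2).
Proof.
pose q x := mu (H `&` ball x (2 * r)).
have mq : measurable_fun setT (q : mplane R -> \bar R) by exact: measurable_ball_mass.
have q0 x : (0 <= q x)%E by exact: measure_ge0.
have [mT tT] := tonelli_weight mF (ltW r0) mq q0.
have TB : (\int[mu]_(x in F) q x <= M%:E * ((2 * (2 * r)) ^+ 2)%:E)%E.
  exact: tonelli_ball.
pose g y := (\int[mu]_(x in F `&` ball y r) q x)%E.
have g0 y : (0 <= g y)%E by apply: integral_ge0 => x _; exact: q0.
have pt y : E y -> ((gradsum v y)%:E <= kappa%:E * g y)%E.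
  move=> Ey; apply: (@le_trans _ _ (kappa%:E * (mass F y r * mass H y r)%:E)%E).
    by rewrite -EFinM lee_fin; exact: grad_pt.
  apply: lee_pmul => //; first by rewrite lee_fin mulr_ge0 ?mass_ge0.
  have mFb : bset (F `&` ball y r) by apply: bsetI => //; exact: bset_ball.
  have -> : ((mass F y r * mass H y r)%:E = \int[mu]_(x in F `&` ball y r) cst (mass H y r)%:E x)%E.
    rewrite integral_cst//; transitivity ((mass H y r)%:E * mu (F `&` ball y r))%E => //.
    by rewrite (massE y r mF) -EFinM mulrC.
  apply: ge0_le_integral.
  - exact: mFb.
  - by move=> x _; rewrite lee_fin mass_ge0.
  - exact: measurable_cst.
  - exact: measurable_funTS.
  - move=> x [_ yx]; rewrite /= -(massE y r mH); apply: mu_le.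
    + by apply: bsetI => //; exact: bset_ball.
    + by apply: bsetI => //; exact: bset_ball.
    + move=> t [Ht yt]; split => //; have -> : 2 * r = r + r by ring.
      by apply: ball_triangle yt; exact: ball_sym.
rewrite -lee_fin -(Iw_lint lE sg).
apply: (@le_trans _ _ (\int[mu]_y (kappa%:E * g y))%E).
  apply: ge0_le_integral.
  - exact: measurableT.
  - by move=> y _; rewrite lee_fin mulr_ge0 ?indic_nonneg ?gradsum_ge0.
  - by apply: (@mEFin _ (fun y => \1_E y * gradsum v y)); apply: bfunM; [exact: bfun_indic|exact: sg.1].
  - by apply: emeasurable_funM => //; exact: measurable_cst.
  - move=> y _; have [Ey|nEy] := pselect (E y).
      by rewrite (indic1 Ey) mul1r; exact: pt.
    by rewrite (indic0 nEy) mul0r mule_ge0// lee_fin.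
rewrite (ge0_integralZl _ measurableT mT (fun y _ => g0 y)); last by rewrite lee_fin.
rewrite [leRHS]EFinM; apply: lee_wpmul2l; first by rewrite lee_fin.
rewrite /g tT; under eq_integral do rewrite muleC.
rewrite (ge0_integralZl _ mF (measurable_funTS mq) (fun y _ => q0 y)); last by rewrite lee_fin sqr_ge0.
rewrite [leRHS]EFinM [leRHS]muleC; apply: lee_wpmul2l; first by rewrite lee_fin sqr_ge0.
by rewrite EFinM.
Qed.

(** It vanishes where v <= 1/2 and is 1 where v = 1. Its support is thus in {3 v > 1} with a margin,
    at the price of a factor 4 in the gradient. *)
Let tau y := step (2 * v y - 1).

Let tau_arg : c1 (fun y => 2 * v y - 1).
Proof. exact: (c1B (c1M (c1_cst 2) cv) (c1_cst 1)). Qed.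

Let ctau : c1 tau := c1_step tau_arg.

Let grad_tau y : gradsum tau y <= 4 * gradsum v y.
Proof.
have D e : `|'D_e tau y| <= 4 * `|'D_e v y|.
  rewrite (derive_step e y tau_arg) normrM.
  have -> : 'D_e (fun y => 2 * v y - 1) y = 2 * 'D_e v y.
    have -> : (fun y => 2 * v y - 1) = (cst 2 \* v) \+ cst (- 1) by [].
    rewrite (c1_deriveD e y (c1M (c1_cst 2) cv) (c1_cst (- 1))) derive_cst addr0.
    by rewrite (c1_deriveM e y (c1_cst 2) cv) derive_cst mulr0 addr0.
  have b := step'_bound (2 * v y - 1).
  rewrite [X in _ * X]normrM normr_nat mulrA.
  apply: ler_wpM2r; first exact: normr_ge0.
  have -> : 4 = 2 * 2 :> R by ring.
  exact: ler_wpM2r.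
by rewrite /gradsum mulrDr lerD.
Qed.

(** The integral of tau div phi is that of div (tau phi) minus that of grad tau . phi. Since
    [smul tau phi] is a test field of {3 v > 1}, [varle_gt1] for 3 v bounds the first by 16 K * 3
    times the integral of |grad v|; the second is bounded by 4 times it. *)
Lemma smoothed_le phi : test_field setT phi ->
  Iw \1_E (fun y => tau y * divergence phi y) <= (16 * K * 3 + 4) * Iw \1_E (gradsum v).
Proof.
move=> tphi; pose v3 y := 3 * v y.
have cv3 : c1 v3 by exact: (c1M (c1_cst 3) cv).
have v3B : compactly_contained [set y | v3 y != 0] (ball z0 delta).
  pose C := [set y | `|z0 - y| <= delta / 2 + 9 * h].
  apply: (@compactly_contained_closed _ _ C _ (rho + 1)).
  - move=> y /= vy; have /vsupp : v y != 0 by apply: contra_neq vy => v0'; rewrite /v3 v0' mulr0.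
    by rewrite -ball_normE /C /= => /ltW.
  - apply: (@closed_sublevel _ (fun y => `|z0 - y|)) => y.
    apply: (@continuous_comp _ _ _ (fun y : plane R => z0 - y) (fun t : plane R => `|t|)); last exact: norm_continuous.
    by apply: cvgB; [exact: cvg_cst|exact: cvg_id].
  - by move=> y; rewrite /C -ball_normE /= => /le_lt_trans; apply; move: hd h0; lra.
  - move=> y yC; rewrite plane_norm_lt; apply: (@lt_le_trans _ _ (`|z0| + (delta / 2 + 9 * h + 1))).
      by apply: ball_rho; rewrite -ball_normE /=; apply: (le_lt_trans yC); rewrite ltrDl.
    by rewrite /rho !addrA.
have vg := varle_gt1 K0 mE vE (@qE z0) cv3 v3B.
have tau01 y : 0 <= tau y <= 1 by rewrite /tau step_ge0 step_le1.
have cc := c1_continuous cv.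
have ts : test_field [set y | 1 < v3 y] (smul tau phi).
  apply: (test_field_smul (L := [set y | 2^-1 <= v y]) tphi ctau tau01).
  - exact: closed_superlevel.
  - move=> y ty /=; rewrite leNgt; apply/negP => vy; move/negP: ty; apply; apply/eqP.
    by rewrite /tau step_le0//; move: vy; lra.
  - by move=> y [/= vy _]; rewrite /v3; move: vy; lra.
have sd := bsupp_divergence tphi; have ss := bsupp_divergence ts.
have st : bsupp (fun y => tau y * divergence phi y).
  have : bsupp (divergence phi \* tau).
    apply: bsuppM => //; first by apply: bfun_continuous; exact: c1_continuous.
    by exists 1 => y; have /andP[? ?] := tau01 y; rewrite ger0_norm.
  by congr bsupp; apply/funext => y /=; rewrite mulrC.
have -> : Iw \1_E (fun y => tau y * divergence phi y) = Iw \1_E (divergence (smul tau phi)) -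
    Iw \1_E (divergence (smul tau phi) \- (fun y => tau y * divergence phi y)).
  by rewrite (IwB lE ss st) subKr.
have g3 : Iw \1_E (gradsum v3) = 3 * Iw \1_E (gradsum v).
  rewrite -(IwZ 3 lE sg); apply: eq_Iw => y.
  have D e : 'D_e v3 y = 3 * 'D_e v y.
    by rewrite (c1_deriveM e y (c1_cst 3) cv) derive_cst mulr0 addr0.
  have E3 (a : R) : `|3 * a| = 3 * `|a| by rewrite normrM normr_nat.
  by rewrite /gradsum mulrDr; congr (_ + _); rewrite -E3; congr (`|_|); exact: D.
have h1 := vg _ ts; rewrite g3 in h1.
have h2 : - Iw \1_E (divergence (smul tau phi) \- (fun y => tau y * divergence phi y)) <=
    4 * Iw \1_E (gradsum v).
  have sdiff := bsuppB ss st.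
  rewrite -mulN1r -(IwZ (-1) lE sdiff) -(IwZ 4 lE sg).
  apply: (Iw_le lE (bsuppZ _ sdiff) (bsuppZ _ sg)); first by move=> y; exact: indic_nonneg.
  move=> y; rewrite mulN1r; apply: le_trans (grad_tau y).
  apply: (le_trans (ler_norm _)); rewrite normrN /=.
  by rewrite (divergence_smul y tphi ctau) addrC addKr; exact: (dot_grad_le _ _ tphi).
by apply: (le_trans (lerD h1 h2)); rewrite [leRHS]mulrDl mulrA.
Qed.

Let tau_lip y s : tau y = step (2 * v y - 1) -> `|tau y - step (2 * s - 1)| <= 4 * `|v y - s|.
Proof.
move=> ->; apply: (le_trans (step_lip _ _)).
have -> : 2 * v y - 1 - (2 * s - 1) = 2 * (v y - s) by ring.
by rewrite normrM normr_nat mulrA -natrM.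
Qed.

(** [tau] differs from the indicator of [F] by at most 4 times the mass of the opposite phase over
    [b0], on [F] and on [H] alike; [tonelli_ball] integrates these masses. With [M] of order h the
    error is of order h. *)
Lemma smoothed_cvg phi (S : R) : test_field setT phi -> (forall y, `|divergence phi y| <= S) ->
  Iw \1_F (divergence phi) <= Iw \1_E (fun y => tau y * divergence phi y) +
    4 * S / b0 * (M * (2 * r) ^+ 2 + M * (2 * r) ^+ 2).
Proof.
move=> tphi dS; have S0 : 0 <= S by apply: le_trans (dS 0).
have sd := bsupp_divergence tphi.
pose g y := (\1_F y - tau y) * divergence phi y.
have st : bsupp (fun y => tau y * divergence phi y).
  have : bsupp (divergence phi \* tau).
    apply: bsuppM => //; first by apply: bfun_continuous; exact: c1_continuous.
    by exists 1 => y; rewrite ger0_norm ?step_ge0 ?step_le1.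
  by congr bsupp; apply/funext => y /=; rewrite mulrC.
have s1 : bsupp (fun y => \1_F y * divergence phi y).
  have : bsupp (divergence phi \* \1_F).
    apply: bsuppM => //; first exact: bfun_indic.
    by exists 1 => y; rewrite indicE; case: (_ \in _); rewrite ?normr0 ?normr1.
  by congr bsupp; apply/funext => y /=; rewrite mulrC.
have sgg : bsupp g.
  have := bsuppB s1 st; congr bsupp; apply/funext => y /=.
  by rewrite /g mulrBl.
have -> : Iw \1_F (divergence phi) = Iw \1_E (fun y => \1_F y * divergence phi y).
  rewrite /Iw; apply: eq_Rintegral => y _; rewrite mulrA; congr (_ * _).
  have [Fy|nFy] := pselect (F y); last by rewrite (indic0 nFy) mulr0.
  by rewrite (indic1 Fy) (indic1 (FE Fy)) mulr1.
rewrite addrC -lerBlDr -(IwB lE s1 st).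
apply: (@le_trans _ _ (Iw \1_E g)).
  by rewrite le_eqVlt; apply/orP; left; apply/eqP; apply: eq_Iw => y /=; rewrite /g mulrBl.
apply: (le_trans (ler_norm _)); rewrite -lee_fin; apply: (le_trans (Iw_abs_le lE sgg)).
have c0 : 0 <= 4 * S / b0 by rewrite divr_ge0 ?mulr_ge0// ltW.
pose p1 : plane R -> \bar R := (fun y => mu (H `&` ball y r)) \_ F.
pose p2 : plane R -> \bar R := (fun y => mu (F `&` ball y r)) \_ H.
have mp1 : measurable_fun setT (p1 : mplane R -> \bar R).
  by apply/(measurable_restrictT _ mF); apply: measurable_funTS; exact: measurable_ball_mass.
have mp2 : measurable_fun setT (p2 : mplane R -> \bar R).
  by apply/(measurable_restrictT _ mH); apply: measurable_funTS; exact: measurable_ball_mass.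
have p10 y : (0 <= p1 y)%E by rewrite /p1 patchE; case: ifP => // _; exact: measure_ge0.
have p20 y : (0 <= p2 y)%E by rewrite /p2 patchE; case: ifP => // _; exact: measure_ge0.
have rr w : ball 0 r w -> ball 0 (2 * r) w by apply: le_ball; move: r0; lra.
have i1 : (\int[mu]_y p1 y <= (M * (2 * r) ^+ 2)%:E)%E.
  rewrite -integral_mkcond EFinM; apply: (tonelli_ball mF mH (ltW r0) M0e) => w wr.
  exact: (cross_FH (rr _ wr)).
have i2 : (\int[mu]_y p2 y <= (M * (2 * r) ^+ 2)%:E)%E.
  rewrite -integral_mkcond EFinM; apply: (tonelli_ball mH mF (ltW r0) M0e) => w wr.
  exact: (cross_HF (rr _ wr)).
apply: (le_trans _ (ge0_integral_comb_le mp1 mp2 p10 p20 i1 i2 c0)).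
apply: ge0_le_integral.
- exact: measurableT.
- by move=> y _; rewrite lee_fin mulr_ge0.
- apply: (@mEFin _ (fun y => `|\1_E y| * `|g y|)).
  by apply: bfunM; apply: bfun_norm; [exact: bfun_indic|exact: sgg.1].
- apply: emeasurable_funM; first exact: measurable_cst.
  exact: (emeasurable_funD mp1 mp2).
move=> y _; have [Ey|nEy] := pselect (E y); last first.
  rewrite (indic0 nEy) normr0 mul0r; apply: mule_ge0; first by rewrite lee_fin.
  by apply: adde_ge0.
have b0i : 0 <= b0^-1 by rewrite invr_ge0 ltW.
have fin (a q : R) : `|\1_F y - tau y| <= 4 * (a / b0) -> 0 <= a -> q = a ->
    ((`|\1_E y| * `|g y|)%:E <= (4 * S / b0)%:E * q%:E)%E.
  move=> h1 a0 ->; rewrite -EFinM lee_fin (indic1 Ey) normr1 mul1r /g normrM.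
  have -> : 4 * S / b0 * a = 4 * (a / b0) * S by ring.
  by apply: ler_pM.
have [Fy|nFy] := pselect (F y).
  have nHy : ~ H y by move=> [_].
  rewrite /p1 /p2 !patchE (mem_set Fy) (memNset nHy) adde0 (massE y r mH).
  apply: (fin (mass H y r)) => //; last exact: mass_ge0.
  rewrite (indic1 Fy) distrC.
  have yN : `|y| <= N%:R * h.
    apply: ltW; apply: lt_trans (ball_rho (Fz Fy)) _.
    by move: rN h0; rewrite /rho; lra.
  have := tau_lip 1 (erefl (tau y)).
  have -> : step (2 * 1 - 1) = 1 :> R by rewrite step_ge1//; lra.
  move/le_trans; apply; apply: ler_wpM2l => //; rewrite distrC ger0_norm.
    exact: (grid_ge_mass oE mF FE eps0 h0 h8 densE Ey yN).
  by rewrite subr_ge0; apply: grid_le1 => // i j; exact: density_ratio_le1.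
have Hy : H y by [].
rewrite /p1 /p2 !patchE (mem_set Hy) (memNset nFy) add0e (massE y r mF).
apply: (fin (mass F y r)) => //; last exact: mass_ge0.
rewrite (indic0 nFy) sub0r normrN.
have := tau_lip 0 (erefl (tau y)).
have -> : step (2 * 0 - 1) = 0 :> R by rewrite step_le0//; lra.
rewrite subr0 => /le_trans; apply; apply: ler_wpM2l => //; rewrite subr0 ger0_norm.
  exact: (grid_le_mass N oE mF FE eps0 h0 h8 densE Ey).
by apply: grid_ge0 => i j; exact: density_ratio_ge0.
Qed.

Lemma scale_step phi (S : R) : test_field setT phi -> (forall y, `|divergence phi y| <= S) ->
  Iw \1_F (divergence phi) <=
  (16 * K * 3 + 4) * (2 * (8 / h * (16 / (eps * (8 * h) ^+ 2) ^+ 2)) *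
     (M * (2 * (2 * (10 * h))) ^+ 2 * (2 * (10 * h)) ^+ 2)) +
  4 * S / (eps * (8 * h) ^+ 2) * (M * (2 * (10 * h)) ^+ 2 + M * (2 * (10 * h)) ^+ 2).
Proof.
move=> tphi dS; apply: (le_trans (smoothed_cvg tphi dS)); rewrite lerD2r.
apply: (le_trans (smoothed_le tphi)); apply: ler_wpM2l; last exact: grad_le.
by rewrite addr_ge0// !mulr_ge0.
Qed.

End scale.

(** Homogeneity of the gradient term: with [M = m h] all powers of the mesh cancel. *)
Lemma scale_const (a b c d g h m e : R) : 0 < h -> 0 < e -> g != 0 ->
  2 * (a / h * (b / (e * (g * h) ^+ 2) ^+ 2)) * ((m * h) * (2 * (2 * (c * h))) ^+ 2 * (2 * (c * h)) ^+ 2) =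
  2 * (a * (b / (e * g ^+ 2) ^+ 2)) * ((2 * (2 * c)) ^+ 2 * (2 * c) ^+ 2) * m.
Proof. by move=> h0 e0 g0; field; rewrite g0 !gt_eqF. Qed.

(** In the error term one power of h remains, so it vanishes in the limit. *)
Lemma scale_const2 (S c g h m e : R) : 0 < h -> 0 < e -> g != 0 ->
  4 * S / (e * (g * h) ^+ 2) * (m * h * (2 * (c * h)) ^+ 2 + m * h * (2 * (c * h)) ^+ 2) =
  4 * S / (e * g ^+ 2) * ((2 * c) ^+ 2 + (2 * c) ^+ 2) * m * h.
Proof. by move=> h0 e0 g0; field; rewrite g0 !gt_eqF. Qed.

Let C1 : R := (16 * K * 3 + 4) * (2 * (8 * (16 / (eps * 8 ^+ 2) ^+ 2)) *
  ((2 * (2 * 10)) ^+ 2 * (2 * 10) ^+ 2)).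

Lemma set_extension : exists2 C : R, 0 <= C & forall F p z0, bset F -> F `<=` E ->
  F `<=` ball z0 (delta / 2) -> varle \1_F E p -> varle \1_F setT (C * p).
Proof.
have C10 : 0 <= C1.
  rewrite /C1; apply: mulr_ge0; first by rewrite addr_ge0// !mulr_ge0.
  apply: mulr_ge0; last by apply: mulr_ge0; exact: sqr_ge0.
  by apply: mulr_ge0 => //; apply: mulr_ge0 => //; apply: divr_ge0 => //; exact: sqr_ge0.
exists (C1 * (2 * 20)) => [|F p z0 mF FE Fz vF phi tphi]; first by apply: mulr_ge0.
have p0 := varle_ge0 vF.
(* [S] depends on the field, hence so does the scale chosen below; the constant of the final bound
   does not. *)
have [_ [S [_ [S0 dS _]]]] := bsupp_divergence tphi.
apply/ler_addgt0Pr => e e0.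
pose eta := e / 2 / (C1 + 1).
have eta0 : 0 < eta by rewrite !divr_gt0// ltr_wpDl.
(* The bound of [cross_small] for translations up to 20 h, that is 2 r with r = 10 h; it is linear
   in [p], and [eta] disappears in the end. *)
pose m := 2 * 20 * p + eta; have m0 : 0 < m by rewrite ltr_wpDl// !mulr_ge0.
pose C2 := 4 * S / (eps * 8 ^+ 2) * ((2 * 10) ^+ 2 + (2 * 10) ^+ 2) * m.
have C20 : 0 <= C2.
  rewrite /C2; apply: mulr_ge0; last exact: ltW.
  apply: mulr_ge0; last by apply: addr_ge0; exact: sqr_ge0.
  apply: divr_ge0; first exact: mulr_ge0.
  by apply: mulr_ge0; [exact: ltW|exact: sqr_ge0].
have M20 : 0 < (20 : R) by [].
have cs := cross_small mE vE eps0 delta0 densC mF FE vF Fz M20 eta0.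
have t0 : 0 < Num.min (delta / 20) (e / 2 / (C2 + 1)).
  by rewrite lt_min divr_gt0//= !divr_gt0// ltr_wpDl.
have sm : \forall k \near \oo, dyad k < Num.min (delta / 20) (e / 2 / (C2 + 1)) :> R.
  have : (2^-1 : R) ^+ n @[n --> \oo] --> 0 by apply: cvg_expr; rewrite gtr0_norm; lra.
  move=> /cvgrPdist_lt/(_ _ t0); apply: filterS => k.
  by rewrite sub0r normrN gtr0_norm ?dyad_gt0.
have FI (Q1 Q2 : nat -> Prop) : (\forall k \near \oo, Q1 k) -> (\forall k \near \oo, Q2 k) ->
    \forall k \near \oo, Q1 k /\ Q2 k by exact: filterI.
have [k [ck]] := filter_ex (FI _ _ cs sm).
set h := dyad k in ck *; have h0 : 0 < h by exact: dyad_gt0.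
rewrite lt_min => /andP[hd he].
have hd' : 10 * h <= delta / 2 by move: hd; lra.
have M0 : 0 <= m * h by rewrite mulr_ge0// ltW.
have := scale_step mF FE Fz h0 hd' M0 ck tphi dS.
rewrite scale_const// scale_const2// (mulrA (16 * K * 3 + 4)) -/C1 -/C2.
move/le_trans; apply.
have E1 : C1 * m <= C1 * (2 * 20) * p + e / 2.
  rewrite /m mulrDr mulrA; rewrite lerD2l /eta mulrA ler_pdivrMr ?ltr_wpDl//.
  by rewrite mulrC; apply: ler_wpM2l; [exact: ltW (divr_gt0 e0 _)|lra].
have E2 : C2 * h <= e / 2.
  apply: (@le_trans _ _ (C2 * (e / 2 / (C2 + 1)))); first by apply: ler_wpM2l => //; exact: ltW.
  rewrite mulrA ler_pdivrMr ?ltr_wpDl// mulrC; apply: ler_wpM2l; last by lra.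
  by rewrite divr_ge0// ltW.
by apply: (le_trans (lerD E1 E2)); rewrite -addrA -splitr.
Qed.

End extension.

Lemma ge0_integral_le_comb d (T : measurableType d) (R : realType)
    (m : {measure set T -> \bar R}) (f1 f2 f3 : T -> \bar R) (a b k c : R) :
  measurable_fun setT f1 -> measurable_fun setT f2 -> measurable_fun setT f3 ->
  (forall t, 0 <= f1 t)%E -> (forall t, 0 <= f2 t)%E -> (forall t, 0 <= f3 t)%E -> 0 <= c ->
  (\int[m]_t f1 t = a%:E)%E -> (\int[m]_t f2 t = b%:E)%E -> (\int[m]_t f3 t <= k%:E)%E ->
  (forall t, f1 t <= f2 t + c%:E * f3 t)%E -> a <= b + c * k.
Proof.
move=> m1 m2 m3 p1 p2 p3 c0 i1 i2 i3 le.
have mc : measurable_fun setT (fun t => c%:E * f3 t)%E.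
  by apply: emeasurable_funM => //; exact: measurable_cst.
have pc t : (0 <= c%:E * f3 t)%E by rewrite mule_ge0.
rewrite -lee_fin -i1 EFinD -i2 EFinM.
apply: (@le_trans _ _ (\int[m]_t (f2 t + c%:E * f3 t)))%E.
  by apply: ge0_le_integral => //; exact: emeasurable_funD.
rewrite ge0_integralD// ge0_integralZl//.
by apply: leeD => //; exact: lee_wpmul2l.
Qed.

(** * Extension of functions *)

Section layers.
Context {R : realType}.
Implicit Types (x y z v : plane R) (A F E : set (plane R)) (w q : plane R -> R).

Definition ppart w x : R := Num.max (w x) 0.

Lemma bfun_ppart w : bfun w -> bfun (ppart w).
Proof. by move=> mw; apply: measurable_maxr => //; exact: measurable_cst. Qed.

Lemma ppart_norm w x : `|ppart w x| <= `|w x|.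
Proof.
rewrite /ppart; have [h|h] := leP (w x) 0; first by rewrite normr0.
by [].
Qed.

Lemma lint_dom w w' : lint w -> bfun w' -> (forall x, `|w' x| <= `|w x|) -> lint w'.
Proof.
move=> [mw iw] mw' ww; split=> // r; apply: le_lt_trans (iw r).
apply: ge0_le_integral.
- exact: bset_ball.
- by move=> x _; rewrite lee_fin.
- by apply: measurable_funTS; apply: mEFin; exact: bfun_norm.
- by apply: measurable_funTS; apply: mEFin; exact: bfun_norm.
- by move=> x _; rewrite lee_fin.
Qed.

(** Cut off at negative [t], so that the integral over [t] gives the positive part of [w]. For t >=
    0 the superlevel sets lie where [w] is nonzero, hence within reach of the extension of sets. *)
Definition layer w q (t : R) : \bar R :=
  if 0 <= t then (\int[mu]_x (\1_(level w t) x * q x)%:E)%E else 0%E.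

Lemma layer_cake_weight w q : bfun w -> bfun q -> (forall x, 0 <= q x) ->
  measurable_fun setT (layer w q : measurableTypeR R -> \bar R) /\
  (\int[lebesgue_measure]_t layer w q t = \int[mu]_x (ppart w x * q x)%:E)%E.
Proof.
move=> mw mq q0.
pose L : set (plane R * R) := [set p | 0 <= p.2 /\ p.2 < w p.1].
have mL : measurable (L : set (mplane R * measurableTypeR R)).
  have m1 : measurable_fun setT ((fun p => w p.1 - p.2) : mplane R * measurableTypeR R -> R).
    apply: measurable_funB; last exact: measurable_snd.
    by apply: (measurableT_comp mw); exact: measurable_fst.
  have m2 : measurable_fun setT ((fun p => p.2) : mplane R * measurableTypeR R -> R).
    exact: measurable_snd.
  have -> : L = (fun p => p.2) @^-1` `[0, +oo[ `&` (fun p => w p.1 - p.2) @^-1` `]0, +oo[.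
    by apply/seteqP; split=> p; rewrite /L /= !in_itv/= !andbT subr_gt0.
  apply: measurableI; rewrite -[X in measurable X]setTI.
    by apply: m2 => //; exact: measurable_itv.
  by apply: m1 => //; exact: measurable_itv.
pose f (p : mplane R * measurableTypeR R) : \bar R := (q p.1 * \1_L p)%:E.
have mf : measurable_fun setT f.
  apply/measurable_EFinP; apply: measurable_funM; last exact: measurable_indic.
  by apply: (measurableT_comp mq); exact: measurable_fst.
have f0 p : (0 <= f p)%E by rewrite lee_fin mulr_ge0.
have G t : layer w q t = fubini_G mu f t.
  rewrite /layer /fubini_G; have [t0|t0] := leP 0 t.
    apply: eq_integral => x _; rewrite /f /= mulrC; congr (_ * _)%:E; rewrite !indicE.
    have [h|h] := pselect (level w t x).
      have hL : L (x, t) by split.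
      by rewrite (mem_set h) (mem_set hL).
    have hL : ~ L (x, t) by move=> [].
    by rewrite (memNset h) (memNset hL).
  rewrite (eq_integral (cst 0%E)) ?integral0// => x _.
  have hL : ~ L (x, t) by move=> [/=]; rewrite leNgt t0.
  by rewrite /f /= indicE (memNset hL) mulr0.
split.
  have -> : layer w q = fubini_G mu f by apply/funext => t; exact: G.
  exact: (@measurable_fun_fubini_tonelli_G _ _ (mplane R) (measurableTypeR R) R mu f mf f0).
transitivity (\int[lebesgue_measure]_t fubini_G mu f t)%E.
  by apply: eq_integral => t _; exact: G.
transitivity (\int[mu]_x fubini_F lebesgue_measure f x)%E.
  exact: (esym (@fubini_tonelli _ _ (mplane R) (measurableTypeR R) R mu lebesgue_measure f mf f0)).
apply: eq_integral => x _; rewrite /fubini_F /f /=.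
have mI : measurable (`[0, w x[%classic : set (measurableTypeR R)) by exact: measurable_itv.
transitivity (\int[lebesgue_measure]_t ((q x)%:E * (\1_(`[0, w x[%classic) t)%:E))%E.
  apply: eq_integral => t _; rewrite -EFinM; congr (_ * _)%:E; rewrite !indicE.
  congr (_%:R); congr nat_of_bool; apply/idP/idP => /set_mem; rewrite /= ?in_itv/=.
    by move=> [t0 tw]; apply/mem_set; rewrite /= in_itv/= t0.
  by move=> /andP[t0 tw]; apply/mem_set.
rewrite ge0_integralZl//.
- rewrite (integral_indic _ measurableT mI) setIT.
  transitivity ((q x)%:E * lebesgue_measure `[0%R, w x[%classic)%E => //.
  rewrite lebesgue_measure_itv/= lte_fin /ppart.
  have [h|h] := ltP 0 (w x).
    by rewrite oppr0 addr0 -EFinM mulrC.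
  by rewrite mule0 mul0r.
- by apply/measurable_EFinP; exact: measurable_indic.
- by rewrite lee_fin.
Qed.

(** The bound for sets is applied to each superlevel set with t >= 0, and the coarea majorant [g] is
    integrated. Since Tonelli is used for nonnegative functions, the divergence is split into
    positive and negative parts and the inequality is kept as one between sums. *)
Lemma ppart_extension E (C : R) z0 (rho : R) w (M : R) : open E -> 0 <= C ->
  (forall F p, bset F -> F `<=` E -> F `<=` ball z0 rho -> varle \1_F E p ->
     varle \1_F setT (C * p)) ->
  lint w -> (forall x, ~ (E `&` ball z0 rho) x -> w x = 0) -> varle w E M ->
  varle (ppart w) setT ((C + 1) * (4 * M)).
Proof.
move=> oE C0 HF lw w0 vw phi tphi.
have mw := lw.1; have M0 := varle_ge0 vw.
have [g [mg g0 ig gP]] := coarea lw oE vw.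
have sd := bsupp_divergence tphi; set d := divergence phi in sd *.
have lp : lint (ppart w).
  by apply: (lint_dom lw); [exact: bfun_ppart|exact: ppart_norm].
have C10 : 0 < C + 1 by rewrite ltr_wpDl.
have key t : 0 <= t -> ((Iw \1_(level w t) d)%:E <= (C + 1)%:E * g t)%E.
  move=> t0; have mt := bset_level t mw.
  (* Here [C + 1] is used in place of [C]: with a zero factor, an infinite [g t] would give the
     bound 0. *)
  have [->|gfin] := eqVneq (g t) +oo%E; first by rewrite gt0_muley ?leey// lte_fin.
  have gf : g t \is a fin_num by rewrite ge0_fin_numE// ltey.
  have sub x : level w t x -> (E `&` ball z0 rho) x.
    move=> wt; apply: contrapT => /w0 wx; move: wt; rewrite /level /= wx.
    by apply/negP; rewrite -leNgt.
  have vt : varle \1_(level w t) E (fine (g t)).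
    by move=> psi tpsi; rewrite -lee_fin (fineK gf); exact: gP.
  rewrite -(fineK gf) -EFinM lee_fin.
  apply: le_trans (HF _ _ mt (fun x h => (sub x h).1) (fun x h => (sub x h).2) vt phi tphi) _.
  by apply: ler_wpM2r; [exact: fine_ge0|rewrite lerDl].
have s1 : bsupp (ppart d).
  case: sd => md [S [r [S0 dS d0]]]; split; first exact: bfun_ppart.
  exists S, r; split => // x; first by apply: le_trans (ppart_norm _ _) (dS x).
  by move=> /d0 dx; rewrite /ppart dx; exact/max_idPl.
have s2 : bsupp (ppart (\- d)%R).
  case: (bsuppN sd) => md [S [r [S0 dS d0]]]; split; first exact: bfun_ppart.
  exists S, r; split => // x; first by apply: le_trans (ppart_norm _ _) (dS x).
  by move=> /d0 dx; rewrite /ppart dx; exact/max_idPl.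
have dE : d = ppart d \- ppart (\- d).
  apply/funext => x; rewrite /ppart /=.
  by have [h|h] := leP (d x) 0; have [h'|h'] := leP (- d x) 0; move: h h'; lra.
have pp (f : plane R -> R) x : 0 <= ppart f x by rewrite /ppart le_max lexx orbT.
have [m1 i1] := layer_cake_weight mw s1.1 (pp d).
have [m2 i2] := layer_cake_weight mw s2.1 (pp (\- d)%R).
have le t : (layer w (ppart d) t <= layer w (ppart (\- d)%R) t + (C + 1)%:E * g t)%E.
  rewrite /layer; have [t0|t0] := leP 0 t; last first.
    by rewrite add0e mule_ge0// lee_fin ltW.
  have lt := lint_indic (bset_level t mw).
  rewrite (Iw_lint lt s1) (Iw_lint lt s2).
  have := key t t0; rewrite [X in Iw _ X]dE (IwB lt s1 s2) EFinB.
  by rewrite leeBlDr// addeC.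
have iA := Iw_lint lp s1; have iB := Iw_lint lp s2.
have l0 q t : (forall x, 0 <= q x) -> (0 <= layer w q t)%E.
  move=> q0; rewrite /layer; case: ifP => // _; apply: integral_ge0 => x _.
  by rewrite lee_fin mulr_ge0 ?indic_nonneg.
have := ge0_integral_le_comb m1 m2 mg (fun t => l0 _ t (pp _)) (fun t => l0 _ t (pp _)) g0
  (ltW C10) (etrans i1 iA) (etrans i2 iB) ig le.
by rewrite [X in _ -> Iw _ X <= _]dE (IwB lp s1 s2) lerBlDl.
Qed.

(** [w] is the positive part of [w] minus that of [- w]; both have variation at most [M] in [E]
    before taking parts, hence the doubled constant. *)
Lemma bv_extension E (C : R) z0 (rho : R) w (M : R) : open E -> 0 <= C ->
  (forall F p, bset F -> F `<=` E -> F `<=` ball z0 rho -> varle \1_F E p ->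
     varle \1_F setT (C * p)) ->
  lint w -> (forall x, ~ (E `&` ball z0 rho) x -> w x = 0) -> varle w E M ->
  varle w setT ((C + 1) * (4 * M) + (C + 1) * (4 * M)).
Proof.
move=> oE C0 HF lw w0 vw phi tphi.
have tN U psi : test_field U psi -> test_field U (fun x => (-1) *: psi x).
  case=> /C1P[c1f c2f] cc ep; split.
  - apply/C1P; split.
    + exact: (c1M (c1_cst (-1)) c1f).
    + exact: (c1M (c1_cst (-1)) c2f).
  - apply: (compactly_contained_sub _ (@subset_refl _ _) cc) => x /=.
    by apply: contra_neq => ->; rewrite scaler0.
  - by move=> x; rewrite enormZ normrN normr1 mul1r.
have dN U psi : test_field U psi ->
    divergence (fun x => (-1) *: psi x) = fun x => (-1) * divergence psi x.
  move=> tp; apply/funext => x; rewrite (@divergence_smul _ U psi (cst (-1)) x tp (c1_cst (-1))).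
  by rewrite !derive_cst !mul0r !addr0.
have mwN : bfun (\- w) by apply: measurable_funN; exact: lw.1.
have lwN : lint (\- w) by apply: (lint_dom lw) => // x; rewrite normrN.
have IwN (f : plane R -> R) u : Iw (\- u) f = Iw u (fun x => (-1) * f x).
  by rewrite /Iw; apply: eq_Rintegral => x _ /=; ring.
have vwN : varle (\- w) E M.
  by move=> psi tpsi; rewrite IwN -(dN E psi tpsi); apply: vw; exact: tN.
have w0N x : ~ (E `&` ball z0 rho) x -> (\- w) x = 0 by move=> /w0 /= ->; rewrite oppr0.
have h1 := ppart_extension oE C0 HF lw w0 vw tphi.
have h2 := ppart_extension oE C0 HF lwN w0N vwN (tN _ _ tphi).
rewrite (dN setT) in h2 => //.
have sd := bsupp_divergence tphi.
have l1 : lint (ppart w) by apply: (lint_dom lw); [apply: bfun_ppart; exact: lw.1|exact: ppart_norm].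
have l2 : lint (ppart (\- w)) by apply: (lint_dom lwN); [exact: bfun_ppart|exact: ppart_norm].
suff -> : Iw w (divergence phi) = Iw (ppart w) (divergence phi) +
    Iw (ppart (\- w)) (fun x => (-1) * divergence phi x) by exact: lerD.
rewrite /Iw -RintegralD//; last 2 first.
- exact: (lint_integrable l1 sd).
- exact: (lint_integrable l2 (bsuppZ (-1) sd)).
apply: eq_Rintegral => x _; rewrite /ppart /=.
have [h|h] := leP (w x) 0.
  have -> : Num.max (- w x) 0 = - w x by apply/max_idPl; rewrite oppr_ge0.
  by ring.
have -> : Num.max (- w x) 0 = 0 by apply/max_idPr; rewrite oppr_le0 ltW.
by ring.
Qed.

End layers.

(** * Lebesgue measurable sets and Borel sets *)

Notation lmeas E := (lebesgue_measurable E).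

Section versions.
Context {R : realType}.
Implicit Types (A B E X : set (plane R)).

Lemma lmeas_bset A : bset A -> lmeas A.
Proof. move=> mA; apply: (@sub_caratheodory _ _ _ (@mu R) A).
by apply: sub_sigma_algebra; exact: mA. Qed.

Lemma lebesgue2_bset A : bset A -> lebesgue2 A = mu A.
Proof. by move=> mA; exact: (measurable_mu_extE (@mu R)). Qed.

Lemma lebesgue2_le A B : A `<=` B -> (lebesgue2 A <= lebesgue2 B)%E.
Proof. exact: (le_outer_measure (@mu R)^*%mu). Qed.

Lemma lebesgue2_cover X (e : R) : 0 < e -> lebesgue2 X \is a fin_num ->
  exists A, [/\ bset A, X `<=` A & (mu A <= lebesgue2 X + e%:E)%E].
Proof.
move=> e0 fX.
have [_/= [A XA <-] lt] := lb_ereal_inf_adherent e0 fX.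
exists (\bigcup_k A k); split.
- by apply: bigcupT_measurable => k; have [/(_ k)] := XA.
- by have [_] := XA.
apply: le_trans (ltW lt); rewrite -lebesgue2_bset; last first.
  by apply: bigcupT_measurable => k; have [/(_ k)] := XA.
apply: (le_trans (outer_measure_sigma_subadditive (@mu R)^*%mu A)).
apply: lee_nneseries => // n _.
have mA : bset (A n) by have [/(_ n)] := XA.
by rewrite -[leLHS]/(lebesgue2 (A n)) lebesgue2_bset.
Qed.

(** The intersection of countable covers whose measures exceed that of [X] by less and less. *)
Lemma lebesgue2_hull X : exists A, [/\ bset A, X `<=` A & (lebesgue2 A <= lebesgue2 X)%E].
Proof.
have [fX|] := boolP (lebesgue2 X \is a fin_num); last first.
  rewrite ge0_fin_numE; last exact: outer_measure_ge0.
  rewrite -leNgt leye_eq => /eqP ->; exists setT; split => //; last by rewrite leey.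
  exact: measurableT.
have inv0 n : (0 < n.+1%:R^-1 :> R)%R by rewrite invr_gt0.
have /choice[A hA] n := lebesgue2_cover (inv0 n) fX.
exists (\bigcap_n A n); split.
- by apply: bigcapT_measurable => n; have [] := hA n.
- by apply: sub_bigcap => n _; have [] := hA n.
apply/lee_addgt0Pr => e e0.
have [n ne] := ex_natSinv_lt e0.
have [mA XA leA] := hA n.
apply: (le_trans (lebesgue2_le (@bigcap_inf _ _ n setT A I))).
rewrite (lebesgue2_bset mA); apply: (le_trans leA).
by rewrite leeD2l// lee_fin ltW.
Qed.

(** A Borel representative: E itself is only Lebesgue measurable, whereas translations and Tonelli
    are used for Borel sets. *)
Definition version E A : Prop :=
  [/\ bset A, lebesgue2 (E `\` A) = 0%E & lebesgue2 (A `\` E) = 0%E].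

Lemma lebesgue2_null_bigcup (N : (set (plane R))^nat) :
  (forall n, lebesgue2 (N n) = 0%E) -> lebesgue2 (\bigcup_n N n) = 0%E.
Proof.
move=> N0; apply/eqP; rewrite eq_le; apply/andP; split; last exact: outer_measure_ge0.
apply: (le_trans (outer_measure_sigma_subadditive (@mu R)^*%mu N)).
by rewrite eseries0// => n _ _; exact: N0.
Qed.

Lemma lebesgue2_null_sub A B : A `<=` B -> lebesgue2 B = 0%E -> lebesgue2 A = 0%E.
Proof.
move=> AB B0; apply/eqP; rewrite eq_le; apply/andP; split; last exact: outer_measure_ge0.
by rewrite -B0; exact: lebesgue2_le.
Qed.

Lemma lebesgue2_nullU A B : lebesgue2 A = 0%E -> lebesgue2 B = 0%E ->
  lebesgue2 (A `|` B) = 0%E.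
Proof.
move=> A0 B0; apply: (@lebesgue2_null_sub _ (\bigcup_n (if n is 0%N then A else B))).
  by move=> x [Ax|Bx]; [exists 0%N|exists 1%N].
by apply: lebesgue2_null_bigcup => -[|n].
Qed.

Lemma lmeas_null A : lebesgue2 A = 0%E -> lmeas A.
Proof.
move=> A0; apply: le_caratheodory_measurable => X.
apply: (@le_trans _ _ (lebesgue2 A + (@mu R)^*%mu (X `&` ~` A))%E).
  by rewrite leeD2r//; apply: lebesgue2_le; exact: subIsetr.
by rewrite A0 add0e le_outer_measure//; exact: subIsetl.
Qed.

(** E is cut into bounded pieces, since the hull exceeds its set by a null set only when measures
    can be subtracted. *)
Lemma version_exists E : lmeas E -> exists A, version E A.
Proof.
move=> mE.
pose Eb n := E `&` ball (0 : plane R) n%:R.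
have mEb n : lmeas (Eb n).
  by apply: measurableI => //; apply: lmeas_bset; exact: bset_ball.
have /choice[A hA] n := lebesgue2_hull (Eb n).
have A0 n : lebesgue2 (A n `\` Eb n) = 0%E.
  have [mA EA leA] := hA n.
  have fE : (lebesgue2 (Eb n) < +oo)%E.
    apply: (le_lt_trans (lebesgue2_le (@subIsetr _ _ _))).
    by rewrite lebesgue2_bset ?mu_ball ?ltry//; exact: bset_ball.
  have fA : (lebesgue2 (A n) < +oo)%E by exact: le_lt_trans leA fE.
  have D := measureD (lmeas_bset mA) (mEb n) fA.
  apply: (etrans D); rewrite setIidr// -[LHS]/(lebesgue2 (A n) - lebesgue2 (Eb n))%E.
  have -> : lebesgue2 (A n) = lebesgue2 (Eb n).
    by apply/eqP; rewrite eq_le leA; exact: lebesgue2_le.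
  rewrite subee// ge0_fin_numE//; exact: outer_measure_ge0.
exists (\bigcup_n A n); split.
- by apply: bigcupT_measurable => n; have [] := hA n.
- rewrite (_ : _ `\` _ = set0); first exact: outer_measure0.
  apply/seteqP; split => // x [Ex]; apply.
  exists (Num.truncn `|x|).+1 => //; have [_ + _] := hA (Num.truncn `|x|).+1; apply.
  split; first exact: Ex.
  by rewrite -ball_normE /= sub0r normrN truncnS_gt.
apply: (@lebesgue2_null_sub _ (\bigcup_n (A n `\` Eb n))); last exact: lebesgue2_null_bigcup.
by move=> x [[n _ Anx] nEx]; exists n => //; split => // -[].
Qed.

Notation cplane := (caratheodory_type (@mu R)^*%mu).

Lemma measurable_id_cplane : measurable_fun setT (id : cplane -> mplane R).
Proof. by move=> _ B mB; rewrite setTI; exact: lmeas_bset. Qed.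

Lemma cmeasurable (f : plane R -> \bar R) : measurable_fun setT (f : mplane R -> \bar R) ->
  measurable_fun setT (f : cplane -> \bar R).
Proof. by move=> mf; exact: (measurableT_comp mf measurable_id_cplane). Qed.

Lemma ge0_integral_lebesgue2 (f : plane R -> \bar R) :
  measurable_fun setT (f : mplane R -> \bar R) -> (forall x, 0 <= f x)%E ->
  (\int[lebesgue2]_x f x = \int[mu]_x f x)%E.
Proof.
move=> mf f0.
pose s : {mfun cplane >-> mplane R} :=
  HB.pack (id : cplane -> mplane R) (isMeasurableFun.Build _ _ _ _ _ measurable_id_cplane).
transitivity (\int[pushforward (@lebesgue2 R) s]_x f x)%E.
  by rewrite (ge0_integral_pushforward measurable_id_cplane (@lebesgue2 R) measurableT mf).
by apply: eq_measure_integral => A mA _; exact: lebesgue2_bset.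
Qed.

Lemma integral_lebesgue2 (f : plane R -> \bar R) :
  measurable_fun setT (f : mplane R -> \bar R) ->
  (\int[lebesgue2]_x f x = \int[mu]_x f x)%E.
Proof.
move=> mf; rewrite [LHS]integralE [RHS]integralE; congr (_ - _)%E.
- by apply: ge0_integral_lebesgue2 => //; exact: measurable_funepos.
- by apply: ge0_integral_lebesgue2 => //; exact: measurable_funeneg.
Qed.

Lemma ae_null (P : plane R -> Prop) : lebesgue2 (~` [set x | P x]) = 0%E ->
  {ae lebesgue2, forall x, P x}.
Proof.
by move=> N0; exists (~` [set x | P x]); split => //; exact: (lmeas_null N0).
Qed.

(** Completeness of [lebesgue2] supplies the measurability of [f \_ D], which agrees with the Borel
    function [w] off the null set [N]. *)
Lemma integral_version (D N : set (plane R)) (f w : plane R -> \bar R) :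
  measurable_fun setT (w : mplane R -> \bar R) -> lebesgue2 N = 0%E ->
  (forall x, ~ N x -> (f \_ D) x = w x) ->
  (\int[lebesgue2]_(x in D) f x = \int[mu]_x w x)%E.
Proof.
move=> mw N0 fw; rewrite integral_mkcond -integral_lebesgue2//.
have ae : ae_eq (@lebesgue2 R) setT (f \_ D) w.
  apply: ae_null; apply: lebesgue2_null_sub N0 => x /= h.
  by apply: contrapT => nN; apply: h => _; exact: fw.
apply: (@ae_eq_integral _ cplane R (@lebesgue2 R) setT w (f \_ D) measurableT _ _ ae).
- apply: (@ae_measurable_fun _ cplane R (@lebesgue2 R) _ setT w); last exact: cmeasurable.
    exact: measure_is_complete_caratheodory.
  exact: ae_eq_sym ae.
- exact: cmeasurable.
Qed.

(** [w x] is the supremum of the rationals q such that x lies in a Borel version of {f > q}; off the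
    countable union [N] of the errors these are exactly the rationals below f x. *)
Lemma borel_fun_version (f : plane R -> R) :
  measurable_fun setT (f : cplane -> R) ->
  exists N w, [/\ lebesgue2 N = 0%E, bfun w & forall x, ~ N x -> f x = w x].
Proof.
move=> mf.
have /choice[B hB] (q : rat) : exists B, version (f @^-1` `]ratr q, +oo[) B.
  apply: version_exists; rewrite /lebesgue_measurable -[X in measurable X]setTI.
  exact: (mf measurableT _ (measurable_itv _)).
pose N := \bigcup_n (if unpickle n is Some q then
   (f @^-1` `]ratr q, +oo[ `\` B q) `|` (B q `\` f @^-1` `]ratr q, +oo[) else set0).
have N0 : lebesgue2 N = 0%E.
  apply: lebesgue2_null_bigcup => n; case: (unpickle n) => [q|]; last exact: outer_measure0.
  by have [_ ? ?] := hB q; exact: lebesgue2_nullU.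
pose g n x : \bar R := if unpickle n is Some q then
   (if x \in B q then (ratr q)%:E else -oo)%E else -oo%E.
have mg n : measurable_fun setT (g n : mplane R -> \bar R).
  rewrite /g; case: (unpickle n) => [q|]; last exact: measurable_cst.
  apply: measurable_fun_if => //; try exact: measurable_cst.
  apply: (@measurable_fun_bool _ _ _ _ true); rewrite setTI.
  rewrite (_ : _ @^-1` _ = B q); first by have [] := hB q.
  by apply/seteqP; split => x /=; [move=> /set_mem|move=> /mem_set].
exists N, (fun x => fine (esups (g^~ x) 0)); split => //.
  apply: (measurableT_comp (@fine_measurable R setT measurableT)).
  exact: (@measurable_fun_esups _ (mplane R) R setT g mg 0%N).
move=> x nN; change (f x = fine (esups (g^~ x) 0%N)).
have hN (q : rat) : B q x <-> ratr q < f x.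
  have nq : ~ ((f @^-1` `]ratr q, +oo[ `\` B q) `|` (B q `\` f @^-1` `]ratr q, +oo[)) x.
    by move=> h; apply: nN; exists (pickle q); [exact: I|rewrite pickleK; exact: h].
  split => [Bx|lt].
    apply: contrapT => nlt; apply: nq; right; split => //=.
    by rewrite in_itv/= andbT.
  apply: contrapT => nB; apply: nq; left; split => //=.
  by rewrite in_itv/= andbT.
suff -> : esups (g^~ x) 0 = (f x)%:E by [].
apply/eqP; rewrite eq_le; apply/andP; split.
  apply: ge_ereal_sup => _ [n _ <-]; rewrite /g.
  case: (unpickle n) => [q|]; last exact: leNye.
  case: ifPn => [/set_mem/hN lt|_]; last exact: leNye.
  by rewrite lee_fin ltW.
rewrite leNgt; apply/negP => lt.
have [y /andP[y1 y2]] : exists y : R, ((esups (g^~ x) 0%N < y%:E) && (y%:E < (f x)%:E))%E.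
  move: lt; case: (esups _ _) => [r| |]//= lt.
    by exists ((r + f x) / 2); rewrite !lte_fin in lt *; apply/andP; split; lra.
  by exists (f x - 1); rewrite ltNyr lte_fin; lra.
rewrite lte_fin in y2; have [q] := rat_in_itvoo y2; rewrite in_itv/= => /andP[q1 q2].
have : ((ratr q)%:E <= esups (g^~ x) 0%N)%E.
  apply: ereal_sup_ubound; exists (pickle q); first exact: leq0n.
  by rewrite /g pickleK (mem_set ((hN q).2 q2)).
by rewrite leNgt => /negP; apply; apply: (lt_trans y1); rewrite lte_fin.
Qed.

End versions.

(** * From Lebesgue measurable to Borel data *)

Section transfer.
Context {R : realType}.
Implicit Types (x y z : plane R) (A B E F G U V : set (plane R)).

Lemma integral_field D N U (u w : plane R -> R) phi : lint w -> test_field U phi ->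
  lebesgue2 N = 0%E -> (forall x, ~ N x -> (u \_ D) x = w x) ->
  (\int[lebesgue2]_(x in D) (u x * divergence phi x)%:E = (Iw w (divergence phi))%:E)%E.
Proof.
move=> lw tphi N0 uw; rewrite -(Iw_lint lw (bsupp_divergence tphi)).
apply: (integral_version _ N0).
  by apply: (@mEFin _ (w \* divergence phi)); apply: bfunM; [exact: lw.1|exact: (bsupp_divergence tphi).1].
move=> x /uw <-; rewrite !patchE; case: ifP => // _.
by rewrite mul0r.
Qed.

Lemma variationP D N (u w : plane R -> R) (M : R) : lint w -> lebesgue2 N = 0%E ->
  (forall x, ~ N x -> (u \_ D) x = w x) -> ((Defs.variation u D <= M%:E)%E <-> varle w D M).
Proof.
move=> lw N0 uw; split.
  move=> h phi tphi; rewrite -lee_fin -(integral_field lw tphi N0 uw).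
  by apply: le_trans h; apply: ereal_sup_ubound; exists phi.
move=> h; apply: ge_ereal_sup => _ [phi tphi <-].
by rewrite (integral_field lw tphi N0 uw) lee_fin; exact: h.
Qed.

Lemma integral_div E A U phi : version E A -> test_field U phi ->
  (\int[lebesgue2]_(x in E) (divergence phi x)%:E = (Iw \1_A (divergence phi))%:E)%E.
Proof.
move=> [mA EA AE] tphi.
rewrite -(@integral_field E ((E `\` A) `|` (A `\` E)) U (cst 1) \1_A phi (lint_indic mA) tphi).
- by apply: eq_integral => x _; rewrite mul1r.
- exact: lebesgue2_nullU.
move=> x nx; rewrite patchE; have [Ex|nEx] := pselect (E x).
  rewrite (mem_set Ex) indic1//; apply: contrapT => nAx; apply: nx; left; exact: (conj Ex nAx).
rewrite (memNset nEx) indic0// => Ax; apply: nx; right; exact: (conj Ax nEx).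
Qed.

Lemma perimeterP E A U (M : R) : version E A ->
  ((perimeter E U <= M%:E)%E <-> varle \1_A U M).
Proof.
move=> vA; split.
  move=> h phi tphi; rewrite -lee_fin -(integral_div vA tphi).
  by apply: le_trans h; apply: ereal_sup_ubound; exists phi.
move=> h; apply: ge_ereal_sup => _ [phi tphi <-].
by rewrite (integral_div vA tphi) lee_fin; exact: h.
Qed.

Lemma perimeter_ge0 E A U : version E A -> (0 <= perimeter E U)%E.
Proof.
move=> vA; have <- : (\int[lebesgue2]_(x in E) (divergence (cst 0) x)%:E = 0)%E.
  by rewrite (integral_div vA (test_field0 U)) divergence0 Iw0.
by apply: ereal_sup_ubound; exists (cst 0) => //; exact: test_field0.
Qed.

Lemma closed_borel G : closed G -> borel G.
Proof.
move=> cG; rewrite -(setCK G) -setTD; apply: sigma_algebraCD.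
by apply: sub_sigma_algebra; exact: closed_openC.
Qed.

Lemma closed_bset G : closed G -> bset G.
Proof. by move=> cG; rewrite -(setCK G); apply: bsetC; apply: bset_open; exact: closed_openC. Qed.

Lemma borel0 : borel (set0 : set (plane R)).
Proof. exact: sigma_algebra0. Qed.

Lemma compactly_contained0 U : compactly_contained set0 U.
Proof. by rewrite /compactly_contained closure0; split => //; exact: compact0. Qed.

Lemma version_diff E A G : bset G -> version E A -> version (E `\` G) (A `\` G).
Proof.
move=> mG [mA EA AE]; split; first exact: bsetD.
- apply: lebesgue2_null_sub EA => x [[Ex nG] h]; split; first exact: Ex.
  by move=> Ax; apply: h; exact: (conj Ax nG).
- apply: lebesgue2_null_sub AE => x [[Ax nG] h]; split; first exact: Ax.
  by move=> Ex; apply: h; exact: (conj Ex nG).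
Qed.

Lemma version_union E A G : bset G -> version E A -> version (E `|` G) (A `|` G).
Proof.
move=> mG [mA EA AE]; split; first exact: bsetU.
- apply: lebesgue2_null_sub EA => x [[Ex|Gx] h]; last by case: h; right.
  by split; [exact: Ex|move=> Ax; apply: h; left].
- apply: lebesgue2_null_sub AE => x [[Ax|Gx] h]; last by case: h; right.
  by split; [exact: Ax|move=> Ex; apply: h; left].
Qed.

Definition qm2 (K : R) A B : Prop := qm K A B /\ qm K (~` A) B.

Lemma qm2_sub (K : R) A B B' : B `<=` B' -> qm2 K A B' -> qm2 K A B.
Proof.
move=> BB' [q1 q2]; split.
- by move=> U G M oU UB; apply: q1 => //; exact: (compactly_contained_sub _ BB' UB).
- by move=> U G M oU UB; apply: q2 => //; exact: (compactly_contained_sub _ BB' UB).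
Qed.

(** Removing [G] from the complement of [A] is adding [G] to [A], so both halves are instances of
    the definition, with one of its two sets empty. The sign of [K] is not given, hence
    [Num.max K 0]. *)
Lemma quasiminimal_qm2 (K : R) E A B : version E A -> quasiminimal K E B ->
  qm2 (Num.max K 0) A B.
Proof.
move=> vA [_ q].
have qF U F X X' (M : R) : version X X' -> (perimeter E U <= K%:E * perimeter X U)%E ->
    varle \1_X' U M -> varle \1_A U (Num.max K 0 * M).
  move=> vX h vM; apply/(perimeterP _ _ vA); apply: (le_trans h).
  apply: (@le_trans _ _ ((Num.max K 0)%:E * perimeter X U)%E).
    by apply: lee_wpmul2r; [exact: perimeter_ge0 vX|rewrite lee_fin le_max lexx].
  rewrite EFinM; apply: lee_wpmul2l; first by rewrite lee_fin le_max lexx orbT.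
  exact/(perimeterP _ _ vX).
have mA : bset A by have [] := vA.
split=> U G M oU UB cG GU vM; have mG := closed_bset cG.
  apply: (qF U set0 _ _ _ (version_diff mG vA) _ vM).
  have := q U set0 G oU UB borel0 (compactly_contained0 U) (closed_borel cG) GU.
  by rewrite setU0.
apply: varleC => //; apply: (qF U set0 _ _ _ (version_union mG vA)).
  have := q U G set0 oU UB (closed_borel cG) GU borel0 (compactly_contained0 U).
  by rewrite setD0.
have mD : bset (~` A `\` G) by apply: bsetD => //; exact: bsetC.
have := varleC mD vM; rewrite (_ : ~` (~` A `\` G) = A `|` G)//.
by rewrite setDE setCI !setCK.
Qed.

(** On a segment in the ball the interior of E coincides with its closure, so its trace is
    relatively open and closed; segments are connected and balls convex. *)
Lemma ball_no_boundary E z (r : R) : ball z r `&` boundary E = set0 ->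
  ball z r `<=` E \/ ball z r `&` E = set0.
Proof.
move=> bE.
have cE x : ball z r x -> closure E x -> E^° x.
  by move=> zx cx; apply: contrapT => nx; rewrite -[False]/(set0 x) -bE; split.
have [[p [zp Ep]]|nE] := pselect (exists p, ball z r p /\ E p); last first.
  by right; apply/seteqP; split => // x [zx Ex]; apply: nE; exists x.
left=> y zy; apply: interior_subset.
pose f (t : R) : plane R := p + t *: (y - p).
have cf : continuous f.
  move=> t; apply: cvgD; first exact: cvg_cst.
  by apply: cvgZ; [exact: cvg_id|exact: cvg_cst].
have cI : connected (f @` `[0, 1]).
  apply: connected_continuous_connected; first exact: segment_connected.
  exact: continuous_subspaceT.
have fb t : `[0, 1]%classic t -> ball z r (f t).
  rewrite /= in_itv/= => /andP[t0 t1].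
  move: zp zy; rewrite -!ball_normE /= => zp zy.
  have -> : z - f t = (1 - t) *: (z - p) + t *: (z - y).
    by rewrite /f; apply/eqP; rewrite -pair_eqE; apply/andP; split; apply/eqP => /=;
      rewrite /GRing.scale /=; ring.
  apply: (le_lt_trans (ler_normD _ _)); rewrite !normrZ (ger0_norm t0) ger0_norm ?subr_ge0//.
  have [->|tn0] := eqVneq t 0; first by rewrite subr0 mul1r mul0r addr0.
  have tp : 0 < t by rewrite lt_def tn0.
  have a1 : (1 - t) * `|z - p| <= (1 - t) * r by rewrite ler_wpM2l ?subr_ge0// ltW.
  have a2 : t * `|z - y| < t * r by rewrite ltr_pM2l.
  lra.
have e : f @` `[0, 1] `&` E^° = f @` `[0, 1].
  apply: cI.
  - exists p; split; first by exists 0; [rewrite /= in_itv/= lexx ler01|rewrite /f scale0r addr0].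
    by apply: cE => //; exact: subset_closure.
  - by exists E^° => //; exact: open_interior.
  - exists (closure E); first exact: closed_closure.
    apply/seteqP; split => x [Ix Ex]; split => //.
      by apply: subset_closure; exact: interior_subset.
    by apply: cE => //; have [t t01 <-] := Ix; exact: fb.
have : (f @` `[0, 1]) y.
  by exists 1; [rewrite /= in_itv/= lexx ler01|rewrite /f scale1r addrC subrK].
by rewrite -e => -[].
Qed.

Lemma divergence_out U phi x : test_field U phi -> ~ U x -> divergence phi x = 0.
Proof.
move=> [_ [_ ccU] _] nx.
have nK : (~` closure [set x | phi x != 0]) x by move=> /ccU.
have near0 : \forall y \near x, phi y = 0.
  have /nbhs_ballP[e /= e0 eK] : nbhs x (~` closure [set x | phi x != 0]).
    by apply: open_nbhs_nbhs; split => //; apply: closed_openC; exact: closed_closure.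
  apply/nbhs_ballP; exists e => //= y /eK ny; apply/eqP; apply: contrapT => /negP h.
  by apply: ny; exact: subset_closure.
have D (f : plane R -> R) v : (\forall y \near x, f y = 0) -> 'D_v f x = 0.
  by move=> f0; rewrite (@near_eq_derive _ _ _ f (cst 0)) ?derive_cst.
rewrite /divergence !D ?addr0//.
  by apply: filterS near0 => y ->.
by apply: filterS near0 => y ->.
Qed.

(** In such a ball the perimeter of [A] is 0, because divergences of fields supported there have
    integral 0. *)
Lemma qm2_trivial (K : R) E A z (r : R) : 0 <= K -> version E A ->
  ball z r `<=` E \/ ball z r `&` E = set0 -> qm2 K A (ball z r).
Proof.
move=> K0 vA h; have mA : bset A by have [] := vA.
have l1 : lint (cst (1 : R)).
  by apply: (@lint_bounded _ _ 1); [exact: bfun_cst|move=> x /=; rewrite normr1].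
have v0 U : compactly_contained U (ball z r) -> varle \1_A U 0.
  move=> Ub phi tphi; rewrite -lee_fin -(integral_div vA tphi).
  have tB : test_field (ball z r) phi.
    by apply: test_field_sub tphi => x Ux; apply: Ub.2; exact: subset_closure.
  have d0 x : ~ ball z r x -> divergence phi x = 0.
    move=> nx; exact: (divergence_out tB nx).
  case: h => h.
    rewrite -(Iw1_divergence tphi) -(Iw_lint l1 (bsupp_divergence tphi)).
    rewrite (@integral_version _ E set0 _ (fun x => (1 * divergence phi x)%:E)) ?outer_measure0//.
      by apply: (@mEFin _ (cst 1 \* divergence phi)); apply: bfunM l1.1 (bsupp_divergence tphi).1.
    move=> x _; rewrite patchE mul1r; have [Ex|nEx] := pselect (E x); first by rewrite (mem_set Ex).
    by rewrite (memNset nEx) d0// => /h.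
  rewrite (eq_integral (fun=> 0%E)) ?integral0// => x /set_mem Ex.
  rewrite d0// => zx; have : set0 x by rewrite -h. by [].
split=> U G M oU Ub cG GU vM.
  by apply: varle_le (v0 U Ub); rewrite mulr_ge0// (varle_ge0 vM).
apply: varleC => //; apply: varle_le (v0 U Ub).
by rewrite mulr_ge0// (varle_ge0 vM).
Qed.

Lemma eball_half x (r : R) : ball x (r / 2) `<=` eball x r.
Proof.
move=> y; rewrite -ball_normE /= => xy; rewrite /eball /=.
by apply: (le_lt_trans (enorm_le _)); rewrite distrC mulrC -ltr_pdivlMr.
Qed.

(** One radius for all centres, on the boundary or not: a half-size ball that meets the boundary
    lies in a ball centred on it, and the others are trivial. When E is bounded with radii depending
    on the point, the boundary is compact. *)
Lemma quasiminimal_uniform (K : R) E A : version E A -> locally_quasiminimizing K E ->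
  exists2 d : R, 0 < d & forall z, qm2 (Num.max K 0) A (ball z d).
Proof.
move=> vA [_ hE]; have K0 : 0 <= Num.max K 0 by rewrite le_max lexx orbT.
suff [d d0 hd] : exists2 d : R, 0 < d & forall x, boundary E x -> qm2 (Num.max K 0) A (ball x d).
  exists (d / 2) => [|z]; first by rewrite divr_gt0.
  have [[x [zx bx]]|nx] := pselect (exists x, ball z (d / 2) x /\ boundary E x).
    apply: qm2_sub (hd x bx) => y zy.
    by rewrite [d]splitr; apply: ball_triangle zy; exact: ball_sym.
  apply: (qm2_trivial K0 vA); apply: ball_no_boundary; apply/seteqP; split => // x [zx bx].
  by apply: nx; exists x.
case: hE => [[d d0 hd]|[bE hd]].
  exists (d / 2) => [|x bx]; first by rewrite divr_gt0.
  by apply: qm2_sub (quasiminimal_qm2 vA (hd x bx)); exact: eball_half.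
have [r Er] : exists r : R, E `<=` ball 0 r.
  have [M [_ EM]] := bE; exists (`|M| + 2) => x Ex; rewrite plane_norm_lt.
  have : `|x| <= `|M| + 1 by apply: EM => //; have := ler_norm M; lra.
  lra.
have cb : compact (boundary E).
  apply: (@plane_compact _ _ (r + 1)).
    apply: closedI; first exact: closed_closure.
    by rewrite closedC; exact: open_interior.
  move=> x [/(_ (ball x 1) (nbhsx_ballx x 1 ltr01))[y [Ey xy]] _].
  have := ball_triangle (Er _ Ey) (ball_sym xy); exact.
move: cb => /compact_near_coveringP/(_ _ (0^'+ : set_system R)
  (fun d x => qm2 (Num.max K 0) A (ball x d)) _)[x bx|].
  have [d d0 qd] := hd x bx.
  have q2 := qm2_sub (@eball_half x d) (quasiminimal_qm2 vA qd).
  exists (ball x (d / 4), [set e : R | e < d / 4]).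
    split => /=; first by apply: nbhsx_ballx; rewrite divr_gt0.
    exact: nbhs_right_lt (divr_gt0 d0 _).
  move=> [y e] [/= xy ed]; apply: qm2_sub q2 => p yp.
  have := ball_triangle xy (le_ball (ltW ed) yp); congr (ball _ _ _); lra.
move=> d0 /= d0p H; exists (d0 / 2); first by rewrite divr_gt0.
have d2 : 0 < d0 / 2 by rewrite divr_gt0.
apply: (H (d0 / 2) _ d2); rewrite /= sub0r normrN (gtr0_norm d2).
by rewrite [ltRHS]splitr ltrDl.
Qed.

End transfer.

(** * The open representative *)

Section normalization.
Context {R : realType}.
Implicit Types (x y z : plane R) (A B E F G U V : set (plane R)).

(** Passes from Euclidean balls and E to balls of the sup norm and a Borel version; the two kinds of
    balls are nested up to a factor 2. *)
Lemma ess_interiorP E A z : version E A ->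
  ess_interior E z <-> exists2 r : R, 0 < r & mu (ball z r `\` A) = 0%E.
Proof.
move=> [mA EA AE]; have mD r : bset (ball z r `\` A) by exact: bsetD (bset_ball _ _) mA.
split=> -[r r0 h]; [exists (r / 2)|exists r] => //; first by rewrite divr_gt0.
  rewrite -lebesgue2_bset//; apply: lebesgue2_null_sub (lebesgue2_nullU h EA) => x [zx nA].
  have [Ex|nE] := pselect (E x); [right|left]; split => //.
  exact: eball_half.
rewrite -lebesgue2_bset// in h.
apply: lebesgue2_null_sub (lebesgue2_nullU h AE) => x [zx nE].
have [Ax|nA] := pselect (A x); [right|left]; split => //.
exact: eball_sub_ball.
Qed.

Lemma open_ess_interior E A : version E A -> open (ess_interior E).
Proof.
move=> vA; rewrite openE => z /(ess_interiorP _ vA)[r r0 h].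
apply/nbhs_ballP; exists (r / 2) => /=; first by rewrite divr_gt0.
move=> y zy; apply/(ess_interiorP _ vA); exists (r / 2); first by rewrite divr_gt0.
have mA : bset A by have [] := vA.
apply/eqP; rewrite eq_le measure_ge0 andbT -h; apply: mu_le.
- exact: bsetD (bset_ball _ _) mA.
- exact: bsetD (bset_ball _ _) mA.
- by move=> x [yx nA]; split => //; rewrite [r]splitr; exact: ball_triangle yx.
Qed.

(** The essential interior is covered by the countably many rational balls that lie in [A] up to a
    null set. *)
Lemma mu_ess_interiorD E A : version E A -> mu (ess_interior E `\` A) = 0%E.
Proof.
move=> vA; have mA : bset A by have [] := vA.
have mO : bset (ess_interior E) by apply: bset_open; exact: open_ess_interior vA.
pose Q (B : set (plane R)) := lebesgue2 (B `\` A) = 0%E.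
have QS B B' : B `<=` B' -> Q B' -> Q B.
  by move=> BB'; apply: lebesgue2_null_sub => x [Bx nA]; split => //; exact: BB'.
rewrite -lebesgue2_bset; last exact: bsetD.
apply: (@lebesgue2_null_sub _ _ (\bigcup_n (if unpickle n is Some q then
   (if `[< Q (rball q) >] then rball q `\` A else set0) else set0))).
  move=> x [/(ess_interiorP _ vA)[r r0 h] nA].
  have [|q Qq qx] := ex_rball QS r0 (x := x).
    by rewrite /Q lebesgue2_bset//; exact: bsetD (bset_ball _ _) mA.
  exists (pickle q); first exact: I.
  by rewrite pickleK (asboolT Qq); split.
apply: lebesgue2_null_bigcup => n; case: (unpickle n) => [q|]; last exact: outer_measure0.
by case: ifP => [/asboolP//|_]; exact: outer_measure0.
Qed.

Section dens.
Variables (E A : set (plane R)) (P K eps d : R).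
Hypotheses (vA : version E A) (pA : varle \1_A setT P).
Hypotheses (eps0 : 0 < eps) (d0 : 0 < d) (qA : forall z, qm2 K A (ball z d)).
Hypothesis dens : forall A B P z r, bset A -> varle \1_A setT P -> qm K A B ->
  0 < r -> ball z r `<=` B -> (mu (A `&` ball z r) <= (eps * r ^+ 2)%:E)%E ->
  mu (A `&` ball z (r / 2)) = 0%E.
Let mA : bset A. Proof. by have [] := vA. Qed.

(** Failure of the bound would, by [density] for the complement, make [A] fill the half ball up to a
    null set, and then z would be an essential interior point. *)
Lemma density_compl z r : 0 < r <= d -> ~ ess_interior E z ->
  ((eps * r ^+ 2)%:E <= mu (~` A `&` ball z r))%E.
Proof.
move=> /andP[r0 rd] nz; rewrite leNgt; apply/negP => /ltW le; apply: nz.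
apply/(ess_interiorP _ vA); exists (r / 2); first by rewrite divr_gt0.
rewrite setDE setIC; apply: (dens (bsetC mA) (varleC mA pA) (qA z).2 r0 _ le).
exact: le_ball.
Qed.

Lemma density_set z r : 0 < r <= d -> (0 < mu (A `&` ball z (r / 2)))%E ->
  ((eps * r ^+ 2)%:E <= mu (A `&` ball z r))%E.
Proof.
move=> /andP[r0 rd] nz; rewrite leNgt; apply/negP => /ltW le.
move: nz; rewrite (dens mA pA (qA z).1 r0 _ le) ?ltxx//; exact: le_ball.
Qed.

(** The part of [A] outside the essential interior lies in the collar of every width h, where [A]
    has measure O(h) by [collar_E]. *)
Lemma version_ess_interior : version E (ess_interior E).
Proof.
have oO := open_ess_interior vA; have mO := bset_open oO.
have [_ EA AE] := vA.
have AO : lebesgue2 (A `\` ess_interior E) = 0%E.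
  have mAO := bsetD mA mO.
  rewrite lebesgue2_bset//; apply/eqP; rewrite eq_le measure_ge0 andbT.
  apply/lee_addgt0Pr => e e0; rewrite add0e.
  have P0 := varle_ge0 pA.
  pose c := 16 / eps * (2 * P * 2).
  have c0 : 0 <= c by rewrite !mulr_ge0// invr_ge0 ltW.
  pose h := Num.min d (e / (c + 1)).
  have c1 : 0 < c + 1 by rewrite ltr_wpDl.
  have h0 : 0 < h by rewrite lt_min d0 divr_gt0.
  have hd : 0 < h <= d by rewrite h0 ge_min lexx.
  have che : c * h <= e.
    have : h <= e / (c + 1) by rewrite ge_min lexx orbT.
    rewrite ler_pdivlMr// mulrDr mulr1 mulrC; move: h0; lra.
  apply: (@le_trans _ _ (mu (A `&` collar (ess_interior E) h))).
    apply: mu_le => //.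
      by apply: bsetI => //; apply: bset_open; exact: open_collar.
    by move=> x [Ax nO]; split => //; exists x => //; exact: ballxx.
  apply: (le_trans (collar_E mA pA eps0 density_compl hd)).
  by rewrite lee_fin; apply: le_trans che; rewrite /c -!mulrA lexx.
split => //.
  apply: lebesgue2_null_sub (lebesgue2_nullU EA AO) => x [Ex nO].
  by have [Ax|nA] := pselect (A x); [right|left].
have OA : lebesgue2 (ess_interior E `\` A) = 0%E.
  by rewrite lebesgue2_bset; [exact: mu_ess_interiorD vA|exact: bsetD].
apply: lebesgue2_null_sub (lebesgue2_nullU OA AE) => x [Ox nE].
by have [Ax|nA] := pselect (A x); [right|left].
Qed.

End dens.

Lemma quasiminimizing_set_extension (K : R) E : locally_quasiminimizing K E ->
  exists C rho : R, [/\ 0 <= C, 0 < rho, version E (ess_interior E), open (ess_interior E) &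
    forall F p z, bset F -> F `<=` ess_interior E -> F `<=` ball z rho ->
      varle \1_F (ess_interior E) p -> varle \1_F setT (C * p)].
Proof.
move=> hE; have [[mE pE] _] := hE.
have K0 : 0 <= Num.max K 0 by rewrite le_max lexx orbT.
have [A vA] := version_exists mE.
have [eps eps0 dens] := density K0.
have fP : perimeter E setT \is a fin_num by rewrite ge0_fin_numE//; exact: perimeter_ge0 vA.
have perP B : version E B -> varle \1_B setT (fine (perimeter E setT)).
  by move=> vB; apply/(perimeterP _ _ vB); rewrite fineK.
have [d1 d10 q1] := quasiminimal_uniform vA hE.
have vO := version_ess_interior vA (perP A vA) eps0 d10 q1 dens.
have oO := open_ess_interior vA.
(* Quasiminimality is derived again, now for the representative [ess_interior E]: the extension of
   sets requires an open set, and [A] was only an auxiliary Borel version. *)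
have [d d0 qO] := quasiminimal_uniform vO hE.
have [C C0 HC] := set_extension oO (perP _ vO) K0 eps0 d0 (fun z => (qO z).1)
  (density_compl vO (perP _ vO) qO dens) (density_set vO (perP _ vO) qO dens).
by exists C, (d / 2); split => //; rewrite divr_gt0.
Qed.

Lemma integrable_version E u : lmeas E -> lebesgue2.-integrable E (EFin \o u) ->
  exists N w, [/\ lebesgue2 N = 0%E, bfun w, (\int[mu]_x `|w x|%:E < +oo)%E &
    forall x, ~ N x -> (u \_ E) x = w x].
Proof.
move=> mE /integrableP[/measurable_EFinP mu' iu].
have mr : measurable_fun setT (u \_ E : caratheodory_type (@mu R)^*%mu -> R).
  exact/(measurable_restrictT _ mE).
have [N [w [N0 mw uw]]] := borel_fun_version mr.
exists N, w; split => //.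
rewrite -(@integral_version _ E N (fun x => `|u x|%:E) (fun x => `|w x|%:E)) => //.
  by apply: (@mEFin _ (fun x => `|w x|)); exact: bfun_norm.
move=> x /uw <-; rewrite !patchE; case: ifP => // _.
by rewrite normr0.
Qed.

End normalization.

Theorem corollary4 (R : realType) (K : R) (E : set (plane R))
    (hE : locally_quasiminimizing K E) :
  BVl_extension_domain E.
Proof.
have [[mE pE] _] := hE.
have [C [rho [C0 rho0 vO oO HC]]] := quasiminimizing_set_extension hE.
have mO := bset_open oO.
split => //.
pose c := (C + 1) * 4 + (C + 1) * 4.
have c4 : 0 <= (C + 1) * 4 by rewrite mulr_ge0// addr_ge0.
(* The summand 1 ensures that the constant is at least 1, as the definition demands. *)
exists (1 + c), rho; split => //; first by rewrite lerDl addr_ge0.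
move=> u [iu vu] du.
(* Any point of E where u is nonzero can serve as centre: the diameter of the support is below
   [rho]. If u vanishes on E the centre is arbitrary. *)
have [z0 hz0] : exists z0, forall x, E x -> u x != 0 -> ball z0 rho x.
  have [[z [Ez uz]]|nz] := pselect (exists z, E z /\ u z != 0); last first.
    by exists 0 => x Ex ux; case: nz; exists x.
  exists z => x Ex ux; apply: (eball_sub_ball rho0); rewrite /eball /= -lte_fin.
  apply: le_lt_trans du; apply: ereal_sup_ubound.
  by exists x; [apply: subset_closure|exists z => //; apply: subset_closure].
have [N0 [w0 [N00 mw0 iw0 uw0]]] := integrable_version mE iu.
have [_ EO OE] := vO.
pose N := N0 `|` ((E `\` ess_interior E) `|` (ess_interior E `\` E)).
have NN0 : lebesgue2 N = 0%E by apply: lebesgue2_nullU => //; exact: lebesgue2_nullU.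
have EOP x : ~ N x -> E x <-> ess_interior E x.
  move=> nN; split => h; apply: contrapT => h'; apply: nN; right; [left|right]; exact: (conj h h').
pose V := ess_interior E `&` ball z0 rho.
have mV : bset V by exact: bsetI mO (bset_ball z0 rho).
(* [bv_extension] asks for a Borel function that vanishes off [V] everywhere; [w0] does so only up
   to a null set. *)
pose w x := w0 x * \1_V x.
have mw : bfun w by apply: bfunM => //; exact: bfun_indic.
have uw x : ~ N x -> (u \_ E) x = w x.
  move=> nN; rewrite /w -uw0; last by move=> h; apply: nN; left.
  have [Vx|nV] := pselect (V x); first by rewrite indic1// mulr1.
  rewrite indic0// mulr0 patchE; case: ifPn => // /set_mem Ex.
  apply/eqP; apply: contrapT => /negP ux; apply: nV; split; first exact/(EOP x nN).
  exact: hz0.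
have lw : lint w.
  split => // r; apply: le_lt_trans iw0.
  rewrite integral_mkcond; apply: ge0_le_integral => //.
  - by move=> x _; rewrite patchE; case: ifP => // _; rewrite lee_fin.
  - apply/(measurable_restrictT _ (bset_ball (0 : plane R) r)); apply: measurable_funTS.
    by apply: (@mEFin _ (fun x => `|w x|)); exact: bfun_norm.
  - by apply: (@mEFin _ (fun x => `|w0 x|)); exact: bfun_norm.
  - move=> x _; rewrite patchE; case: ifP => _; last by rewrite lee_fin.
    rewrite lee_fin /w normrM ler_piMr//.
    have [Vx|nV] := pselect (V x); first by rewrite indic1// normr1.
    by rewrite indic0// normr0.
have uO x : ~ N x -> (u \_ (ess_interior E)) x = w x.
  move=> nN; rewrite -uw// !patchE.
  have [Ex|nE] := pselect (E x).
    by rewrite (mem_set Ex) (mem_set ((EOP x nN).1 Ex)).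
  by rewrite (memNset nE) (memNset (fun h => nE ((EOP x nN).2 h))).
have v0 : (0 <= Defs.variation u (ess_interior E))%E.
  have <- : (\int[lebesgue2]_(x in ess_interior E) (u x * divergence (cst 0) x)%:E = 0)%E.
    by rewrite (integral_field lw (test_field0 setT) NN0 uO) divergence0 Iw0.
  by apply: ereal_sup_ubound; exists (cst 0) => //; exact: test_field0.
have fv : Defs.variation u (ess_interior E) \is a fin_num by rewrite ge0_fin_numE.
pose M := fine (Defs.variation u (ess_interior E)).
have vM : varle w (ess_interior E) M by apply/(variationP _ lw NN0 uO); rewrite fineK.
have vT : varle w setT ((C + 1) * (4 * M) + (C + 1) * (4 * M)).
  apply: (@bv_extension _ _ C z0 rho w M oO C0 _ lw _ vM).
    by move=> F p mF FE Fz; exact: HC mF FE Fz.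
  by move=> x nV; rewrite /w indic0// mulr0.
have M0 := varle_ge0 vM.
have uT x : ~ N x -> ((u \_ E) \_ setT) x = w x by move=> /uw; rewrite patch_setT.
have le : (Defs.variation (u \_ E) setT <= (1 + c)%:E * Defs.variation u (ess_interior E))%E.
  rewrite -(fineK fv) -EFinM; apply/(variationP _ lw NN0 uT).
  apply: varle_le vT; rewrite -/M [(1 + c) * M]mulrDl mul1r [c * M]mulrDl -[(C + 1) * 4 * M]mulrA.
  by rewrite lerDr.
exists (u \_ E); split; [split|exact: le|].
- rewrite (_ : EFin \o u \_ E = (EFin \o u) \_ E).
    exact: (integrable_mkcond _ mE).1 iu.
  by apply/funext => x; rewrite /= !patchE; case: ifP.
- rewrite ess_interiorT; apply: le_lt_trans le _.
  by rewrite -(fineK fv) -EFinM ltry.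
- by apply: aeW => x Ex; rewrite patchE (mem_set Ex).
Qed.
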